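(* Let $G$ be an abelian group and $\mathbb{F}$ a field. (1) If $\mathcal{B}$ is a $G$-graded-central-simple algebra over $\mathbb{F}$, then there exist a subgroup $H$ of $G$, an algebra $\mathcal{A}$ graded by $\overline{G}=G/H$ which is central simple as an ungraded algebra, and $\tau\in\mathrm{Z}^2_{\mathrm{sym}}(G,\mathbb{F}^\times)$ such that $\mathcal{B}\simeq_G L^\tau_\pi(\mathcal{A})$, where $\pi:G\to\overline{G}$ is the canonical projection. (2) Conversely, if $H\le G$, $\mathcal{A}$ is a central simple $\overline{G}=G/H$-graded algebra and $\tau\in\mathrm{Z}^2_{\mathrm{sym}}(G,\mathbb{F}^\times)$, then $L^\tau_\pi(\mathcal{A})$ is $G$-graded-central-simple and $C(L^\tau_\pi(\mathcal{A}))\simeq_G\mathbb{F}^{\tau'}H$, where $\tau'=\tau|_{H\times H}$. (3) For $i=1,2$ let $H_i\le G$, $\pi_i:G\to G/H_i$ the canonical projection, $\mathcal{A}_i$ a central simple $G/H_i$-graded algebra, and $\tau_i\in\mathrm{Z}^2_{\mathrm{sym}}(G,\mathbb{F}^\times)$. Then $L^{\tau_1}_{\pi_1}(\mathcal{A}_1)\simeq_G L^{\tau_2}_{\pi_2}(\mathcal{A}_2)$ if and only if $H_1=H_2=:H$ (so $\pi_1=\pi_2=:\pi:G\to\overline{G}=G/H$) and there exists $\mu\in\mathrm{Z}^2_{\mathrm{sym}}(\overline{G},\mathbb{F}^\times)$ such that $[\tau_1]=\pi^*([\mu])[\tau_2]$ in $\mathrm{H}^2_{\mathrm{sym}}(G,\mathbb{F}^\times)$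 and $\mathcal{A}_1^\mu\simeq_{\overline{G}}\mathcal{A}_2$.
   Context: Algebras are arbitrary (nonassociative, possibly infinite-dimensional) algebras over $\mathbb{F}$. A $G$-grading is a decomposition $\mathcal{A}=\bigoplus_g\mathcal{A}_g$ with $\mathcal{A}_g\mathcal{A}_h\subseteq\mathcal{A}_{gh}$; $\simeq_G$ denotes graded isomorphism. Centroid: $C(\mathcal{A})=\{c\in\mathrm{End}_{\mathbb{F}}(\mathcal{A})\mid c(xy)=c(x)y=xc(y)\}$, $C(\mathcal{A})_g=\{c\in C(\mathcal{A}): c\mathcal{A}_{g'}\subseteq\mathcal{A}_{gg'}\ \forall g'\}$. An algebra is central simple if it is simple and its centroid is $\mathbb{F}1$. A $G$-graded algebra is graded-simple if $\mathcal{A}^2=\mathcal{A}$ and there are no proper nonzero graded ideals, graded-central if $C(\mathcal{A})_e=\mathbb{F}1$, graded-central-simple if both; for such algebras $C(\mathcal{A})=\bigoplus_gC(\mathcal{A})_g$ is $G$-graded. Symmetric $2$-cocycles $\mathrm{Z}^2_{\mathrm{sym}}(A,\mathbb{F}^\times)$: maps $\tau:A\times A\to\mathbb{F}^\times$ with $\tau(a_1,a_2)\tau(a_1a_2,a_3)=\tau(a_1,a_2a_3)\tau(a_2,a_3)$ and $\tau(a_1,a_2)=\tau(a_2,a_1)$; coboundaries $\mathrm{d}\gamma(a_1,a_2)=\gamma(a_1)\gamma(a_2)\gamma(a_1a_2)^{-1}$; $\mathrm{H}^2_{\mathrm{sym}}=\mathrm{Z}^2_{\mathrm{sym}}/\mathrm{B}^2$.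 For $\pi:G\to\overline{G}$, $\pi^*:\mathrm{H}^2_{\mathrm{sym}}(\overline{G},\mathbb{F}^\times)\to\mathrm{H}^2_{\mathrm{sym}}(G,\mathbb{F}^\times)$, $[\mu]\mapsto[\mu\circ(\pi\times\pi)]$. The $\tau$-twist $\mathcal{A}^\tau$ of a graded algebra is the same graded space with multiplication $x*y=\tau(g_1,g_2)xy$ for $x\in\mathcal{A}_{g_1},y\in\mathcal{A}_{g_2}$. The twisted group algebra $\mathbb{F}^{\tau'}H$ is the $\tau'$-twist of the group algebra $\mathbb{F}H$ with its natural grading (viewed as $G$-graded with support $H$). For $H\le G$, $\pi:G\to\overline{G}=G/H$, $g\mapsto\bar g$, and a $\overline{G}$-graded algebra $\mathcal{A}$, the loop algebra is the $G$-graded subalgebra $L_\pi(\mathcal{A})=\bigoplus_{g\in G}\mathcal{A}_{\bar g}\otimes g$ of $\mathcal{A}\otimes_{\mathbb{F}}\mathbb{F}G$ (degree of $\mathcal{A}_{\bar g}\otimes g$ is $g$), and $L^\tau_\pi(\mathcal{A}):=(L_\pi(\mathcal{A}))^\tau$ for $\tau\in\mathrm{Z}^2_{\mathrm{sym}}(G,\mathbb{F}^\times)$. *)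

(* Defs.v *)
From HB Require Import structures.
From mathcomp Require Import all_boot all_order all_algebra.
From Stdlib Require Import IndefiniteDescription ClassicalDescription FunctionalExtensionality PropExtensionality.
Set Implicit Arguments. Unset Strict Implicit. Unset Printing Implicit Defensive.
Import GRing.Theory.
Local Open Scope ring_scope.

Definition asbool (P : Prop) : bool :=
  if excluded_middle_informative P then true else false.
Lemma asboolP (P : Prop) : reflect P (asbool P).
Proof. rewrite /asbool; case: excluded_middle_informative => h; by constructor. Qed.

Section ClassicalChoice.
Variable T : Type.
Definition cfind (P : pred T) (n : nat) : option T :=
  match excluded_middle_informative (exists x, P x) with
  | left h => Some (proj1_sig (constructive_indefinite_description _ h))
  | right _ => None end.
Lemma cfind_correct P n x : cfind P n = Some x -> P x.
Proof.
rewrite /cfind; case: excluded_middle_informative => // h [<-].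
by case: constructive_indefinite_description.
Qed.
Lemma cfind_complete (P : pred T) : (exists x, P x) -> exists n, cfind P n.
Proof. by move=> h; exists 0%N; rewrite /cfind; case: excluded_middle_informative. Qed.
Lemma cfind_ext (P Q : pred T) : P =1 Q -> cfind P =1 cfind Q.
Proof. by move=> /functional_extensionality ->. Qed.
End ClassicalChoice.

Section FunSpace.
Variables (R : pzRingType) (T : Type) (V : lmodType R).
Definition funT := T -> V.
Lemma funT_eqP : Equality.axiom (fun f g : funT => asbool (f = g)).
Proof. by move=> f g; apply: (iffP (asboolP _)). Qed.
HB.instance Definition _ := hasDecEq.Build funT funT_eqP.
HB.instance Definition _ := hasChoice.Build funT
  (@cfind_correct funT) (@cfind_complete funT) (@cfind_ext funT).
Definition fzero : funT := fun _ => 0.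
Definition fopp (f : funT) : funT := fun x => - f x.
Definition fadd (f g : funT) : funT := fun x => f x + g x.
Definition fscale (a : R) (f : funT) : funT := fun x => a *: f x.
Lemma faddA : associative fadd.
Proof. by move=> f g h; apply: functional_extensionality => x; rewrite /fadd addrA. Qed.
Lemma faddC : commutative fadd.
Proof. by move=> f g; apply: functional_extensionality => x; rewrite /fadd addrC. Qed.
Lemma fadd0 : left_id fzero fadd.
Proof. by move=> f; apply: functional_extensionality => x; rewrite /fadd add0r. Qed.
Lemma faddN : left_inverse fzero fopp fadd.
Proof. by move=> f; apply: functional_extensionality => x; rewrite /fadd /fopp addNr. Qed.
HB.instance Definition _ := GRing.isZmodule.Build funT faddA faddC fadd0 faddN.
Lemma fscaleA a b (f : funT) : fscale a (fscale b f) = fscale (a * b) f.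
Proof. by apply: functional_extensionality => x; rewrite /fscale scalerA. Qed.
Lemma fscale1 : left_id 1 fscale.
Proof. by move=> f; apply: functional_extensionality => x; rewrite /fscale scale1r. Qed.
Lemma fscaleDr : right_distributive fscale +%R.
Proof. by move=> a f g; apply: functional_extensionality => x; rewrite /fscale /= /fadd scalerDr. Qed.
Lemma fscaleDl (f : funT) : {morph fscale^~ f : a b / a + b}.
Proof. by move=> a b; apply: functional_extensionality => x; rewrite /fscale /= /fadd scalerDl. Qed.
HB.instance Definition _ := GRing.Zmodule_isLmodule.Build R funT fscaleA fscale1 fscaleDr fscaleDl.
End FunSpace.

Section Span.
Variables (F : fieldType) (V : lmodType F) (P : pred V).
Definition inspan (v : V) : Prop :=
  forall Q : pred V, 0 \in Q -> (forall a x y, x \in Q -> y \in Q -> a *: x + y \in Q) ->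
    {subset P <= Q} -> v \in Q.
Definition spanP : pred V := fun v => asbool (inspan v).
Lemma spanP_closed : subsemimod_closed spanP.
Proof.
have h0 : 0 \in spanP by rewrite unfold_in; apply/asboolP => Q.
have hl a x y : x \in spanP -> y \in spanP -> a *: x + y \in spanP.
  rewrite !unfold_in => /asboolP hx /asboolP hy; apply/asboolP => Q Q0 QL QP.
  by apply: (QL); [exact: (hx Q Q0 QL QP) | exact: (hy Q Q0 QL QP)].
split; [split=> // x y hx hy|].
  by rewrite -(scale1r x); apply: hl.
by move=> a x hx; rewrite -(addr0 (a *: x)); apply: hl.
Qed.
HB.instance Definition _ := GRing.isSubmodClosed.Build F V spanP spanP_closed.
Record spanT := SpanT { sp_val : V; sp_valP : sp_val \in spanP }.
HB.instance Definition _ := [isSub for sp_val].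
HB.instance Definition _ := [Choice of spanT by <:].
HB.instance Definition _ := [SubChoice_isSubLmodule of spanT by <:].
End Span.


Record subgrp (G : zmodType) := SubGrp {
  sg_pred : pred G;
  sg0 : 0 \in sg_pred;
  sgB : forall x y, x \in sg_pred -> y \in sg_pred -> x - y \in sg_pred }.

(* the quotient group G/H, elements are chosen coset representatives *)
Section Quotient.
Variables (G : zmodType) (H : subgrp G).
Local Notation Hp := (sg_pred H).
Lemma sgN x : x \in Hp -> - x \in Hp.
Proof. by move=> hx; rewrite -sub0r; apply: sgB => //; apply: sg0. Qed.
Lemma sgD x y : x \in Hp -> y \in Hp -> x + y \in Hp.
Proof. by move=> hx hy; rewrite -(opprK y); apply: sgB => //; apply: sgN. Qed.
Lemma qrep_ex x : exists y, x - y \in Hp.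
Proof. by exists x; rewrite subrr sg0. Qed.
Definition qrep (x : G) : G := xchoose (qrep_ex x).
Lemma qrepP x : x - qrep x \in Hp.
Proof. exact: (xchooseP (qrep_ex x)). Qed.
Lemma qrep_eq x y : x - y \in Hp -> qrep x = qrep y.
Proof.
move=> hxy; apply: eq_xchoose => z; apply/idP/idP => h.
  have -> : y - z = (x - z) - (x - y) by rewrite [RHS]addrC opprB addrA subrK.
  exact: sgB.
have -> : x - z = (x - y) + (y - z) by rewrite addrA subrK.
exact: sgD.
Qed.
Lemma qrepK x : qrep (qrep x) = qrep x.
Proof. by apply: qrep_eq; rewrite -opprB; apply: sgN; apply: qrepP. Qed.
Record quot := Quot { q_val : G; q_valP : qrep q_val == q_val }.
HB.instance Definition _ := [isSub for q_val].
HB.instance Definition _ := [Choice of quot by <:].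
Definition qproj (x : G) : quot := @Quot (qrep x) (introT eqP (qrepK x)).
Lemma qproj_val (a : quot) : qproj (q_val a) = a.
Proof. by case: a => v hv; apply: val_inj => /=; apply/eqP. Qed.
Lemma qproj_eq x y : x - y \in Hp -> qproj x = qproj y.
Proof. by move=> h; apply: val_inj => /=; apply: qrep_eq. Qed.
Lemma qprojDl x y : qproj (qrep x + y) = qproj (x + y).
Proof.
apply: qproj_eq; rewrite opprD addrACA subrr addr0 -opprB.
by apply: sgN; apply: qrepP.
Qed.
Definition qzero : quot := qproj 0.
Definition qopp (a : quot) : quot := qproj (- q_val a).
Definition qadd (a b : quot) : quot := qproj (q_val a + q_val b).
Lemma qaddA : associative qadd.
Proof.
move=> a b c; rewrite /qadd /= qprojDl [q_val a + _]addrC qprojDl.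
by rewrite addrC addrA.
Qed.
Lemma qaddC : commutative qadd.
Proof. by move=> a b; rewrite /qadd addrC. Qed.
Lemma qadd0 : left_id qzero qadd.
Proof. by move=> a; rewrite /qadd /= qprojDl add0r qproj_val. Qed.
Lemma qaddN : left_inverse qzero qopp qadd.
Proof. by move=> a; rewrite /qadd /= qprojDl addNr. Qed.
HB.instance Definition _ := GRing.isZmodule.Build quot qaddA qaddC qadd0 qaddN.
End Quotient.

(* Graded (nonassociative, possibly infinite-dimensional) algebras.         *)
(* A G-graded algebra is given by its underlying F-vector space, its        *)
(* product, and the family (A_g)_g of homogeneous components; the algebra   *)
(* axioms (bilinearity, A = (+)_g A_g, A_g A_h <= A_{g+h}) are is_galg.     *)
(* Groups are abelian and written additively (e = 0, gh = g + h).          *)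
Record galg (F : fieldType) (G : Type) := GAlg {
  gcar : lmodType F;
  gmul : gcar -> gcar -> gcar;
  gcomp : G -> pred gcar }.
Arguments gcar {F G} g : rename.
Arguments gmul {F G} g _ _ : rename.
Arguments gcomp {F G} g _ : rename.

Section GradedNotions.
Local Unset Implicit Arguments.
Context {F : fieldType} {G : zmodType}.

Definition subspace {V : lmodType F} (P : pred V) : Prop :=
  0 \in P /\ forall a x y, x \in P -> y \in P -> a *: x + y \in P.

Definition bilinear_mul (A : galg F G) : Prop :=
  (forall a x y z, gmul A (a *: x + y) z = a *: gmul A x z + gmul A y z) /\
  (forall a x y z, gmul A z (a *: x + y) = a *: gmul A z x + gmul A z y).

Definition is_grading (A : galg F G) : Prop :=
  (forall g, subspace (gcomp A g)) /\
  (forall x : gcar A, exists (s : seq G) (f : G -> gcar A),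
      (forall g, f g \in gcomp A g) /\ x = \sum_(g <- s) f g) /\
  (forall (s : seq G) (f : G -> gcar A), uniq s -> (forall g, f g \in gcomp A g) ->
      \sum_(g <- s) f g = 0 -> forall g, g \in s -> f g = 0) /\
  (forall g h x y, x \in gcomp A g -> y \in gcomp A h -> gmul A x y \in gcomp A (g + h)).

Definition is_galg (A : galg F G) : Prop := bilinear_mul A /\ is_grading A.

Definition is_ideal (A : galg F G) (I : pred (gcar A)) : Prop :=
  subspace I /\ forall x y, x \in I -> gmul A x y \in I /\ gmul A y x \in I.
Definition is_graded_subspace (A : galg F G) (I : pred (gcar A)) : Prop :=
  forall x, x \in I -> exists (s : seq G) (f : G -> gcar A),
    (forall g, f g \in gcomp A g /\ f g \in I) /\ x = \sum_(g <- s) f g.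

Definition sq_full (A : galg F G) : Prop :=
  forall x : gcar A, exists s : seq (F * gcar A * gcar A),
    x = \sum_(p <- s) p.1.1 *: gmul A p.1.2 p.2.
Definition nonzero (A : galg F G) : Prop := exists x : gcar A, x != 0.

Definition simple (A : galg F G) : Prop :=
  nonzero A /\ sq_full A /\
  forall I : pred (gcar A), is_ideal A I -> (forall x, x \in I -> x = 0) \/ (forall x, x \in I).
Definition graded_simple (A : galg F G) : Prop :=
  nonzero A /\ sq_full A /\
  forall I : pred (gcar A), is_ideal A I -> is_graded_subspace A I ->
    (forall x, x \in I -> x = 0) \/ (forall x, x \in I).

Definition is_centroid (A : galg F G) (c : gcar A -> gcar A) : Prop :=
  (forall a x y, c (a *: x + y) = a *: c x + c y) /\
  (forall x y, c (gmul A x y) = gmul A (c x) y /\ c (gmul A x y) = gmul A x (c y)).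
Definition centroid_deg (A : galg F G) (g : G) (c : gcar A -> gcar A) : Prop :=
  forall g' x, x \in gcomp A g' -> c x \in gcomp A (g + g').

Definition central (A : galg F G) : Prop :=
  forall c : gcar A -> gcar A, is_centroid A c -> exists a : F, forall x, c x = a *: x.
Definition graded_central (A : galg F G) : Prop :=
  forall c : gcar A -> gcar A, is_centroid A c -> centroid_deg A 0 c -> exists a : F, forall x, c x = a *: x.

Definition central_simple (A : galg F G) : Prop := simple A /\ central A.
Definition graded_central_simple (A : galg F G) : Prop :=
  graded_simple A /\ graded_central A.

Definition giso (A B : galg F G) : Prop :=
  exists phi : gcar A -> gcar B,
    (forall a x y, phi (a *: x + y) = a *: phi x + phi y) /\ bijective phi /\
    (forall x y, phi (gmul A x y) = gmul B (phi x) (phi y)) /\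
    (forall g x, x \in gcomp A g -> phi x \in gcomp B g) /\
    (forall g y, y \in gcomp B g -> exists2 x, x \in gcomp A g & phi x = y).

Definition sym2cocycle (t : G -> G -> F) : Prop :=
  (forall a b, t a b != 0) /\
  (forall a b c, t a b * t (a + b) c = t a (b + c) * t b c) /\
  (forall a b, t a b = t b a).
Definition cohomologous (t1 t2 : G -> G -> F) : Prop :=
  exists gam : G -> F, (forall a, gam a != 0) /\
    forall a b, t1 a b = t2 a b * (gam a * gam b / gam (a + b)).

(* the tau-twist A^tau: x * y = tau(g1,g2) xy on homogeneous elements, *)
(* extended bilinearly via (a chosen) homogeneous decomposition         *)
Definition gdec {A : galg F G} (x : gcar A) : seq G * (G -> gcar A) :=
  match excluded_middle_informative
    (exists p : seq G * (G -> gcar A), uniq p.1 /\ (forall g, p.2 g \in gcomp A g) /\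
        x = \sum_(g <- p.1) p.2 g) with
  | left h => proj1_sig (constructive_indefinite_description _ h)
  | right _ => ([::], fun _ => 0) end.
Definition twist (A : galg F G) (t : G -> G -> F) : galg F G :=
  @GAlg F G (gcar A)
    (fun x y => \sum_(g <- (gdec x).1) \sum_(h <- (gdec y).1)
                  t g h *: gmul A ((gdec x).2 g) ((gdec y).2 h))
    (gcomp A).

(* finitely supported functions G -> V model V (x) FG *)
Definition fsupp {V : lmodType F} (f : G -> V) : seq G :=
  match excluded_middle_informative (exists s : seq G, forall g, f g != 0 -> g \in s) with
  | left h => undup (proj1_sig (constructive_indefinite_description _ h))
  | right _ => [::] end.
Definition fdelta {V : lmodType F} (g : G) (v : V) : funT G V :=
  fun k => if k == g then v else 0.
Definition conv {V : lmodType F} (m : V -> V -> V) (f f' : funT G V) : funT G V :=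
  fun k => \sum_(g <- fsupp f) \sum_(h <- fsupp f')
             (if g + h == k then m (f g) (f' h) else 0).

(* loop algebra L_pi(A) = (+)_g A_{pi g} (x) g  inside  A (x) FG *)
Section Loop.
Context {Gb : zmodType}.
Variables (pi : G -> Gb) (A : galg F Gb).
Definition loop_gen : pred (funT G (gcar A)) :=
  fun f => asbool (exists g v, v \in gcomp A (pi g) /\ f = fdelta g v).
Definition loop_car : lmodType F := spanT loop_gen.
Definition loop_mul (x y : loop_car) : loop_car :=
  insubd 0 (conv (gmul A) (sp_val x) (sp_val y)).
Definition loop_comp (g : G) : pred loop_car :=
  fun x => asbool ((forall k, k != g -> sp_val x k = 0) /\ sp_val x g \in gcomp A (pi g)).
Definition loop : galg F G := @GAlg F G loop_car loop_mul loop_comp.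
End Loop.
Definition tloop {Gb : zmodType} (pi : G -> Gb) (A : galg F Gb) (t : G -> G -> F) :=
  twist (loop pi A) t.

Section GroupAlg.
Variable H : subgrp G.
Definition grp_gen : pred (funT G F^o) :=
  fun f => asbool (exists g (a : F^o), g \in sg_pred H /\ f = fdelta g a).
Definition grp_car : lmodType F := spanT grp_gen.
Definition grp_mul (x y : grp_car) : grp_car :=
  insubd 0 (conv *%R (sp_val x) (sp_val y)).
Definition grp_comp (g : G) : pred grp_car :=
  fun x => asbool ((forall k, k != g -> sp_val x k = 0) /\
                   (g \in sg_pred H \/ sp_val x g = 0)).
Definition grpalg : galg F G := @GAlg F G grp_car grp_mul grp_comp.
End GroupAlg.
(* restriction tau' = tau|_{H x H} (extended by 1, values outside H x H are never used) *)
Definition restr (H : subgrp G) (t : G -> G -> F) : G -> G -> F :=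
  fun a b => if (a \in sg_pred H) && (b \in sg_pred H) then t a b else 1.
Definition tgrpalg (H : subgrp G) (t' : G -> G -> F) : galg F G := twist (grpalg H) t'.

Section CentroidAlg.
Variable A : galg F G.
Definition cent_gen : pred (funT (gcar A) (gcar A)) := fun c => asbool (is_centroid A c).
Definition cent_car : lmodType F := spanT cent_gen.
Definition cent_mul (c d : cent_car) : cent_car :=
  insubd 0 ((sp_val c \o sp_val d) : funT (gcar A) (gcar A)).
Definition cent_comp (g : G) : pred cent_car :=
  fun c => asbool (centroid_deg A g (sp_val c)).
Definition centroid_alg : galg F G := @GAlg F G cent_car cent_mul cent_comp.
End CentroidAlg.

End GradedNotions.

(* Main.v *)
(* A graded isomorphism of [B] with [L^t_pi(A)] amounts to bijections [phi g] from [A_(pi g)] to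
   [B_g] that are multiplicative up to [t]: a chart of [B] over [A]. Charts compose, and
   multiplication operators move up and down along a chart, so graded simplicity does too. So do
   homogeneous elements of the centroid: one of degree [k] carries [A_(pi g)] to [A_(pi (k + g))]
   by a map which, commuting with multiplications, only depends on [pi g]. Hence, over a central
   simple [A], the centroid of [B] is the span of one shift in each degree of [ker pi], and this
   determines [H] and gives (2).

   For (1), [H] is the support of [C(B)]. Nonzero [u_h] in [C(B)_h] satisfy
   [u_h u_k = t(h, k) u_(h + k)] for a symmetric cocycle [t] on [H], which extends to [G] by Zorn's
   lemma, since an abelian extension of [K] by the multiplicative group of [F] embeds in one of
   the group generated by [K] and one more element. After twisting by [t^-1] the [u_h] are an
   action of [H] on [B], and [A] is the algebra of its orbits. It is graded-central-simple with
   centroid concentrated in degree 0, and then it is central simple: if two components of a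
   shortest element of an ideal were nonzero, one would be the image of the other under an element
   of the centroid of nonzero degree.

   For (3), charts of one algebra [B] over [A1] and [A2] differ by maps [E g] from [A1_(pi g)] to
   [A2_(pi g)], multiplicative up to [t1 / t2]. As [C(B)] acts by shifts along both charts, [E g]
   and [E (h + g)] are proportional for [h] in [H]; this trivializes [t1 / t2] on [H], so that
   [t1 / t2] is cohomologous to the inflation of some [mu] and, once rescaled, [E g] only depends
   on [pi g] and is an isomorphism of [A1^mu] with [A2]. *)

(* [boolp] comes before [Defs], whose [asbool] has to shadow its own. *)
From mathcomp Require Import boolp classical_sets.
Require Import Defs.
From HB Require Import structures.
From mathcomp Require Import all_boot all_order all_algebra ring.
Import GRing.Theory.
Local Open Scope ring_scope.
Set Implicit Arguments. Unset Strict Implicit. Unset Printing Implicit Defensive.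

(** * Graded algebras and their components *)

Lemma sum_over_support (I : eqType) (V : nmodType) (r s : seq I) (f : I -> V) :
  uniq r -> uniq s -> (forall i, f i != 0 -> i \in r) -> (forall i, f i != 0 -> i \in s) ->
  \sum_(i <- r) f i = \sum_(i <- s) f i.
Proof.
move=> ur us fr fs; pose P i := f i != 0.
rewrite -(@big_rmcond_in _ _ _ _ r P) => [|i _ /negbNE/eqP //].
rewrite -[RHS](@big_rmcond_in _ _ _ _ s P) => [|i _ /negbNE/eqP //].
rewrite -big_filter -[RHS]big_filter; apply/perm_big/uniq_perm; rewrite ?filter_uniq // => i.
by rewrite !mem_filter /P; case: eqP => //= /eqP fi; rewrite fr ?fs.
Qed.

Structure gradedAlg (F : fieldType) (G : zmodType) :=
  GradedAlg { galg_of :> galg F G; gradedAlgP : is_galg galg_of }.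

Section Gradings.
Variables (F : fieldType) (G : zmodType).
Implicit Types A : gradedAlg F G.

Lemma gmul_bilinear A : bilinear_for *:%R *:%R (gmul A).
Proof.
by case: (gradedAlgP A) => -[mulPl mulPr] _; split=> z a x y; [apply: mulPl|apply: mulPr].
Qed.
HB.instance Definition _ A :=
  bilinear_isBilinear.Build F (gcar A) (gcar A) (gcar A) *:%R *:%R (gmul A) (gmul_bilinear A).
HB.instance Definition _ A x :=
  GRing.isLinear.Build F (gcar A) (gcar A) *:%R (gmul A x) ((gmul_bilinear A).2 x).

Lemma subspace_closed (V : lmodType F) (P : pred V) : subspace P -> subsemimod_closed P.
Proof.
move=> [P0 PL]; split=> [|a x xP]; last by rewrite -[a *: x]addr0; apply: PL.
by split=> // x y xP yP; rewrite -[x]scale1r; apply: PL.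
Qed.

Lemma gcomp_closed A g : subsemimod_closed (gcomp A g).
Proof. by apply: subspace_closed; case: (gradedAlgP A) => _ []. Qed.
HB.instance Definition _ A g :=
  GRing.isSubmodClosed.Build F (gcar A) (gcomp A g) (gcomp_closed A g).

Lemma gmul_gcomp A g h x y :
  x \in gcomp A g -> y \in gcomp A h -> gmul A x y \in gcomp A (g + h).
Proof. by case: (gradedAlgP A) => _ [_ [_ [_ gmulA]]]; apply: gmulA. Qed.

Lemma gcomp_independent A (s : seq G) (f : G -> gcar A) : uniq s ->
  (forall g, f g \in gcomp A g) -> \sum_(g <- s) f g = 0 -> forall g, g \in s -> f g = 0.
Proof. by case: (gradedAlgP A) => _ [_ [_ [indep _]]]; apply: indep. Qed.

Lemma gdecP A (x : gcar A) : [/\ uniq (gdec x).1, forall g, (gdec x).2 g \in gcomp A g &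
  x = \sum_(g <- (gdec x).1) (gdec x).2 g].
Proof.
rewrite /gdec; case: ClassicalDescription.excluded_middle_informative => [dec|[]].
  by case: IndefiniteDescription.constructive_indefinite_description => /= p [? [? ?]].
case: (gradedAlgP A) => _ [_ [/(_ x) [s [f [fA ->]]] _]].
exists (undup s, fun g => f g *+ count_mem g s); split; first exact: undup_uniq.
by split=> [g|]; [apply: rpredMn|rewrite -[LHS]big_undup_iterop_count].
Qed.

Definition gproj (A : galg F G) (g : G) (x : gcar A) : gcar A :=
  if g \in (gdec x).1 then (gdec x).2 g else 0.
Arguments gproj A g x : clear implicits.

Lemma gproj_in A g x : gproj A g x \in gcomp A g.
Proof. by rewrite /gproj; case: ifP => _; [case: (gdecP x)|apply: rpred0]. Qed.

Lemma sum_gproj_over A (s : seq G) x : uniq s -> (forall g, gproj A g x != 0 -> g \in s) ->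
  \sum_(g <- s) gproj A g x = x.
Proof.
move=> us xs; have [ud _ xE] := gdecP x.
rewrite [in RHS]xE (sum_over_support us ud xs); last first.
  by move=> g; rewrite /gproj; case: ifP; rewrite ?eqxx.
by rewrite big_seq [RHS]big_seq; apply: eq_bigr => g gx; rewrite /gproj gx.
Qed.

Lemma gproj_sum A (s : seq G) (f : G -> gcar A) h : uniq s -> (forall g, f g \in gcomp A g) ->
  gproj A h (\sum_(g <- s) f g) = if h \in s then f h else 0.
Proof.
move=> us fA; set x := \sum_(g <- s) f g; pose f0 g := if g \in s then f g else 0.
have f0s g : f0 g != 0 -> g \in s by rewrite /f0; case: ifP; rewrite ?eqxx.
have xs g : gproj A g x != 0 -> g \in (gdec x).1 by rewrite /gproj; case: ifP; rewrite ?eqxx.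
pose r := undup (s ++ (gdec x).1); have ur : uniq r := undup_uniq _.
have mem_r g : (g \in s) || (g \in (gdec x).1) -> g \in r by rewrite mem_undup mem_cat.
apply/esym/eqP; rewrite -/(f0 h) -subr_eq0; have [hr|hr] := boolP (h \in r); last first.
  have [->|/f0s hs] := eqVneq (f0 h) 0; last by case/negP: hr; apply: mem_r; rewrite hs.
  by rewrite sub0r oppr_eq0; apply: contraNT hr => /xs hx; apply: mem_r; rewrite hx orbT.
apply/eqP; apply: (gcomp_independent ur (f := fun g => f0 g - gproj A g x)) => // [g|].
  by apply: rpredB; [rewrite /f0; case: ifP => // _; apply: rpred0|apply: gproj_in].
rewrite sumrB sum_gproj_over // => [|g /xs gx]; last by apply: mem_r; rewrite gx orbT.
rewrite (sum_over_support ur us (f := f0)) // => [|g /f0s gs]; last by apply: mem_r; rewrite gs.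
apply/eqP; rewrite subr_eq0 /x big_seq [X in _ == X]big_seq; apply/eqP/eq_bigr => g gs.
by rewrite /f0 gs.
Qed.
End Gradings.
Arguments gproj {F G} A g x.

Section Components.
Variables (F : fieldType) (G : zmodType) (A : gradedAlg F G).

Definition gsupp (x : gcar A) : seq G := [seq g <- (gdec x).1 | gproj A g x != 0].

Lemma gsupp_uniq x : uniq (gsupp x).
Proof. by apply: filter_uniq; case: (gdecP x). Qed.

Lemma mem_gsupp x g : (g \in gsupp x) = (gproj A g x != 0).
Proof. by rewrite mem_filter andb_idr // /gproj; case: ifP; rewrite ?eqxx. Qed.

Lemma sum_gproj x : \sum_(g <- gsupp x) gproj A g x = x.
Proof. by apply: sum_gproj_over => [|g]; [apply: gsupp_uniq|rewrite mem_gsupp]. Qed.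

Lemma common_support x y : exists s : seq G, [/\ uniq s,
  forall g, gproj A g x != 0 -> g \in s & forall g, gproj A g y != 0 -> g \in s].
Proof.
exists (undup (gsupp x ++ gsupp y)).
by split=> [|g|g]; rewrite ?undup_uniq // mem_undup mem_cat !mem_gsupp => ->; rewrite ?orbT.
Qed.

Lemma gproj_linear g : linear (gproj A g).
Proof.
move=> a x y; have [s [us xs ys]] := common_support x y.
rewrite -{1}(sum_gproj_over us xs) -{1}(sum_gproj_over us ys) scaler_sumr -big_split /=.
rewrite gproj_sum // => [|h]; last by rewrite rpredD ?rpredZ ?gproj_in.
case: ifPn => // gs; have [-> ->] : gproj A g x = 0 /\ gproj A g y = 0.
  by split; apply: contraNeq gs; [apply: xs|apply: ys].
by rewrite scaler0 addr0.
Qed.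
HB.instance Definition _ g :=
  GRing.isLinear.Build F (gcar A) (gcar A) *:%R (gproj A g) (gproj_linear g).

Lemma gproj_homog g h x : x \in gcomp A h -> gproj A g x = if g == h then x else 0.
Proof.
move=> xh; pose f k := if k == h then x else 0.
have fA k : f k \in gcomp A k by rewrite /f; case: eqP => [->|_] //; apply: rpred0.
by have := gproj_sum g (isT : uniq [:: h]) fA; rewrite big_seq1 inE /f eqxx => ->; case: eqP.
Qed.

Lemma gproj_id g x : x \in gcomp A g -> gproj A g x = x.
Proof. by move=> /gproj_homog ->; rewrite eqxx. Qed.

Lemma gproj_ext x y : (forall g, gproj A g x = gproj A g y) -> x = y.
Proof.
move=> xy; apply/subr0_eq; rewrite -(sum_gproj (x - y)) big1 // => g _.
by rewrite linearB /= xy subrr.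
Qed.

Lemma gcomp_disjoint g h x : x \in gcomp A g -> x \in gcomp A h -> g != h -> x = 0.
Proof. by move=> /gproj_id xE /(gproj_homog g); rewrite xE => -> /negbTE ->. Qed.

Lemma homog_ind (P : gcar A -> Prop) : P 0 -> (forall x y, P x -> P y -> P (x + y)) ->
  (forall g x, x \in gcomp A g -> P x) -> forall x, P x.
Proof.
move=> P0 PD Phomog x; rewrite -(sum_gproj x); elim/big_ind: _ => // g _.
exact: Phomog (gproj_in g x).
Qed.

Lemma linear_homog_ext (V : lmodType F) (f f' : {linear gcar A -> V}) :
  (forall g x, x \in gcomp A g -> f x = f' x) -> f =1 f'.
Proof.
move=> ff'; apply: homog_ind => [|x y fx fy|//]; first by rewrite !linear0.
by rewrite !linearD fx fy.
Qed.

Lemma bilinear_homog_ext (V : lmodType F) (m m' : gcar A -> gcar A -> V) :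
  bilinear_for *:%R *:%R m -> bilinear_for *:%R *:%R m' ->
  (forall g h x y, x \in gcomp A g -> y \in gcomp A h -> m x y = m' x y) -> m =2 m'.
Proof.
pose linl (u : gcar A -> gcar A -> V) (uP : bilinear_for *:%R *:%R u) y :
  {linear gcar A -> V} := HB.pack (u^~ y) (GRing.isLinear.Build F _ V *:%R (u^~ y) (uP.1 y)).
pose linr (u : gcar A -> gcar A -> V) (uP : bilinear_for *:%R *:%R u) x :
  {linear gcar A -> V} := HB.pack (u x) (GRing.isLinear.Build F _ V *:%R (u x) (uP.2 x)).
move=> mP mP' mm' x y; apply: (linear_homog_ext (f := linl m mP y) (f' := linl m' mP' y)).
move=> g {}x xg; apply: (linear_homog_ext (f := linr m mP x) (f' := linr m' mP' x)) => h {}y yh.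
exact: (mm' g h).
Qed.

Lemma homog_neq0 : nonzero A -> exists g x, x \in gcomp A g /\ x != 0.
Proof.
move=> [x x0]; case E : (gsupp x) => [|g s].
  by case/eqP: x0; rewrite -(sum_gproj x) E big_nil.
by exists g, (gproj A g x); rewrite gproj_in -mem_gsupp E mem_head.
Qed.

Section Glue.
Variables (V : lmodType F) (phi : G -> {linear gcar A -> V}).

Definition glue (x : gcar A) : V := \sum_(g <- gsupp x) phi g (gproj A g x).

Lemma glue_sum_over (s : seq G) x : uniq s -> (forall g, gproj A g x != 0 -> g \in s) ->
  glue x = \sum_(g <- s) phi g (gproj A g x).
Proof.
have supp g : phi g (gproj A g x) != 0 -> gproj A g x != 0.
  by apply: contra_neq => ->; rewrite linear0.
move=> us xs; apply: sum_over_support => // [|g|g]; first exact: gsupp_uniq.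
  by rewrite mem_gsupp; apply: supp.
by move/supp/xs.
Qed.

Lemma glue_linear : linear glue.
Proof.
move=> a x y; have [s [us xs ys]] := common_support x y.
rewrite !(@glue_sum_over s) // => [|g].
  by rewrite scaler_sumr -big_split; apply: eq_bigr => g _; rewrite !linearP.
rewrite linearP /=; have [->|/xs //] := eqVneq (gproj A g x) 0.
by rewrite scaler0 add0r; apply: ys.
Qed.
HB.instance Definition _ := GRing.isLinear.Build F (gcar A) V *:%R glue glue_linear.

Lemma glue_homog g x : x \in gcomp A g -> glue x = phi g x.
Proof.
move=> xg; rewrite (@glue_sum_over [:: g]) ?big_seq1 ?gproj_id // => h.
by rewrite (gproj_homog _ xg) inE; case: (h == g); rewrite ?eqxx.
Qed.
End Glue.
End Components.

Lemma gproj_shift (F : fieldType) (G : zmodType) (A B : gradedAlg F G) (k : G)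
    (f : {linear gcar A -> gcar B}) g x :
  (forall h y, y \in gcomp A h -> f y \in gcomp B (k + h)) ->
  gproj B (k + g) (f x) = f (gproj A g x).
Proof.
move=> fk.
apply: (linear_homog_ext (f := gproj B (k + g) \o f) (f' := f \o gproj A g)) => h {}x xh /=.
rewrite (gproj_homog _ xh) (gproj_homog _ (fk h x xh)) (inj_eq (addrI k)).
by case: eqP => // _; rewrite linear0.
Qed.

Section Ideals.
Variables (F : fieldType) (G : zmodType) (A : gradedAlg F G).

Lemma gprojMl g h x y : x \in gcomp A g -> gproj A (g + h) (gmul A x y) = gmul A x (gproj A h y).
Proof. by move=> xg; apply: (@gproj_shift _ _ A A g (gmul A x)) => k z; apply: gmul_gcomp. Qed.

Lemma gprojMr g h x y : y \in gcomp A h -> gproj A (g + h) (gmul A x y) = gmul A (gproj A g x) y.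
Proof.
move=> yh; rewrite addrC; apply: (@gproj_shift _ _ A A h (applyr (gmul A) y)) => k z zk.
by rewrite addrC; apply: gmul_gcomp.
Qed.

Lemma subspaceD (V : lmodType F) (P : pred V) x y :
  subspace P -> x \in P -> y \in P -> x + y \in P.
Proof. by move=> sP; case: (subspace_closed sP) => -[_ PD] _; apply: PD. Qed.

Lemma subspace_sum (V : lmodType F) (P : pred V) (I : eqType) (r : seq I) (f : I -> V) :
  subspace P -> (forall i, i \in r -> f i \in P) -> \sum_(i <- r) f i \in P.
Proof.
move=> sP fP; rewrite big_seq; elim/big_ind: _ => //; first by case: sP.
by move=> x y; apply: subspaceD.
Qed.

Lemma is_ideal_homog (I : pred (gcar A)) : subspace I ->
  (forall x g y, x \in I -> y \in gcomp A g -> gmul A x y \in I /\ gmul A y x \in I) ->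
  is_ideal A I.
Proof.
move=> sI mulI; split=> // x y xI; move: y; apply: homog_ind => [|y z [xy yx] [xz zx]|g y].
- by rewrite linear0l linear0r; case: sI.
- by rewrite linearDl linearDr; split; apply: subspaceD.
- exact: mulI.
Qed.

Lemma is_graded_subspace_gproj (I : pred (gcar A)) :
  (forall x g, x \in I -> gproj A g x \in I) -> is_graded_subspace A I.
Proof.
by move=> gI x xI; exists (gsupp x), (fun g => gproj A g x); rewrite sum_gproj; split=> // g;
  split; [apply: gproj_in|apply: gI].
Qed.
End Ideals.

(** * Multiplication operators *)

Section MultiplicationOperators.
Variables (F : fieldType) (G : zmodType) (A : gradedAlg F G).

Inductive mult_op : G -> (gcar A -> gcar A) -> Prop :=
| mult_opl k x of x \in gcomp A k : mult_op k (gmul A x)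
| mult_opr k x of x \in gcomp A k : mult_op k (gmul A ^~ x)
| mult_op_comp k l S T of mult_op k S & mult_op l T : mult_op (k + l) (S \o T)
| mult_op_comb k a S T of mult_op k S & mult_op k T : mult_op k (fun x => a *: S x + T x).

Lemma mult_op_linear k T : mult_op k T -> exists T' : {linear gcar A -> gcar A}, T = T'.
Proof.
move=> TP; suff TL : linear T.
  by exists (HB.pack_for {linear gcar A -> gcar A} T (GRing.isLinear.Build F _ _ *:%R T TL)).
elim: TP => {k T} [k x _|k x _|k l S T _ SL _ TL|k b S T _ SL _ TL] a y z /=.
- exact: linearPr.
- exact: linearPl.
- by rewrite TL SL.
- by rewrite SL TL !scalerDr !scalerA [b * a]mulrC addrACA.
Qed.

Lemma mult_op0 k T : mult_op k T -> T 0 = 0.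
Proof. by move=> /mult_op_linear [T' ->]; apply: linear0. Qed.

Lemma mult_opB k T x y : mult_op k T -> T (x - y) = T x - T y.
Proof. by move=> /mult_op_linear [T' ->]; apply: linearB. Qed.

Lemma mult_op_gproj k T (g : G) x : mult_op k T -> gproj A (k + g) (T x) = T (gproj A g x).
Proof.
move=> TP; elim: TP g x => {k T} [k x xk|k x xk|k l S T _ SE _ TE|k a S T _ SE _ TE] g y.
- exact: gprojMl.
- by rewrite addrC; apply: gprojMr.
- by rewrite /= -addrA SE TE.
- by rewrite linearP /= SE TE.
Qed.

Lemma mult_op_homog k T g x : mult_op k T -> x \in gcomp A g -> T x \in gcomp A (k + g).
Proof. by move=> /mult_op_gproj Tk /gproj_id {1}<-; rewrite -Tk gproj_in. Qed.

Lemma mult_op_ideal (I : pred (gcar A)) k T x :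
  is_ideal A I -> mult_op k T -> x \in I -> T x \in I.
Proof.
move=> [sI mulI] TP; elim: TP x => {k T} [k x _|k x _|k l S T _ SI _ TI|k a S T _ SI _ TI] y yI /=.
- exact: (mulI _ _ yI).2.
- exact: (mulI _ _ yI).1.
- exact/SI/TI.
- by apply: sI.2; [apply: SI|apply: TI].
Qed.

Lemma mult_op_centroid c k T x : is_centroid A c -> mult_op k T -> c (T x) = T (c x).
Proof.
move=> [cP cM] TP; elim: TP x => {k T} [k x _|k x _|k l S T _ SE _ TE|k a S T _ SE _ TE] y /=.
- exact: (cM x y).2.
- exact: (cM y x).1.
- by rewrite SE TE.
- by rewrite cP SE TE.
Qed.

Definition sum_of_products (x : gcar A) := exists s : seq (F * gcar A * gcar A),
  x = \sum_(p <- s) p.1.1 *: gmul A p.1.2 p.2.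

Lemma sum_of_products_comb a x y :
  sum_of_products x -> sum_of_products y -> sum_of_products (a *: x + y).
Proof.
move=> [s ->] [r ->]; exists ([seq (a * p.1.1, p.1.2, p.2) | p <- s] ++ r).
rewrite big_cat big_map /= scaler_sumr; congr (_ + _).
by apply: eq_bigr => p _; rewrite scalerA.
Qed.

Lemma mult_op_sum_of_products k T x : mult_op k T -> sum_of_products (T x).
Proof.
move=> TP; elim: TP x => {k T} [k x _|k x _|k l S T _ S2 _ _|k a S T _ S2 _ T2] y /=.
- by exists [:: (1, x, y)]; rewrite big_seq1 scale1r.
- by exists [:: (1, y, x)]; rewrite big_seq1 scale1r.
- exact: S2.
- exact: sum_of_products_comb.
Qed.

Lemma sq_full_eq (V : lmodType F) (f f' : {linear gcar A -> V}) : sq_full A ->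
  (forall x y, f (gmul A x y) = f' (gmul A x y)) -> f =1 f'.
Proof.
move=> sqA ff' x; have [s ->] := sqA x; rewrite !linear_sum; apply: eq_bigr => p _.
by rewrite !linearZ ff'.
Qed.

Definition annihilates (x : gcar A) := forall y : gcar A, gmul A x y = 0 /\ gmul A y x = 0.

Lemma graded_simple_annihilator x : graded_simple A -> annihilates x -> x = 0.
Proof.
move=> [[x0 x0n] [sqA idA]] xann; pose I : pred (gcar A) := fun x => asbool (annihilates x).
have IP y : reflect (annihilates y) (y \in I) by apply: asboolP.
have sI : subspace I.
  split=> [|a y z /IP yann /IP zann]; apply/IP => w; first by rewrite linear0l linear0r.
  rewrite linearPl linearPr /=; have [-> ->] := yann w; have [-> ->] := zann w.
  by rewrite scaler0 addr0.
have [||I0|I1] := idA I.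
- apply: is_ideal_homog => // y g w /IP yann _; have [-> ->] := yann w.
  by split; case: sI.
- apply: is_graded_subspace_gproj => y g /IP yann; apply/IP.
  apply: homog_ind => [|w z [yw wy] [yz zy]|h w wh].
  + by rewrite linear0l linear0r.
  + by rewrite linearDl linearDr /= yw wy yz zy addr0.
  + by rewrite -(gprojMr _ _ wh) -(gprojMl _ _ wh); have [-> ->] := yann w; rewrite !linear0.
- by apply: I0; apply/IP.
- case/eqP: x0n; have [s ->] := sqA x0; rewrite big1 // => p _.
  by have /IP/(_ p.2) [-> _] := I1 p.1.2; rewrite scaler0.
Qed.

Definition reachable a (p : gcar A) g x := exists2 T, mult_op (g - a) T & T p = x.

Lemma reachable0 a p g : reachable a p g 0.
Proof. by exists (gmul A 0); [apply/mult_opl/rpred0|rewrite linear0l]. Qed.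

Lemma reachable_comb a p g b x y :
  reachable a p g x -> reachable a p g y -> reachable a p g (b *: x + y).
Proof.
by move=> [S SP <-] [T TP <-]; exists (fun z => b *: S z + T z); first exact: mult_op_comb.
Qed.

Lemma reachable_mull a p g k x y :
  y \in gcomp A k -> reachable a p g x -> reachable a p (k + g) (gmul A y x).
Proof.
move=> yk [T TP <-]; exists (gmul A y \o T) => //.
by rewrite -addrA; apply: mult_op_comp => //; apply: mult_opl.
Qed.

Lemma reachable_mulr a p g k x y :
  y \in gcomp A k -> reachable a p g x -> reachable a p (g + k) (gmul A x y).
Proof.
move=> yk [T TP <-]; exists (gmul A ^~ y \o T) => //.
by rewrite addrAC addrC; apply: mult_op_comp => //; apply: mult_opr.
Qed.

Definition mult_transitive := forall a g p x,
  p \in gcomp A a -> p != 0 -> x \in gcomp A g -> reachable a p g x.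

Lemma graded_simple_transitive : graded_simple A -> mult_transitive.
Proof.
move=> gsA a g p x pa p0 xg.
pose I : pred (gcar A) := fun y => asbool (forall h, reachable a p h (gproj A h y)).
have IP y : reflect (forall h, reachable a p h (gproj A h y)) (y \in I) by apply: asboolP.
have homogI h y : y \in gcomp A h -> reachable a p h y -> y \in I.
  move=> yh yr; apply/IP => k; rewrite (gproj_homog _ yh).
  by case: eqP => [->|_] //; apply: reachable0.
have sI : subspace I.
  split=> [|b y z /IP yI /IP zI]; apply/IP => h; first by rewrite linear0; apply: reachable0.
  by rewrite linearP; apply: reachable_comb.
have [||I0|I1] := gsA.2.2 I.
- apply: is_ideal_homog => // y k z /IP yI zk; split; apply/IP => h; rewrite -[h](subrK k).
    by rewrite gprojMr //; apply: reachable_mulr.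
  by rewrite addrC gprojMl //; apply: reachable_mull.
- by apply: is_graded_subspace_gproj => y h /IP yI; apply: (homogI h); rewrite ?gproj_in.
- case/eqP: p0; apply: graded_simple_annihilator gsA _.
  apply: homog_ind => [|y z [py yp] [pz zp]|h y yh].
  + by rewrite linear0l linear0r.
  + by rewrite linearDl linearDr /= py yp pz zp addr0.
  + split; apply: I0.
      apply: (homogI (a + h)); first exact: gmul_gcomp.
      by exists (gmul A ^~ y) => //; rewrite addrC addKr; apply: mult_opr.
    apply: (homogI (h + a)); first exact: gmul_gcomp.
    by exists (gmul A y) => //; rewrite addrK; apply: mult_opl.
- by have /IP/(_ g) := I1 x; rewrite gproj_id.
Qed.

Lemma transitive_graded_simple : nonzero A -> mult_transitive -> graded_simple A.
Proof.
move=> nzA trA; split=> //; have [a [p [pa p0]]] := homog_neq0 nzA; split=> [|I Iid gI].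
  apply: homog_ind => [|x y x2 y2|g x xg]; first by exists [::]; rewrite big_nil.
    by rewrite -[x]scale1r; apply: sum_of_products_comb.
  by have [T TP <-] := trA _ _ _ _ pa p0 xg; apply: mult_op_sum_of_products TP.
have [[x [xI /eqP x0]]|I0] := pselect (exists x, x \in I /\ x <> 0); last first.
  by left=> x xI; apply: contrapT => x0; apply: I0; exists x.
have [s [f [fI xE]]] := gI x xI.
have /hasP [g _ fg0] : has (fun g => f g != 0) s.
  by apply: contraNT x0 => /hasPn f0; rewrite xE big_seq big1 // => g /f0 /negbNE /eqP.
right=> y; rewrite -(sum_gproj y); apply: (subspace_sum Iid.1) => h _.
have [T TP <-] := trA _ _ _ _ (fI g).1 fg0 (gproj_in h y).
exact: mult_op_ideal Iid TP (fI g).2.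
Qed.
End MultiplicationOperators.

Lemma simple_graded_simple (F : fieldType) (G : zmodType) (A : gradedAlg F G) :
  simple A -> graded_simple A.
Proof. by move=> [nzA [sqA idA]]; split=> //; split=> // I Iid _; apply: idA. Qed.

(** * The centroid *)

Section Centroid.
Variables (F : fieldType) (G : zmodType) (A : gradedAlg F G).
Implicit Types c d : {linear gcar A -> gcar A}.

Lemma is_centroid_linear (c : gcar A -> gcar A) :
  is_centroid A c -> exists c' : {linear gcar A -> gcar A}, c = c'.
Proof.
move=> [cP _].
by exists (HB.pack_for {linear gcar A -> gcar A} c (GRing.isLinear.Build F _ _ *:%R c cP)).
Qed.

Lemma is_centroid_homog c :
  (forall g h x y, x \in gcomp A g -> y \in gcomp A h ->
     c (gmul A x y) = gmul A (c x) y /\ c (gmul A x y) = gmul A x (c y)) ->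
  is_centroid A c.
Proof.
move=> cM; split=> [a x y|x y]; first exact: linearP.
have mulP : bilinear_for *:%R *:%R (fun x y => c (gmul A x y)).
  by split=> z a u v; rewrite ?linearPl ?linearPr linearP.
split.
  apply: (bilinear_homog_ext mulP (m' := fun x y => gmul A (c x) y)).
    by split=> z a u v; rewrite ?linearP ?linearPl ?linearPr.
  by move=> g h u v ug vh; have [] := cM g h u v ug vh.
apply: (bilinear_homog_ext mulP (m' := fun x y => gmul A x (c y))).
  by split=> z a u v; rewrite ?linearP ?linearPl ?linearPr.
by move=> g h u v ug vh; have [] := cM g h u v ug vh.
Qed.

Lemma is_centroid_comb a c d : is_centroid A c -> is_centroid A d ->
  is_centroid A (fun x => a *: c x + d x).
Proof.
move=> [cP cM] [dP dM]; split=> [b x y|x y].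
  by rewrite cP dP !scalerDr !scalerA [a * b]mulrC addrACA.
by rewrite linearPl linearPr /= -(cM x y).1 -(cM x y).2 -(dM x y).1 -(dM x y).2.
Qed.

Lemma is_centroid_comp c d : is_centroid A c -> is_centroid A d -> is_centroid A (c \o d).
Proof.
move=> [cP cM] [dP dM]; split=> [a x y|x y] /=; first by rewrite dP cP.
by rewrite {1}(dM x y).1 (cM _ _).1 (dM x y).2 (cM _ _).2.
Qed.

Definition homog_centroid k c := is_centroid A c /\ centroid_deg A k c.

Lemma homog_centroid_gproj k c g x :
  homog_centroid k c -> gproj A (k + g) (c x) = c (gproj A g x).
Proof. by move=> [_ ck]; apply: gproj_shift. Qed.

Lemma homog_centroid_id : homog_centroid 0 idfun.
Proof. by split=> [|g x]; rewrite ?add0r. Qed.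

Lemma homog_centroid_comp k l c d :
  homog_centroid k c -> homog_centroid l d -> homog_centroid (k + l) (c \o d).
Proof.
move=> [cC ck] [dC dl]; split=> [|g x xg]; first exact: is_centroid_comp.
by rewrite -addrA; apply/ck/dl.
Qed.

Definition centroid_component k c : {linear gcar A -> gcar A} :=
  glue (fun g => gproj A (k + g) \o c).

Lemma centroid_component_gcomp k c g x :
  x \in gcomp A g -> centroid_component k c x = gproj A (k + g) (c x).
Proof. exact: glue_homog. Qed.

Lemma centroid_component_homog k c : is_centroid A c -> homog_centroid k (centroid_component k c).
Proof.
move=> [_ cM]; split=> [|g x /centroid_component_gcomp ->]; last exact: gproj_in.
apply: is_centroid_homog => g h x y xg yh.
rewrite (centroid_component_gcomp _ _ (gmul_gcomp xg yh)).
rewrite (centroid_component_gcomp _ _ xg) (centroid_component_gcomp _ _ yh).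
by split; [rewrite (cM x y).1 addrA gprojMr|rewrite (cM x y).2 addrCA gprojMl].
Qed.

Lemma centroid_commute c d : sq_full A -> is_centroid A c -> is_centroid A d ->
  forall x, c (d x) = d (c x).
Proof.
move=> sqA [_ cM] [_ dM]; apply: (sq_full_eq (f := c \o d) (f' := d \o c)) => // x y /=.
by rewrite (dM x y).2 (cM _ _).1 (cM x y).1 (dM _ _).2.
Qed.

Section GradedSimple.
Hypothesis gsA : graded_simple A.

Lemma homog_centroid_eq0 k c x : homog_centroid k c -> x != 0 -> c x = 0 -> c =1 \0.
Proof.
move=> cH x0 cx0; have [cC _] := cH; case E : (gsupp x) => [|a s].
  by case/eqP: x0; rewrite -(sum_gproj x) E big_nil.
have p0 : gproj A a x != 0 by rewrite -mem_gsupp E mem_head.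
apply: (linear_homog_ext (f' := \0)) => g y yg /=.
have [T TP <-] := graded_simple_transitive gsA (gproj_in a x) p0 yg.
by rewrite (mult_op_centroid _ cC TP) -(homog_centroid_gproj a x cH) cx0 linear0 (mult_op0 TP).
Qed.

Lemma homog_centroid_inj k c x : homog_centroid k c -> c x != 0 -> injective c.
Proof.
move=> cH cx y z cyz; apply/eqP; rewrite -subr_eq0; apply: contraNT cx => yz.
by rewrite (homog_centroid_eq0 cH yz) // linearB cyz subrr.
Qed.

Lemma homog_centroid_surj k c x : homog_centroid k c -> c x != 0 -> forall y, exists z, c z = y.
Proof.
move=> cH cx; have [cC ck] := cH; have [|a [p [pa p0]]] := homog_neq0 (A := A).
  by exists x; apply: contraNneq cx => ->; rewrite linear0.
have cp0 : c p != 0.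
  by apply: contraNneq cx => cp0; rewrite (homog_centroid_eq0 cH p0 cp0).
apply: homog_ind => [|_ _ [y <-] [z <-]|g y yg]; first by exists 0; rewrite linear0.
  by exists (y + z); rewrite linearD.
have [T TP <-] := graded_simple_transitive gsA (ck _ _ pa) cp0 yg.
by exists (T p); rewrite (mult_op_centroid _ cC TP).
Qed.

Lemma homog_centroid_inv k c x : homog_centroid k c -> c x != 0 ->
  exists d, [/\ homog_centroid (- k) d, cancel c d & cancel d c].
Proof.
move=> cH cx; have [[_ cM] ck] := cH; have cI := homog_centroid_inj cH cx.
have [d dK] := choice (homog_centroid_surj cH cx).
have dC : is_centroid A d.
  split=> [a y z|y z]; first by apply: cI; rewrite linearP /= !dK.
  by split; apply: cI; [rewrite (cM _ _).1 !dK|rewrite (cM _ _).2 !dK].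
have [d' dE] := is_centroid_linear dC; exists d'; rewrite -dE; split=> // [|y]; last exact/cI/dK.
split=> [|g y yg]; rewrite -dE //; suff <- : gproj A (- k + g) (d y) = d y by apply: gproj_in.
by apply: cI; rewrite -(homog_centroid_gproj _ _ cH) dK addNKr gproj_id.
Qed.
End GradedSimple.

Section GradedCentralSimple.
Hypothesis gcsA : graded_central_simple A.

Lemma homog_centroid_line k c d x : homog_centroid k c -> c x != 0 -> homog_centroid k d ->
  exists lam : F, d =1 lam \*: c.
Proof.
move=> cH cx dH; have [c' [c'H cK c'K]] := homog_centroid_inv gcsA.1 cH cx.
have [] := homog_centroid_comp c'H dH; rewrite addNr => c'dC c'd0.
have [lam lamE] := gcsA.2 _ c'dC c'd0.
by exists lam => y /=; rewrite -[LHS]c'K [c' _]lamE linearZ.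
Qed.

Definition centroid_support k := exists c x, homog_centroid k c /\ c x != 0.

Lemma centroid_support0 : centroid_support 0.
Proof. by have [[[x x0] _] _] := gcsA; exists idfun, x; split=> //; apply: homog_centroid_id. Qed.

Lemma centroid_supportB k l : centroid_support k -> centroid_support l -> centroid_support (k - l).
Proof.
move=> [c [x [cH cx]]] [d [y [dH dy]]]; have [d' [d'H dK d'K]] := homog_centroid_inv gcsA.1 dH dy.
by exists (c \o d'), (d x); rewrite /= dK; split=> //; apply: homog_centroid_comp.
Qed.

Definition in_centroid_support : pred G := fun k => asbool (centroid_support k).

Lemma in_centroid_support0 : 0 \in in_centroid_support.
Proof. exact/asboolP/centroid_support0. Qed.

Lemma in_centroid_supportB k l :
  k \in in_centroid_support -> l \in in_centroid_support -> k - l \in in_centroid_support.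
Proof. by move=> /asboolP kS /asboolP lS; apply/asboolP/centroid_supportB. Qed.

Definition centroid_subgrp : subgrp G := SubGrp in_centroid_support0 in_centroid_supportB.
End GradedCentralSimple.
End Centroid.

Section Span.
Variables (F : fieldType) (V : lmodType F) (P : pred V).

Lemma mem_spanP : {subset P <= spanP P}.
Proof. by move=> v vP; rewrite unfold_in; apply/asboolP => Q _ _; apply. Qed.

Lemma spanP_min (Q : pred V) : subspace Q -> {subset P <= Q} -> {subset spanP P <= Q}.
Proof. by move=> [Q0 QL] PQ v; rewrite unfold_in => /asboolP; apply. Qed.
End Span.

Section CentroidAlgebra.
Variables (F : fieldType) (G : zmodType) (A : gradedAlg F G).
Implicit Types c d : {linear gcar A -> gcar A}.

Definition cval (z : gcar (centroid_alg A)) : gcar A -> gcar A :=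
  sp_val (z : spanT (cent_gen A)).

Lemma cval_centroid z : is_centroid A (cval z).
Proof.
suff /asboolP : sp_val (z : spanT (cent_gen A)) \in cent_gen A by [].
apply: (spanP_min _ _ (sp_valP _)) => //.
split=> [|a c d /asboolP cC /asboolP dC]; apply/asboolP.
  by split=> [a x y|x y]; rewrite ?scaler0 ?addr0 // linear0l linear0r.
have [[c' ?] [d' ?]] := (is_centroid_linear cC, is_centroid_linear dC); subst c d.
exact: is_centroid_comb.
Qed.
HB.instance Definition _ z :=
  GRing.isLinear.Build F (gcar A) (gcar A) *:%R (cval z) (cval_centroid z).1.

Definition centroid_elt (c : gcar A -> gcar A) : gcar (centroid_alg A) :=
  insubd (0 : spanT (cent_gen A)) (c : funT (gcar A) (gcar A)).

Lemma centroid_eltE c : is_centroid A c -> cval (centroid_elt c) = c.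
Proof.
by move=> cC; apply: (insubdK (0 : spanT (cent_gen A))); apply/mem_spanP/asboolP.
Qed.

Lemma cval_ext z w : cval z =1 cval w -> z = w.
Proof. by move=> zw; apply/val_inj/funext. Qed.

Lemma cval_comb a z w x : cval (a *: z + w) x = a *: cval z x + cval w x.
Proof. by []. Qed.

Lemma cval_scale a z x : cval (a *: z) x = a *: cval z x.
Proof. by []. Qed.

Lemma cval_sum (I : Type) (r : seq I) (z : I -> gcar (centroid_alg A)) x :
  cval (\sum_(i <- r) z i) x = \sum_(i <- r) cval (z i) x.
Proof. by elim: r => [|i r IH]; rewrite ?big_nil ?big_cons //= -IH. Qed.

Lemma cval_mul z w x : cval (gmul (centroid_alg A) z w) x = cval z (cval w x).
Proof.
rewrite -[gmul _ z w]/(centroid_elt (cval z \o cval w)) centroid_eltE //.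
by apply: is_centroid_comp; apply: cval_centroid.
Qed.

Lemma centroid_gcompP k z : reflect (homog_centroid k (cval z)) (z \in gcomp (centroid_alg A) k).
Proof. by apply: (iffP (asboolP _)) => [zk|[]//]; split=> //; apply: cval_centroid. Qed.

(* Only finitely many components of [c] are nonzero, since a homogeneous component which is
   nonzero does not kill any nonzero [x]. *)
Lemma centroid_decomposition c : graded_simple A -> is_centroid A c ->
  exists s, c =1 fun x => \sum_(k <- s) centroid_component k c x.
Proof.
move=> gsA cC; have [a [p [pa p0]]] := homog_neq0 gsA.1.
pose s := [seq g - a | g <- gsupp (c p)].
have us : uniq s by rewrite map_inj_uniq ?gsupp_uniq //; apply: addIr.
have supp k g x : x \in gcomp A g -> gproj A (k + g) (c x) != 0 -> k \in s.
  move=> xg; rewrite -(centroid_component_gcomp k c xg) => ckx.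
  suff : k + a \in gsupp (c p) by move=> ka; apply/mapP; exists (k + a); rewrite ?addrK.
  rewrite mem_gsupp -(centroid_component_gcomp k c pa); apply: contraNneq ckx => ckp.
  by rewrite (homog_centroid_eq0 gsA (centroid_component_homog k cC) p0 ckp).
exists s; apply: homog_ind => [|x y xE yE|g x xg].
- by rewrite linear0 big1 // => k _; rewrite linear0.
- by rewrite linearD xE yE -big_split; apply: eq_bigr => k _; rewrite linearD.
under eq_bigr do rewrite (centroid_component_gcomp _ _ xg).
rewrite -(big_map (+%R^~ g) predT (fun h => gproj A h (c x))) sum_gproj_over //.
  by rewrite map_inj_uniq //; apply: addIr.
move=> h; rewrite -{1}(subrK g h) => /(supp _ _ _ xg) hs.
  by apply/mapP; exists (h - g); rewrite ?subrK.
Qed.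

Lemma centroid_galg : graded_simple A -> is_galg (centroid_alg A).
Proof.
move=> gsA; split; [split=> a z w v|split; [|split; [|split]]].
- by apply: cval_ext => x; rewrite cval_comb !cval_mul.
- by apply: cval_ext => x; rewrite cval_comb !cval_mul cval_comb linearP.
- move=> k; split=> [|a z w /centroid_gcompP [_ zk] /centroid_gcompP [_ wk]];
    apply/asboolP => g x xg; first exact: rpred0.
  by rewrite rpredD ?rpredZ ?zk ?wk.
- move=> z; have zC := cval_centroid z; have [s zE] := centroid_decomposition gsA zC.
  pose zk k := centroid_elt (centroid_component k (cval z)).
  have zkE k : cval (zk k) = centroid_component k (cval z).
    by apply: centroid_eltE; have [] := centroid_component_homog k zC.
  exists s, zk; split=> [k|]; last first.
    by apply: cval_ext => x; rewrite cval_sum zE; apply: eq_bigr => k _; rewrite zkE.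
  by apply/asboolP; rewrite -/(cval _) zkE; have [] := centroid_component_homog k zC.
- move=> s z us zC z0 k ks; apply: cval_ext; apply: (linear_homog_ext (f' := \0)) => g x xg /=.
  pose y h := cval (z (h - g)) x.
  have yE l : y (l + g) = cval (z l) x by rewrite /y addrK.
  rewrite -yE; apply: (gcomp_independent (s := [seq l + g | l <- s])); last exact: map_f.
  + by rewrite map_inj_uniq //; apply: addIr.
  + by move=> h; rewrite -{2}(subrK g h); have /centroid_gcompP [_] := zC (h - g); apply.
  + by rewrite big_map; under eq_bigr do rewrite yE; rewrite -cval_sum z0.
- move=> k l z w /centroid_gcompP [_ zk] /centroid_gcompP [_ wl]; apply/asboolP => g x xg.
  by rewrite -/(cval _) cval_mul -addrA; apply/zk/wl.
Qed.
End CentroidAlgebra.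

(** * Symmetric cocycles and charts *)

Section Cocycles.
Variables (F : fieldType) (G : zmodType).
Implicit Types (t s : G -> G -> F) (gam : G -> F).

Section Identities.
Variables (t : G -> G -> F) (tC : sym2cocycle t).

Lemma cocycle_neq0 a b : t a b != 0. Proof. by case: tC. Qed.

Lemma cocycleA a b c : t a b * t (a + b) c = t a (b + c) * t b c.
Proof. by case: tC => _ []. Qed.

Lemma cocycleC a b : t a b = t b a. Proof. by case: tC => _ []. Qed.

Lemma cocycleCA a b c : t a c * t b (a + c) = t b c * t a (b + c).
Proof.
by rewrite mulrC -cocycleA [RHS]mulrC -cocycleA [b + a]addrC [t b a]cocycleC.
Qed.

Lemma cocycle0l a : t 0 a = t 0 0.
Proof.
have := cocycleA 0 0 a; rewrite !add0r => /(mulIf (cocycle_neq0 _ _)).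
by [].
Qed.
End Identities.

Definition coboundary gam a b := gam a * gam b / gam (a + b).

Lemma sym2cocycle_coboundary gam : (forall a, gam a != 0) -> sym2cocycle (coboundary gam).
Proof.
move=> gam0; split=> [a b|]; first by rewrite !mulf_neq0 ?invr_eq0.
split=> [a b c|a b]; rewrite /coboundary; last by rewrite addrC [gam a * _]mulrC.
by rewrite addrA; field; rewrite !gam0.
Qed.

Lemma sym2cocycleM s t : sym2cocycle s -> sym2cocycle t -> sym2cocycle (fun a b => s a b * t a b).
Proof.
move=> sC tC; split=> [a b|]; first by rewrite mulf_neq0 ?cocycle_neq0.
split=> [a b c|a b]; last by rewrite (cocycleC sC) (cocycleC tC).
by rewrite mulrACA (cocycleA sC) (cocycleA tC) mulrACA.
Qed.

Lemma sym2cocycleV t : sym2cocycle t -> sym2cocycle (fun a b => (t a b)^-1).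
Proof.
move=> tC; split=> [a b|]; first by rewrite invr_eq0 cocycle_neq0.
split=> [a b c|a b]; last by rewrite (cocycleC tC).
by rewrite -!invfM (cocycleA tC).
Qed.
End Cocycles.

Record tloop_chart (F : fieldType) (G Gb : zmodType) (pi : G -> Gb) (t : G -> G -> F)
    (A : gradedAlg F Gb) (B : gradedAlg F G) (phi : G -> {linear gcar A -> gcar B}) : Prop :=
  TloopChart {
    chart_gcomp : forall g x, x \in gcomp A (pi g) -> phi g x \in gcomp B g;
    chart_eq0 : forall g x, x \in gcomp A (pi g) -> phi g x = 0 -> x = 0;
    chart_surj : forall g y, y \in gcomp B g -> exists2 x, x \in gcomp A (pi g) & phi g x = y;
    chart_mul : forall g h x y, x \in gcomp A (pi g) -> y \in gcomp A (pi h) ->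
      gmul B (phi g x) (phi h y) = t g h *: phi (g + h) (gmul A x y) }.
Arguments tloop_chart {F G Gb} pi t A B phi.

Section Charts.
Variables (F : fieldType) (G Gb : zmodType) (pi : G -> Gb).

Lemma chart_inj (t : G -> G -> F) (A : gradedAlg F Gb) (B : gradedAlg F G)
    (phi : G -> {linear gcar A -> gcar B}) g x y : tloop_chart pi t A B phi ->
  x \in gcomp A (pi g) -> y \in gcomp A (pi g) -> phi g x = phi g y -> x = y.
Proof.
move=> chart xg yg xy; apply/subr0_eq/(chart_eq0 chart (g := g)); first exact: rpredB.
by rewrite linearB /= xy subrr.
Qed.

Lemma chart_inverse (t : G -> G -> F) (A : gradedAlg F Gb) (B : gradedAlg F G)
    (phi : G -> {linear gcar A -> gcar B}) : tloop_chart pi t A B phi ->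
  exists psi : G -> {linear gcar B -> gcar A},
    [/\ forall g y, psi g y \in gcomp A (pi g),
        forall g y, y \in gcomp B g -> phi g (psi g y) = y &
        forall g x, x \in gcomp A (pi g) -> psi g (phi g x) = x].
Proof.
move=> chart; pose inverse g (psi : {linear gcar B -> gcar A}) := forall y,
  psi y \in gcomp A (pi g) /\ phi g (psi y) = gproj B g y.
have /choice [psi psiP] : forall g, exists psi, inverse g psi.
  move=> g; have /choice [f fP] : forall y, exists x, x \in gcomp A (pi g) /\ phi g x = gproj B g y.
    by move=> y; have [x] := chart_surj chart (gproj_in g y); exists x.
  have fL : linear f.
    move=> a y z; have [[yA yE] [zA zE]] := (fP y, fP z); have [yzA yzE] := fP (a *: y + z).
    apply: (chart_inj chart yzA); first by rewrite rpredD ?rpredZ.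
    by rewrite yzE !linearP /= yE zE.
  by exists (HB.pack_for {linear gcar B -> gcar A} f (GRing.isLinear.Build F _ _ *:%R f fL)).
exists psi; split=> [g y|g y yg|g x xg]; first by have [] := psiP g y.
  by have [_ ->] := psiP g y; apply: gproj_id.
have [xA xE] := psiP g (phi g x).
by apply: (chart_inj chart xA xg); rewrite xE gproj_id ?(chart_gcomp chart).
Qed.
End Charts.

Section Twist.
Variables (F : fieldType) (G : zmodType) (A : gradedAlg F G) (t : G -> G -> F).

Lemma twist_mulE (r s : seq G) x y : uniq r -> uniq s ->
  (forall g, gproj A g x != 0 -> g \in r) -> (forall h, gproj A h y != 0 -> h \in s) ->
  gmul (twist A t) x y =
    \sum_(g <- r) \sum_(h <- s) t g h *: gmul A (gproj A g x) (gproj A h y).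
Proof.
move=> ur us xr ys; have [[ux _ _] [uy _ _]] := (gdecP x, gdecP y).
have gdecE z g : g \in (gdec z).1 -> (gdec z).2 g = gproj A g z by rewrite /gproj => ->.
have supp z g : gproj A g z != 0 -> g \in (gdec z).1 by rewrite /gproj; case: ifP; rewrite ?eqxx.
have inner g : \sum_(h <- (gdec y).1) t g h *: gmul A (gproj A g x) ((gdec y).2 h) =
    \sum_(h <- s) t g h *: gmul A (gproj A g x) (gproj A h y).
  rewrite big_seq; under eq_bigr => h hy do rewrite gdecE //.
  have nz h : t g h *: gmul A (gproj A g x) (gproj A h y) != 0 -> gproj A h y != 0.
    by apply: contra_neq => ->; rewrite linear0 scaler0.
  by rewrite -big_seq; apply: sum_over_support => // h /nz; [apply: supp|apply: ys].
rewrite [LHS]big_seq; under eq_bigr => g gx do rewrite gdecE // inner.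
have nz g : \sum_(h <- s) t g h *: gmul A (gproj A g x) (gproj A h y) != 0 -> gproj A g x != 0.
  by apply: contra_neq => ->; rewrite big1 // => h _; rewrite linear0l scaler0.
by rewrite -big_seq; apply: sum_over_support => // g /nz; [apply: supp|apply: xr].
Qed.

Lemma twist_homog g h x y : x \in gcomp A g -> y \in gcomp A h ->
  gmul (twist A t) x y = t g h *: gmul A x y.
Proof.
have single k z : z \in gcomp A k -> forall l, gproj A l z != 0 -> l \in [:: k].
  by move=> zk l; rewrite (gproj_homog _ zk) inE; case: (l == k); rewrite ?eqxx.
move=> xg yh; rewrite (twist_mulE _ _ (single g x xg) (single h y yh)) //.
by rewrite !big_seq1 !gproj_id.
Qed.

Lemma twist_galg : is_galg (twist A t).
Proof.
split; last first.
  case: (gradedAlgP A) => _ [subA [spanA [indepA _]]]; do 3!split=> //.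
  by move=> g h x y xg yh; rewrite (twist_homog xg yh) rpredZ ?gmul_gcomp.
have supp x g : gproj A g x != 0 -> g \in gsupp x by rewrite mem_gsupp.
have comb a x y (s : seq G) : (forall g, gproj A g x != 0 -> g \in s) ->
    (forall g, gproj A g y != 0 -> g \in s) -> forall g, gproj A g (a *: x + y) != 0 -> g \in s.
  move=> xs ys g; rewrite linearP /=; have [->|/xs //] := eqVneq (gproj A g x) 0.
  by rewrite scaler0 add0r; apply: ys.
split=> a x y z; have [s [us xs ys]] := common_support x y.
  rewrite !(@twist_mulE s (gsupp z)) ?gsupp_uniq //; try by [apply: supp|apply: comb].
  rewrite scaler_sumr -big_split; apply: eq_bigr => g _ /=.
  rewrite scaler_sumr -big_split; apply: eq_bigr => h _ /=.
  by rewrite linearP linearPl scalerDr !scalerA mulrC.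
rewrite !(@twist_mulE (gsupp z) s) ?gsupp_uniq //; try by [apply: supp|apply: comb].
rewrite scaler_sumr -big_split; apply: eq_bigr => g _ /=.
rewrite scaler_sumr -big_split; apply: eq_bigr => h _ /=.
by rewrite linearP linearPr scalerDr !scalerA mulrC.
Qed.
End Twist.

Canonical twist_gradedAlg (F : fieldType) (G : zmodType) (A : gradedAlg F G) (t : G -> G -> F) :=
  GradedAlg (twist_galg A t).

Section ChartOperations.
Variables (F : fieldType) (G Gb : zmodType) (pi : G -> Gb).
Implicit Types (A : gradedAlg F Gb) (B C : gradedAlg F G) (s t : G -> G -> F).

Lemma twist_chart B t : tloop_chart idfun t B (twist_gradedAlg B t) (fun=> idfun).
Proof. by split=> // [g y yg|g h x y xg yh]; [exists y|apply: twist_homog]. Qed.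

Lemma untwist_chart B t : (forall g h, t g h != 0) ->
  tloop_chart idfun t (twist_gradedAlg B (fun g h => (t g h)^-1)) B (fun=> idfun).
Proof.
move=> t0; split=> // [g y yg|g h x y xg yh]; first by exists y.
by rewrite (@twist_homog _ _ B _ _ _ _ _ xg yh) /= scalerA divff ?scale1r.
Qed.

Lemma chart_eq A B s t phi : tloop_chart pi s A B phi -> s =2 t -> tloop_chart pi t A B phi.
Proof.
by case=> chart_gcomp chart_eq0 chart_surj chart_mul st; split=> // *; rewrite -st chart_mul.
Qed.

Lemma chart_twist A B s t phi : tloop_chart pi s A B phi ->
  tloop_chart pi (fun g h => s g h * t g h) A (twist_gradedAlg B t) phi.
Proof.
case=> chart_gcomp chart_eq0 chart_surj chart_mul; split=> // g h x y xg yh.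
rewrite (@twist_homog _ _ B t g h) ?chart_gcomp // chart_mul // scalerA.
by rewrite [t g h * _]mulrC.
Qed.

Lemma chart_cochain A B t phi (gam : G -> F) : (forall g, gam g != 0) ->
  tloop_chart pi t A B phi ->
  tloop_chart pi (fun g h => t g h * coboundary gam g h) A B (fun g => gam g \*: phi g).
Proof.
move=> gam0 chart; split=> [g x xg|g x xg /eqP|g y /(chart_surj chart) [x xg <-]|g h x y xg yh] /=.
- by rewrite rpredZ ?(chart_gcomp chart).
- by rewrite scaler_eq0 (negbTE (gam0 g)) => /eqP; apply: chart_eq0 chart _ _ _.
- by exists ((gam g)^-1 *: x); rewrite ?rpredZ // linearZ /= scalerA divff ?scale1r.
- rewrite linearZr_LR linearZl_LR /= (chart_mul chart) // !scalerA; congr (_ *: _).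
  by rewrite /coboundary; field.
Qed.

Lemma chart_comp (Gc : zmodType) (rho : {additive Gc -> G}) (u : Gc -> Gc -> F)
    A B (C : gradedAlg F Gc) t phi psi :
  tloop_chart pi t A B phi -> tloop_chart rho u B C psi ->
  tloop_chart (pi \o rho) (fun g h => u g h * t (rho g) (rho h)) A C
    (fun g => psi g \o phi (rho g)).
Proof.
move=> chartA chartB; split=> [g x xg|g x xg|g y yg|g h x y xg yh] /=.
- exact/(chart_gcomp chartB)/(chart_gcomp chartA).
- by move=> /(chart_eq0 chartB (chart_gcomp chartA xg)); apply: chart_eq0 chartA _ _ _.
- have [z zg <-] := chart_surj chartB yg; have [x xg <-] := chart_surj chartA zg.
  by exists x.
- rewrite (chart_mul chartB) ?(chart_gcomp chartA) // (chart_mul chartA) // linearZ /= scalerA.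
  by rewrite raddfD.
Qed.

Lemma chart_giso (A B : gradedAlg F G) phi : tloop_chart idfun (fun _ _ => 1) A B phi -> giso A B.
Proof.
move=> chart; pose f : {linear gcar A -> gcar B} := glue phi.
have f_homog g x : x \in gcomp A g -> f x = phi g x by apply: glue_homog.
have f_gcomp g x : x \in gcomp A g -> f x \in gcomp B g.
  by move=> xg; rewrite (f_homog g) ?(chart_gcomp chart).
have f_gproj g x : gproj B g (f x) = phi g (gproj A g x).
  rewrite -(f_homog g) ?gproj_in // -[g in LHS]add0r gproj_shift // => h y.
  by rewrite add0r; apply: f_gcomp.
have f_inj : injective f.
  move=> x y xy; apply: gproj_ext => g; apply: (chart_inj chart (g := g)); rewrite ?gproj_in //.
  by rewrite -!f_gproj xy.
have f_surj y : exists x, f x = y.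
  elim/homog_ind: y => [|_ _ [x <-] [y <-]|g y yg]; first by exists 0; rewrite linear0.
    by exists (x + y); rewrite linearD.
  by have [x xg <-] := chart_surj chart yg; exists x; rewrite (f_homog g).
have [f' f'K] := choice f_surj; exists f; split=> [a x y|]; first exact: linearP.
split; first by exists f' => // x; apply: f_inj; rewrite f'K.
split=> [|]; last split=> [|g y /(chart_surj chart) [x xg <-]]; [|exact: f_gcomp|]; last first.
  by exists x => //; rewrite (f_homog g).
apply: (bilinear_homog_ext (m := fun x y => f (gmul A x y)) (m' := fun x y => gmul B (f x) (f y))).
- by split=> z a u v; rewrite ?linearPl ?linearPr linearP.
- by split=> z a u v; rewrite linearP ?linearPl ?linearPr.
move=> g h x y xg yh; rewrite (f_homog _ _ xg) (f_homog _ _ yh) (f_homog _ _ (gmul_gcomp xg yh)).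
by rewrite (chart_mul chart) // scale1r.
Qed.

Lemma giso_chart (A B : gradedAlg F G) : giso A B ->
  exists f : {linear gcar A -> gcar B}, tloop_chart idfun (fun _ _ => 1) A B (fun=> f).
Proof.
move=> [f [fL [[f' fK f'K] [fM [fA fB]]]]].
pose f_lin := HB.pack_for {linear gcar A -> gcar B} f (GRing.isLinear.Build F _ _ *:%R f fL).
exists f_lin; split=> //= [g x xg fx0|g h x y xg yh]; last by rewrite fM scale1r.
by apply: (can_inj fK); rewrite fx0; apply/esym/(linear0 f_lin).
Qed.

Lemma chart_unique (rho : {additive G -> Gb}) A B C t phi psi :
  tloop_chart rho t A B phi -> tloop_chart rho t A C psi -> giso B C.
Proof.
move=> chartB chartC; have [phi' [phi'in phiK phi'K]] := chart_inverse chartB.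
apply: (chart_giso (phi := fun g => psi g \o phi' g)).
split=> [g y yg|g y yg|g z /(chart_surj chartC) [x xg <-]|g h y z yg zh] /=.
- exact: (chart_gcomp chartC).
- by move/(chart_eq0 chartC (phi'in _ _)) => y0; rewrite -(phiK _ _ yg) y0 linear0.
- by exists (phi g x); rewrite ?phi'K ?(chart_gcomp chartB).
rewrite -{2}(phiK _ _ yg) -{2}(phiK _ _ zh) (chart_mul chartB) ?phi'in // linearZ /=.
rewrite phi'K ?(chart_mul chartC) ?phi'in ?linearZ /= ?scale1r //.
by rewrite raddfD gmul_gcomp ?phi'in.
Qed.
End ChartOperations.

(** * Transfer along a chart *)

Section ChartTransfer.
Variables (F : fieldType) (G Gb : zmodType) (pi : {additive G -> Gb}) (t : G -> G -> F).
Variables (A : gradedAlg F Gb) (B : gradedAlg F G) (phi : G -> {linear gcar A -> gcar B}).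
Hypothesis pi_surj : forall a, exists g, pi g = a.
Hypothesis tC : sym2cocycle t.
Hypothesis chart : tloop_chart pi t A B phi.

Let t_neq0 g h : t g h != 0. Proof. exact: cocycle_neq0. Qed.

Lemma mult_op_lift b T k g : mult_op b T -> pi k = b ->
  exists2 S, mult_op k S & forall x, x \in gcomp A (pi g) -> S (phi g x) = phi (k + g) (T x).
Proof.
move=> TP; elim: TP k g => {b T} [b y yb|b y yb|b d T T' _ IH T'P IH'|b a T T' _ IH _ IH'] k g kb.
- exists (gmul B (phi k ((t k g)^-1 *: y))).
    by apply/mult_opl/(chart_gcomp chart); rewrite kb rpredZ.
  move=> x xg; rewrite (chart_mul chart) ?kb ?rpredZ // -linearZ /= linearZl_LR /= scalerA.
  by rewrite divff ?scale1r.
- exists (gmul B ^~ (phi k ((t g k)^-1 *: y))).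
    by apply/mult_opr/(chart_gcomp chart); rewrite kb rpredZ.
  move=> x xg; rewrite (chart_mul chart) ?kb ?rpredZ // -linearZ /= linearZr_LR /= scalerA addrC.
  by rewrite divff ?scale1r.
- have [l lb] := pi_surj b; have ld : pi (k - l) = d by rewrite raddfB /= kb lb addrAC subrr add0r.
  have [S' S'P S'E] := IH' _ g ld; have [S SP SE] := IH _ (k - l + g) lb.
  exists (S \o S'); first by rewrite -[k](subrK l) addrC; apply: mult_op_comp.
  move=> x xg; rewrite /= S'E // SE; first by rewrite addrA [l + _]addrC subrK.
  by rewrite raddfD ld; apply: mult_op_homog.
- have [S SP SE] := IH _ g kb; have [S' S'P S'E] := IH' _ g kb.
  exists (fun x => a *: S x + S' x); first exact: mult_op_comb.
  by move=> x xg; rewrite SE // S'E // linearP.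
Qed.

Lemma mult_op_descend k S g : mult_op k S ->
  exists2 T, mult_op (pi k) T & forall x, x \in gcomp A (pi g) -> S (phi g x) = phi (k + g) (T x).
Proof.
move=> SP; elim: SP g => {k S} [k _ /(chart_surj chart) [y yk <-]|k _ /(chart_surj chart) [y yk <-]
  |k l S S' _ IH _ IH'|k a S S' _ IH _ IH'] g.
- exists (gmul A (t k g *: y)); first by apply: mult_opl; rewrite rpredZ.
  by move=> x xg; rewrite (chart_mul chart) // linearZl_LR linearZ.
- exists (gmul A ^~ (t g k *: y)); first by apply: mult_opr; rewrite rpredZ.
  by move=> x xg; rewrite (chart_mul chart) // linearZr_LR linearZ addrC.
- have [T' T'P T'E] := IH' g; have [T TP TE] := IH (l + g).
  exists (T \o T'); first by rewrite raddfD; apply: mult_op_comp.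
  move=> x xg; rewrite /= T'E // TE ?addrA //.
  by rewrite raddfD; apply: mult_op_homog.
- have [T TP TE] := IH g; have [T' T'P T'E] := IH' g.
  exists (fun x => a *: T x + T' x); first exact: mult_op_comb.
  by move=> x xg; rewrite TE // T'E // linearP.
Qed.

Lemma chart_neq0 g x : x \in gcomp A (pi g) -> x != 0 -> phi g x != 0.
Proof. by move=> xg; apply: contra_neq; apply: (chart_eq0 chart xg). Qed.

Lemma homog_neq0_over : nonzero A -> exists g x, x \in gcomp A (pi g) /\ x != 0.
Proof.
by move=> /homog_neq0 [a [x [xa x0]]]; have [g ga] := pi_surj a; exists g, x; rewrite ga.
Qed.

Lemma chart_graded_simple : graded_simple A -> graded_simple B.
Proof.
move=> gsA; apply: transitive_graded_simple => [|g h ? ?].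
  by have [g [p [pg p0]]] := homog_neq0_over gsA.1; exists (phi g p); apply: chart_neq0.
move=> /(chart_surj chart) [q qg <-] phi_q0 /(chart_surj chart) [y yh <-].
have q0 : q != 0 by apply: contra_neq phi_q0 => ->; rewrite linear0.
have [T TP Tq] := graded_simple_transitive gsA qg q0 yh.
have [|S SP SE] := mult_op_lift (k := h - g) g TP; first by rewrite raddfB.
by exists S => //; rewrite SE // subrK Tq.
Qed.

Lemma base_graded_simple : graded_simple B -> graded_simple A.
Proof.
move=> gsB; have [g [_ [/(chart_surj chart) [p pg <-] p0]]] := homog_neq0 gsB.1.
apply: transitive_graded_simple => [|a b q y].
  by exists p; apply: contra_neq p0 => ->; rewrite linear0.
have [[h <-] [k <-]] := (pi_surj a, pi_surj b) => qh q0 yk.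
have [S SP Sq] := graded_simple_transitive gsB (chart_gcomp chart qh) (chart_neq0 qh q0)
  (chart_gcomp chart yk).
have [T TP TE] := mult_op_descend h SP; exists T; first by rewrite -raddfB.
have Tqk : T q \in gcomp A (pi k) by rewrite -(subrK h k) raddfD; apply: mult_op_homog.
by apply: (chart_inj chart Tqk yk); rewrite -Sq TE // subrK.
Qed.

Lemma homog_centroid_lift k (c : {linear gcar A -> gcar A}) : homog_centroid (pi k) c ->
  exists2 d : {linear gcar B -> gcar B}, homog_centroid k d &
    forall g x, x \in gcomp A (pi g) -> d (phi g x) = t k g *: phi (k + g) (c x).
Proof.
move=> [[_ cM] ck]; have [phi' [phi'in phiK phi'K]] := chart_inverse chart.
pose d : {linear gcar B -> gcar B} := glue (fun g => t k g \*: (phi (k + g) \o c \o phi' g)).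
have dE g x : x \in gcomp A (pi g) -> d (phi g x) = t k g *: phi (k + g) (c x).
  by move=> xg; rewrite [LHS](glue_homog _ (chart_gcomp chart xg)) /= phi'K.
have cA g x : x \in gcomp A (pi g) -> c x \in gcomp A (pi (k + g)) by rewrite raddfD; apply: ck.
exists d => //; split=> [|g _ /(chart_surj chart) [x xg <-]]; last first.
  by rewrite dE // rpredZ ?(chart_gcomp chart) ?cA.
apply: is_centroid_homog => g h _ _ /(chart_surj chart) [x xg <-] /(chart_surj chart) [y yh <-].
have xyA : gmul A x y \in gcomp A (pi (g + h)) by rewrite raddfD; apply: gmul_gcomp.
rewrite (chart_mul chart) // linearZ /= !dE // linearZl_LR linearZr_LR /= !(chart_mul chart) ?cA //.
rewrite !scalerA -(cM x y).1 -(cM x y).2 -addrA [g + (k + h)]addrCA.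
by rewrite (cocycleCA tC k g h) (cocycleA tC k g h) [t k _ * t g h]mulrC.
Qed.

Section Descent.
Hypothesis gsA : graded_simple A.
Variables (k : G) (d : {linear gcar B -> gcar B}).
Hypothesis dH : homog_centroid k d.

Section Coordinates.
Variable D : G -> {linear gcar A -> gcar A}.
Hypothesis D_gcomp : forall g x, x \in gcomp A (pi g) -> D g x \in gcomp A (pi (k + g)).
Hypothesis dE : forall g x, x \in gcomp A (pi g) -> d (phi g x) = t k g *: phi (k + g) (D g x).

Let chart_injZ g a u v : a != 0 -> u \in gcomp A (pi g) -> v \in gcomp A (pi g) ->
  a *: phi g u = a *: phi g v -> u = v.
Proof. by move=> a0 ug vg /(scalerI a0); apply: (chart_inj chart). Qed.

Lemma coordinates_mull l g x y : x \in gcomp A (pi l) -> y \in gcomp A (pi g) ->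
  D (l + g) (gmul A x y) = gmul A x (D g y).
Proof.
move=> xl yg; have xyA : gmul A x y \in gcomp A (pi (l + g)) by rewrite raddfD gmul_gcomp.
apply: (@chart_injZ (k + (l + g)) (t l g * t k (l + g))); rewrite ?D_gcomp ?mulf_neq0 //.
  by rewrite addrCA raddfD gmul_gcomp ?D_gcomp.
rewrite -[LHS]scalerA -dE // -linearZ /= -(chart_mul chart) // (dH.1.2 _ _).2 dE //.
by rewrite linearZr_LR /= (chart_mul chart) ?D_gcomp // scalerA (cocycleCA tC) addrCA.
Qed.

Lemma coordinates_mulr l g x y : x \in gcomp A (pi g) -> y \in gcomp A (pi l) ->
  D (g + l) (gmul A x y) = gmul A (D g x) y.
Proof.
move=> xg yl; have xyA : gmul A x y \in gcomp A (pi (g + l)) by rewrite raddfD gmul_gcomp.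
apply: (@chart_injZ (k + (g + l)) (t g l * t k (g + l))); rewrite ?D_gcomp ?mulf_neq0 //.
  by rewrite addrA raddfD gmul_gcomp ?D_gcomp.
rewrite -[LHS]scalerA -dE // -linearZ /= -(chart_mul chart) // (dH.1.2 _ _).1 dE //.
by rewrite linearZl_LR /= (chart_mul chart) ?D_gcomp // scalerA (cocycleA tC) addrA mulrC.
Qed.

Lemma coordinates_mult_op b T l g x : mult_op b T -> pi l = b -> x \in gcomp A (pi g) ->
  D (l + g) (T x) = T (D g x).
Proof.
move=> TP; elim: TP l g x => {b T}
  [b y yb|b y yb|b b' T T' _ IH T'P IH'|b a T T' _ IH _ IH'] l g x lb xg.
- by apply: coordinates_mull; rewrite ?lb.
- by rewrite addrC; apply: coordinates_mulr; rewrite ?lb.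
- have [m mb] := pi_surj b; have lm : pi (l - m) = b' by rewrite raddfB /= lb mb addrAC subrr add0r.
  rewrite -{1}[l](subrK m) [_ + m]addrC -addrA /= (IH m) ?(IH' (l - m)) //.
  by rewrite raddfD lm; apply: mult_op_homog.
- by rewrite linearP /= (IH l) ?(IH' l).
Qed.

(* [D g] and [D h] commute with the same multiplication operators, under which a nonzero
   homogeneous element generates everything. *)
Lemma coordinates_indep g h x : pi g = pi h -> x \in gcomp A (pi g) -> D g x = D h x.
Proof.
have [g0 [p [pg0 p0]]] := homog_neq0_over gsA.1.
move=> gh xg; have [T TP <-] := graded_simple_transitive gsA pg0 p0 xg.
rewrite -{1}(subrK g0 g) -[in RHS](subrK g0 h).
by rewrite !(coordinates_mult_op TP) ?raddfB ?gh.
Qed.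
End Coordinates.

Lemma homog_centroid_descend : exists2 c : {linear gcar A -> gcar A}, homog_centroid (pi k) c &
  forall g x, x \in gcomp A (pi g) -> d (phi g x) = t k g *: phi (k + g) (c x).
Proof.
have [phi' [phi'in phiK phi'K]] := chart_inverse chart.
pose D g : {linear gcar A -> gcar A} := (t k g)^-1 \*: (phi' (k + g) \o d \o phi g).
have D_gcomp g x : x \in gcomp A (pi g) -> D g x \in gcomp A (pi (k + g)).
  by move=> xg; rewrite rpredZ ?phi'in.
have dE g x : x \in gcomp A (pi g) -> d (phi g x) = t k g *: phi (k + g) (D g x).
  move=> xg; rewrite /= linearZ /= scalerA divff // scale1r phiK //.
  exact: dH.2 (chart_gcomp chart xg).
have [s sK] := choice pi_surj; pose c : {linear gcar A -> gcar A} := glue (fun a => D (s a)).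
have cE g x : x \in gcomp A (pi g) -> c x = D g x.
  move=> xg; rewrite [LHS](glue_homog _ xg).
  by apply: (coordinates_indep D_gcomp dE); rewrite ?sK.
exists c; last by move=> g x xg; rewrite dE // (cE g).
split=> [|a x]; last by have [g <-] := pi_surj a => xg; rewrite (cE g) // -raddfD D_gcomp.
apply: is_centroid_homog => a b x y; have [[g <-] [h <-]] := (pi_surj a, pi_surj b) => xg yh.
rewrite (cE g x xg) (cE h y yh) (cE (g + h)); last by rewrite raddfD gmul_gcomp.
by split; [apply: (coordinates_mulr D_gcomp dE)|apply: (coordinates_mull D_gcomp dE)].
Qed.
End Descent.

Lemma homog_centroid_is_shift k (d : {linear gcar B -> gcar B}) :
  graded_simple A -> central A -> homog_centroid k d ->
  exists a : F, forall g x, x \in gcomp A (pi g) ->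
    d (phi g x) = (a * t k g) *: phi (k + g) x.
Proof.
move=> gsA cA dH; have [c [cC _] dE] := homog_centroid_descend gsA dH.
have [a aE] := cA _ cC; exists a => g x xg.
by rewrite dE // aE linearZ /= scalerA mulrC.
Qed.

Lemma chart_graded_central : graded_simple A -> central A -> graded_central B.
Proof.
move=> gsA cA d0 dC d0deg; have [d dE] := is_centroid_linear dC; rewrite {d0}dE in dC d0deg *.
have [a aE] := homog_centroid_is_shift gsA cA (conj dC d0deg); exists (a * t 0 0).
apply: (linear_homog_ext (f' := (a * t 0 0) \*: idfun)) => g _ /(chart_surj chart) [x xg <-].
by rewrite aE // add0r (cocycle0l tC).
Qed.

Lemma homog_centroid_off_kernel k (d : {linear gcar B -> gcar B}) :
  graded_simple A -> central A -> homog_centroid k d -> pi k != 0 -> d =1 \0.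
Proof.
move=> gsA cA dH k0; apply: (linear_homog_ext (f' := \0)) => g _ /(chart_surj chart) [x xg <-] /=.
have [c [cC ck] ->] // := homog_centroid_descend gsA dH.
have [a aE] := cA _ cC; suff -> : c x = 0 by rewrite linear0 scaler0.
apply: (gcomp_disjoint (ck _ _ xg) (h := pi g)); first by rewrite aE rpredZ.
by rewrite -subr_eq0 addrK.
Qed.

Lemma shift_homog_centroid k : pi k = 0 ->
  exists2 d : {linear gcar B -> gcar B}, homog_centroid k d &
    forall g x, x \in gcomp A (pi g) -> d (phi g x) = t k g *: phi (k + g) x.
Proof.
move=> k0; have [|d dH dE] := @homog_centroid_lift k idfun.
  by rewrite k0; apply: homog_centroid_id.
by exists d.
Qed.

Lemma chart_centroid_support k : graded_simple A -> central A ->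
  centroid_support B k <-> pi k = 0.
Proof.
move=> gsA cA; split=> [[d [y [dH dy]]]|k0].
  by apply/eqP; apply: contraNT dy => /(homog_centroid_off_kernel gsA cA dH) ->.
have [d dH dE] := shift_homog_centroid k0.
have [g [x [xg x0]]] := homog_neq0_over gsA.1.
exists d, (phi g x); split=> //; rewrite dE // scaler_eq0 negb_or t_neq0 /=.
by apply: chart_neq0; rewrite // raddfD /= k0 add0r.
Qed.

Lemma base_centroid_support k : centroid_support A (pi k) -> centroid_support B k.
Proof.
move=> [c [x [cH cx]]]; have [d dH dE] := homog_centroid_lift cH; exists d.
case: (pselect (exists y, d y != 0)) => [[y dy]|d0]; first by exists y.
case/eqP: cx; suff -> : c =1 \0 by [].
apply: (linear_homog_ext (f' := \0)) => a y; have [g <-] := pi_surj a => yg /=.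
have cyg : c y \in gcomp A (pi (k + g)) by rewrite raddfD; apply: cH.2.
apply: (chart_eq0 chart cyg); apply: contrapT => cy0; apply: d0.
by exists (phi g y); rewrite dE // scaler_eq0 negb_or t_neq0; apply/eqP.
Qed.

Lemma base_graded_central : graded_central B -> graded_central A.
Proof.
move=> cB c0 cC; have [c cE] := is_centroid_linear cC; rewrite {c0}cE in cC * => c0.
have [|d [dC d0] dE] := @homog_centroid_lift 0 c; first by split; rewrite ?raddf0.
have [a aE] := cB _ dC d0; exists (a / t 0 0).
apply: (linear_homog_ext (f' := (a / t 0 0) \*: idfun)) => b x; have [g <-] := pi_surj b => xg /=.
have cxg : c x \in gcomp A (pi g) by rewrite -[pi g]add0r; apply: c0.
apply: (chart_inj chart cxg); rewrite ?rpredZ // linearZ /=.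
by rewrite mulrC -scalerA -aE dE // add0r (cocycle0l tC) scalerA mulVf ?scale1r.
Qed.
End ChartTransfer.

(** * Simplicity and graded simplicity *)

Section UngradedSimplicity.
Variables (F : fieldType) (G : zmodType) (A : gradedAlg F G).

Lemma graded_central_central :
  graded_central A -> (forall k, centroid_support A k -> k = 0) -> central A.
Proof.
move=> gcA supp0 c0 cC; have [c cE] := is_centroid_linear cC; rewrite {c0}cE in cC *.
have [cC0 c0] := centroid_component_homog 0 cC; have [a aE] := gcA _ cC0 c0.
exists a => x; rewrite -aE; move: x; apply: linear_homog_ext => g x xg; apply: gproj_ext => h.
rewrite (centroid_component_gcomp _ _ xg) add0r; have [->|hg] := eqVneq h g.
  by rewrite (gproj_id (gproj_in _ _)).
rewrite [RHS](gproj_homog _ (gproj_in g _)) (negbTE hg).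
apply: contra_neq_eq hg; rewrite -{1}(subrK g h) -(centroid_component_gcomp _ _ xg) => chg.
apply/subr0_eq/supp0; exists (centroid_component (h - g) c), x; split=> //.
exact: centroid_component_homog.
Qed.

Section GraphCentroid.
Hypothesis gsA : graded_simple A.
Variables (a b : G) (p q : gcar A).
Hypotheses (pa : p \in gcomp A a) (qb : q \in gcomp A b) (p_neq0 : p != 0).
Hypothesis ann_pq : forall k T, mult_op k T -> T p = 0 -> T q = 0.

(* If every [T] that kills [p] also kills [q], the relation [T p |-> T q] is the graph of a map
   commuting with multiplications, that is, of an element of the centroid carrying [p] to [q]. *)
Definition mult_graph g y z := exists T, [/\ mult_op (g - a) T, T p = y & T q = z].

Lemma mult_graph_ex g y : y \in gcomp A g -> exists z, mult_graph g y z.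
Proof.
by move=> yg; have [T TP Tp] := graded_simple_transitive gsA pa p_neq0 yg; exists (T q), T.
Qed.

Lemma mult_graph_comb g c y z y' z' :
  mult_graph g y z -> mult_graph g y' z' -> mult_graph g (c *: y + y') (c *: z + z').
Proof.
move=> [S [SP <- <-]] [T [TP <- <-]]; exists (fun x => c *: S x + T x).
by split=> //; apply: mult_op_comb.
Qed.

Lemma mult_graph_fun g y z z' : mult_graph g y z -> mult_graph g y z' -> z = z'.
Proof.
move=> yz yz'; have [T [TP Tp Tq]] := mult_graph_comb (-1) yz yz'.
apply/esym/subr0_eq; rewrite addrC -scaleN1r -Tq (ann_pq TP) //.
by rewrite Tp scaleN1r addNr.
Qed.

Lemma mult_graph_mulr g h y z x : x \in gcomp A h -> mult_graph g y z ->
  mult_graph (g + h) (gmul A y x) (gmul A z x).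
Proof.
move=> xh [T [TP <- <-]]; exists (gmul A ^~ x \o T); split=> //.
by rewrite addrAC addrC; apply: mult_op_comp TP; apply: mult_opr.
Qed.

Lemma mult_graph_mull g h y z x : x \in gcomp A h -> mult_graph g y z ->
  mult_graph (h + g) (gmul A x y) (gmul A x z).
Proof.
move=> xh [T [TP <- <-]]; exists (gmul A x \o T); split=> //.
by rewrite -addrA; apply: mult_op_comp TP; apply: mult_opl.
Qed.

Lemma homog_centroid_of_graph : exists2 c : {linear gcar A -> gcar A},
  homog_centroid (b - a) c & forall g y z, y \in gcomp A g -> mult_graph g y z -> c y = z.
Proof.
have /choice [f fP] : forall g, exists f : {linear gcar A -> gcar A},
    forall y, mult_graph g (gproj A g y) (f y).
  move=> g; have [f fP] := choice (fun y => mult_graph_ex (gproj_in g y)).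
  have fL : linear f.
    move=> c x y; apply: (mult_graph_fun (fP _)); rewrite linearP /=.
    exact: mult_graph_comb.
  by exists (HB.pack_for {linear gcar A -> gcar A} f (GRing.isLinear.Build F _ _ *:%R f fL)).
pose c : {linear gcar A -> gcar A} := glue f.
have cP g y z : y \in gcomp A g -> mult_graph g y z -> c y = z.
  move=> yg; rewrite [c y](glue_homog _ yg) => yz; apply: (mult_graph_fun _ yz).
  by rewrite -{1}(gproj_id yg).
exists c => //; split=> [|g y yg]; last first.
  have [z yz] := mult_graph_ex yg; rewrite (cP g y z) //; have [T [TP _ <-]] := yz.
  by rewrite addrAC [b + g]addrC addrAC; apply: mult_op_homog TP qb.
apply: is_centroid_homog => g h x y xg yh.
have [[x' xx'] [y' yy']] := (mult_graph_ex xg, mult_graph_ex yh); have xyA := gmul_gcomp xg yh.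
rewrite (cP _ _ _ xg xx') (cP _ _ _ yh yy').
by split; apply: (cP _ _ _ xyA); [apply: mult_graph_mulr|apply: mult_graph_mull].
Qed.

Lemma homog_centroid_of_mult_op :
  exists2 c : {linear gcar A -> gcar A}, homog_centroid (b - a) c & c p = q.
Proof.
have [c cH cP] := homog_centroid_of_graph; exists c => //; apply/subr0_eq/eqP.
have cpqb : c p - q \in gcomp A b.
  by rewrite rpredB // -[b](subrK a) (cH.2 _ _ pa).
apply: contrapT => /negP cpq; have [T TP Tcpq] := graded_simple_transitive gsA cpqb cpq cpqb.
have cTp : c (T p) = T q by apply: cP (mult_op_homog TP pa) _; exists T; rewrite addrK.
by case/eqP: cpq; rewrite -Tcpq (mult_opB _ _ TP) -cTp (mult_op_centroid _ cH.1 TP) subrr.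
Qed.
End GraphCentroid.

(* A nonzero element of [I] with the least number of homogeneous components. *)
Lemma ideal_shortest_element (I : pred (gcar A)) x : is_ideal A I -> x \in I -> x != 0 ->
  exists2 y, y \in I /\ y != 0 &
    forall a k T, a \in gsupp y -> mult_op k T -> T (gproj A a y) = 0 -> T y = 0.
Proof.
move=> Iid xI xn; pose size_in n := asbool (exists y, [/\ y \in I, y != 0 & size (gsupp y) = n]).
have size_ex : exists n, size_in n by exists (size (gsupp x)); apply/asboolP; exists x.
case: (ex_minnP size_ex) => n /asboolP [y [yI yn <-]] min_size {size_ex n}.
have {}min_size z : z \in I -> (size (gsupp z) < size (gsupp y))%N -> z = 0.
  move=> zI; rewrite ltnNge => /negP zy; apply: contrapT => /eqP z0.
  by apply/zy/min_size/asboolP; exists z.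
exists y => // a k T ay TP Tya; apply: min_size; first exact: mult_op_ideal Iid TP yI.
have rem_lt : (size (rem a (gsupp y)) < size (gsupp y))%N.
  by rewrite size_rem // prednK // -has_predT; apply/hasP; exists a.
apply: leq_ltn_trans rem_lt; rewrite -(size_map (+%R k) (rem a (gsupp y))).
apply: uniq_leq_size (gsupp_uniq _) _ => h; rewrite mem_gsupp -[h](subrK k) addrC.
rewrite (mult_op_gproj _ _ TP) => Th; apply: map_f.
rewrite mem_rem_uniq ?gsupp_uniq // inE mem_gsupp; apply/andP.
by split; apply: contra_neq Th => ->; rewrite ?(mult_op0 TP).
Qed.

Lemma graded_simple_simple : graded_simple A ->
  (forall k, centroid_support A k -> k = 0) -> simple A.
Proof.
move=> gsA supp0; have [nzA [sqA _]] := gsA; split=> //; split=> // I Iid.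
have [[x [xI xn]]|I0] := pselect (exists x, x \in I /\ x != 0); last first.
  by left=> x xI; apply: contrapT => /eqP x0; apply: I0; exists x.
have [y [yI yn] y_shortest] := ideal_shortest_element Iid xI xn.
case y_supp : (gsupp y) => [|a s]; first by case/eqP: yn; rewrite -(sum_gproj y) y_supp big_nil.
have ay : a \in gsupp y by rewrite y_supp mem_head.
have yan : gproj A a y != 0 by rewrite -mem_gsupp.
have ya : y \in gcomp A a.
  rewrite -(sum_gproj y) big_seq; apply: rpred_sum => b by_.
  have [|c cH cab] := homog_centroid_of_mult_op gsA (gproj_in a y) (gproj_in b y) yan.
    by move=> k T TP Tya; rewrite -(mult_op_gproj _ _ TP) (y_shortest _ _ _ ay TP Tya) linear0.
  have /supp0/subr0_eq <- : centroid_support A (b - a); last exact: gproj_in.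
  by exists c, (gproj A a y); rewrite cab -mem_gsupp.
right=> z; rewrite -(sum_gproj z); apply: (subspace_sum Iid.1) => h _.
have [T TP <-] := graded_simple_transitive gsA ya yn (gproj_in h z).
exact: mult_op_ideal Iid TP yI.
Qed.
End UngradedSimplicity.

(** * Loop algebras and group algebras *)

Section FinitelySupportedFunctions.
Variables (F : fieldType) (G : zmodType) (V : lmodType F).
Implicit Types (f : funT G V) (r s : seq G).

Definition support_in s f := forall g, f g != 0 -> g \in s.

Lemma fsuppP f s : support_in s f -> uniq (fsupp f) /\ support_in (fsupp f) f.
Proof.
rewrite /fsupp => fs.
case: ClassicalDescription.excluded_middle_informative => [ex|[]]; last by exists s.
split; first exact: undup_uniq.
case: IndefiniteDescription.constructive_indefinite_description => /= r fr g /fr.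
by rewrite mem_undup.
Qed.

Lemma support_in_comb s a f f' : support_in s f -> support_in s f' -> support_in s (a *: f + f').
Proof.
move=> fs fs' g; change (a *: f g + f' g != 0 -> g \in s).
by have [->|/fs //] := eqVneq (f g) 0; rewrite scaler0 add0r; apply: fs'.
Qed.

Lemma support_in_sub r s f : {subset r <= s} -> support_in r f -> support_in s f.
Proof. by move=> rs fr g /fr/rs. Qed.

Lemma fdelta_id (g : G) (v : V) : fdelta g v g = v.
Proof. by rewrite /fdelta eqxx. Qed.

Lemma support_in_fdelta (g : G) (v : V) : support_in [:: g] (fdelta g v).
Proof. by move=> h; rewrite inE /fdelta; case: (h == g); rewrite ?eqxx. Qed.

Lemma sum_funE (I : Type) (r : seq I) (f : I -> funT G V) g :
  (\sum_(i <- r) f i) g = \sum_(i <- r) f i g.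
Proof. by elim: r => [|i r IH]; rewrite ?big_nil ?big_cons //= -IH. Qed.

Lemma sum_fdelta s f : uniq s -> support_in s f -> \sum_(g <- s) fdelta g (f g) = f.
Proof.
move=> us fs; apply/funext => g; rewrite sum_funE; have [gs|gs] := boolP (g \in s).
  rewrite (bigD1_seq g) //= fdelta_id big1 ?addr0 // => h hg.
  by rewrite /fdelta eq_sym (negbTE hg).
rewrite big_seq big1 => [|h hs]; first by apply/esym/eqP; apply: contraNT gs; apply: fs.
by rewrite /fdelta; case: eqP => // gh; rewrite gh hs in gs.
Qed.

Section Convolution.
Variable m : {bilinear V -> V -> V}.

Lemma conv_over r s f f' k : uniq r -> uniq s -> support_in r f -> support_in s f' ->
  conv m f f' k = \sum_(g <- r) \sum_(h <- s) (if g + h == k then m (f g) (f' h) else 0).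
Proof.
move=> ur us fr fs; have [uf supp_f] := fsuppP fr; have [uf' supp_f'] := fsuppP fs.
pose term g h := if g + h == k then m (f g) (f' h) else 0.
have term_neq0 g h : term g h != 0 -> f g != 0 /\ f' h != 0.
  rewrite /term; case: ifP => _ mn; last by rewrite eqxx in mn.
  by split; apply: contra_neq mn => ->; rewrite ?linear0l ?linear0r.
have inner g : \sum_(h <- fsupp f') term g h = \sum_(h <- s) term g h.
  by apply: sum_over_support => // h /term_neq0 [_]; [apply: supp_f'|apply: fs].
rewrite /conv; under eq_bigr => g _ do rewrite -/(term g _) inner.
have row_neq0 g : \sum_(h <- s) term g h != 0 -> f g != 0.
  apply: contra_neq => fg0; rewrite big1 // => h _.
  by apply: contraTeq isT => /term_neq0 []; rewrite fg0 eqxx.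
by apply: sum_over_support => // g /row_neq0; [apply: supp_f|apply: fr].
Qed.

Lemma conv_fdelta (g h : G) v w : conv m (fdelta g v) (fdelta h w) = fdelta (g + h) (m v w).
Proof.
apply/funext => k; rewrite (@conv_over [:: g] [:: h]) //; try exact: support_in_fdelta.
by rewrite !big_seq1 !fdelta_id /fdelta eq_sym.
Qed.

Lemma conv_combl r s a f1 f2 f : support_in r f1 -> support_in r f2 -> support_in s f ->
  conv m (a *: f1 + f2) f = a *: conv m f1 f + conv m f2 f.
Proof.
have uu (q : seq G) : uniq (undup q) := undup_uniq q.
have sub (q : seq G) f' : support_in q f' -> support_in (undup q) f'.
  by apply: support_in_sub => g; rewrite mem_undup.
move=> /sub f1r /sub f2r /sub fs; apply/funext => k.
change (conv m (a *: f1 + f2) f k = a *: conv m f1 f k + conv m f2 f k).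
rewrite !(@conv_over (undup r) (undup s)) //; last exact: support_in_comb.
rewrite scaler_sumr -big_split; apply: eq_bigr => g _ /=.
rewrite scaler_sumr -big_split; apply: eq_bigr => h _ /=.
by case: ifP => _; [rewrite -linearPl|rewrite scaler0 addr0].
Qed.

Lemma conv_combr r s a f f1 f2 : support_in r f -> support_in s f1 -> support_in s f2 ->
  conv m f (a *: f1 + f2) = a *: conv m f f1 + conv m f f2.
Proof.
have uu (q : seq G) : uniq (undup q) := undup_uniq q.
have sub (q : seq G) f' : support_in q f' -> support_in (undup q) f'.
  by apply: support_in_sub => g; rewrite mem_undup.
move=> /sub fr /sub f1s /sub f2s; apply/funext => k.
change (conv m f (a *: f1 + f2) k = a *: conv m f f1 k + conv m f f2 k).
rewrite !(@conv_over (undup r) (undup s)) //; last exact: support_in_comb.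
rewrite scaler_sumr -big_split; apply: eq_bigr => g _ /=.
rewrite scaler_sumr -big_split; apply: eq_bigr => h _ /=.
by case: ifP => _; [rewrite -linearPr|rewrite scaler0 addr0].
Qed.

Lemma support_in_conv r s f f' : support_in r f -> support_in s f' ->
  support_in [seq g + h | g <- fsupp f, h <- fsupp f'] (conv m f f').
Proof.
move=> fr fs k; apply: contraNT => kN; rewrite /conv big_seq big1 // => g gf.
rewrite big_seq big1 // => h hf'; case: eqP => // ghk.
by rewrite -ghk allpairs_f in kN.
Qed.
End Convolution.
End FinitelySupportedFunctions.

(* The subspace of the finitely supported [f] with [f g] in [P g], for all [g], graded by the
   functions supported at one point: loop algebras and group algebras are of this form. *)
Section FunctionAlgebra.
Variables (F : fieldType) (G : zmodType) (V : lmodType F) (m : {bilinear V -> V -> V}).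
Variables (P : G -> pred V) (gen : pred (funT G V)) (comp : G -> pred (spanT gen)).
Hypothesis P_subspace : forall g, subspace (P g).
Hypothesis P_mul : forall g h x y, x \in P g -> y \in P h -> m x y \in P (g + h).
Hypothesis genP : forall f, f \in gen <-> exists g v, v \in P g /\ f = fdelta g v.
Hypothesis compP : forall g (x : spanT gen),
  x \in comp g <-> (forall k, k != g -> sp_val x k = 0) /\ sp_val x g \in P g.

Definition funalg : galg F G :=
  @GAlg F G (spanT gen) (fun x y => insubd 0 (conv m (sp_val x) (sp_val y))) comp.

Definition fun_at (x : gcar funalg) (g : G) : V := sp_val (x : spanT gen) g.

Lemma fun_at_linear g : linear (fun_at^~ g). Proof. by []. Qed.

Lemma fun_at_ext x y : fun_at x =1 fun_at y -> x = y.
Proof. by move=> xy; apply/val_inj/funext. Qed.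

Lemma mem_funalg f : f \in spanP gen <-> (exists s, support_in s f) /\ forall g, f g \in P g.
Proof.
split=> [|[[s fs] fP]].
  pose Q : pred (funT G V) := fun f => asbool ((exists s, support_in s f) /\ forall g, f g \in P g).
  suff QP : {subset spanP gen <= Q} by move/QP/asboolP.
  apply: spanP_min => [|_ /genP [g [v [vP ->]]]]; last first.
    apply/asboolP; split=> [|h]; first by exists [:: g]; apply: support_in_fdelta.
    by rewrite /fdelta; case: eqP => [->|_] //; have [] := P_subspace h.
  split=> [|a f1 f2 /asboolP [[r f1r] f1P] /asboolP [[s f2s] f2P]]; apply/asboolP; split=> [|g].
  - by exists [::] => g; rewrite eqxx.
  - by have [] := P_subspace g.
  - exists (r ++ s); apply: support_in_comb.
      by apply: support_in_sub f1r => g; rewrite mem_cat => ->.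
    by apply: support_in_sub f2s => g; rewrite mem_cat orbC => ->.
  - exact: (P_subspace g).2.
rewrite -(@sum_fdelta _ _ _ (undup s) f) ?undup_uniq //.
  by apply: rpred_sum => g _; apply/mem_spanP/genP; exists g, (f g).
by apply: support_in_sub fs => g; rewrite mem_undup.
Qed.

Lemma fun_at_support x : exists s, support_in s (fun_at x).
Proof. by have [/mem_funalg []] := sp_valP (x : spanT gen). Qed.

Lemma fun_at_common_support x y : exists s, support_in s (fun_at x) /\ support_in s (fun_at y).
Proof.
have [[r xr] [s ys]] := (fun_at_support x, fun_at_support y); exists (r ++ s); split.
  by apply: support_in_sub xr => g; rewrite mem_cat => ->.
by apply: support_in_sub ys => g; rewrite mem_cat orbC => ->.
Qed.

Lemma fun_at_in x g : fun_at x g \in P g.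
Proof. by have /mem_funalg [] := sp_valP (x : spanT gen). Qed.

Lemma fun_at_mul x y : fun_at (gmul funalg x y) = conv m (fun_at x) (fun_at y).
Proof.
apply: (insubdK (0 : spanT gen)); apply/mem_funalg.
have [[r xr] [s ys]] := (fun_at_support x, fun_at_support y).
split=> [|k]; first by eexists; apply: support_in_conv xr ys.
apply: (subspace_sum (P_subspace k)) => g _; apply: (subspace_sum (P_subspace k)) => h _.
by case: eqP => [<-|_]; [apply: P_mul; apply: fun_at_in|have [] := P_subspace k].
Qed.

Definition fun_delta (g : G) (v : V) : gcar funalg := insubd (0 : spanT gen) (fdelta g v).

Lemma fun_at_delta g v : v \in P g -> fun_at (fun_delta g v) = fdelta g v.
Proof.
move=> vP; apply: (insubdK (0 : spanT gen)); apply/mem_spanP/genP.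
by exists g, v.
Qed.

Lemma fun_delta_comb g a v w : v \in P g -> w \in P g ->
  fun_delta g (a *: v + w) = a *: fun_delta g v + fun_delta g w.
Proof.
move=> vP wP; apply: fun_at_ext => k; rewrite fun_at_linear !fun_at_delta //.
  by rewrite /fdelta; case: eqP => // _; rewrite scaler0 addr0.
exact: (P_subspace g).2.
Qed.

Lemma fun_delta0 g : fun_delta g 0 = 0.
Proof.
apply: fun_at_ext => k; rewrite fun_at_delta; last by have [] := P_subspace g.
by rewrite /fdelta if_same.
Qed.

Lemma fun_delta_mul g h v w : v \in P g -> w \in P h ->
  gmul funalg (fun_delta g v) (fun_delta h w) = fun_delta (g + h) (m v w).
Proof.
move=> vP wP; apply: fun_at_ext => k.
by rewrite fun_at_mul !fun_at_delta ?conv_fdelta //; apply: P_mul.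
Qed.

Lemma fun_delta_gcomp g v : v \in P g -> fun_delta g v \in gcomp funalg g.
Proof.
move=> vP; apply/compP; rewrite [sp_val _](fun_at_delta vP) fdelta_id; split=> // k.
by rewrite /fdelta => /negbTE ->.
Qed.

Lemma fun_gcompE g x : x \in gcomp funalg g -> x = fun_delta g (fun_at x g).
Proof.
move=> /compP [x0 xg]; apply: fun_at_ext => k; rewrite fun_at_delta // /fdelta.
by case: eqP => [->|/eqP /x0].
Qed.

Lemma funalg_bilinear : bilinear_mul funalg.
Proof.
split=> a x y z; have [[s [xs ys]] [r zr]] := (fun_at_common_support x y, fun_at_support z).
  by apply: fun_at_ext => k; rewrite fun_at_linear !fun_at_mul (@conv_combl _ _ _ m s r).
by apply: fun_at_ext => k; rewrite fun_at_linear !fun_at_mul (@conv_combr _ _ _ m r s).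
Qed.

Lemma fun_at_sum (I : Type) (r : seq I) (f : I -> gcar funalg) g :
  fun_at (\sum_(i <- r) f i) g = \sum_(i <- r) fun_at (f i) g.
Proof. by elim: r => [|i r IH]; rewrite ?big_nil ?big_cons //= -IH. Qed.

Lemma funalg_galg : is_galg funalg.
Proof.
split; [exact: funalg_bilinear|split; [|split; [|split]]].
- move=> g; split=> [|a x y /compP [x0 xg] /compP [y0 yg]]; apply/compP.
    by split=> //; have [] := P_subspace g.
  split=> [k kg|]; last exact: (P_subspace g).2.
  by rewrite -/(fun_at _ k) fun_at_linear /fun_at x0 // y0 // scaler0 addr0.
- move=> x; have [s xs] := fun_at_support x.
  exists (undup s), (fun g => fun_delta g (fun_at x g)).
  split=> [g|]; first exact/fun_delta_gcomp/fun_at_in.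
  apply: fun_at_ext => k; rewrite fun_at_sum.
  rewrite -[in LHS](@sum_fdelta _ _ _ (undup s) (fun_at x)) ?undup_uniq //.
    by rewrite sum_funE; apply: eq_bigr => g _; rewrite fun_at_delta ?fun_at_in.
  by apply: support_in_sub xs => g; rewrite mem_undup.
- move=> s f us fP s0 g gs; rewrite (fun_gcompE (fP g)).
  suff -> : fun_at (f g) g = 0 by apply: fun_delta0.
  have <- : fun_at (\sum_(h <- s) f h) g = fun_at (f g) g.
    rewrite fun_at_sum (bigD1_seq g) //= big1 ?addr0 // => h hg.
    by have /compP [f0 _] := fP h; rewrite /fun_at f0 // eq_sym.
  by rewrite s0.
- move=> g h x y xg yh; rewrite (fun_gcompE xg) (fun_gcompE yh).
  by rewrite fun_delta_mul ?fun_at_in ?fun_delta_gcomp // P_mul ?fun_at_in.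
Qed.
End FunctionAlgebra.

HB.instance Definition _ (G : zmodType) (H : subgrp G) :=
  GRing.isZmodClosed.Build G (sg_pred H) (conj (sg0 H) (@sgB G H)).

Section Quotient.
Variables (G : zmodType) (H : subgrp G).

Lemma qprojD : {morph qproj H : x y / x + y}.
Proof.
move=> x y; rewrite -[RHS]/(qproj H (qrep H x + qrep H y)) qprojDl [x + qrep H y]addrC qprojDl.
by rewrite addrC.
Qed.

Lemma qproj_is_zmod_morphism : zmod_morphism (qproj H).
Proof. by move=> x y; apply/eqP; rewrite eq_sym subr_eq -qprojD subrK. Qed.
HB.instance Definition _ := GRing.isZmodMorphism.Build G (quot H) (qproj H) qproj_is_zmod_morphism.

Lemma qproj_surj (a : quot H) : exists g, qproj H g = a.
Proof. by exists (q_val a); apply: qproj_val. Qed.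

Lemma qproj_eq0 g : (qproj H g == 0) = (g \in sg_pred H).
Proof.
apply/eqP/idP => [g0|gH]; last by rewrite -(raddf0 (qproj H)); apply: qproj_eq; rewrite subr0.
have -> : g = (g - qrep H g) - (0 - qrep H 0).
  have [->] : qproj H g = qproj H 0 by rewrite raddf0.
  by rewrite sub0r opprK subrK.
by apply: sgB; apply: qrepP.
Qed.

Lemma qproj_eqP g h : (qproj H g == qproj H h) = (g - h \in sg_pred H).
Proof. by rewrite -subr_eq0 -raddfB qproj_eq0. Qed.

Definition coset_rep (g : G) : G := q_val (qproj H g).

Lemma coset_rep_sub g : coset_rep g - g \in sg_pred H.
Proof. by rewrite -qproj_eqP qproj_val. Qed.

Lemma sub_coset_rep g : g - coset_rep g \in sg_pred H.
Proof. by rewrite -qproj_eqP qproj_val. Qed.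
End Quotient.

Section FunctionAlgebraChart.
Variables (F : fieldType) (G Gb : zmodType) (pi : {additive G -> Gb}) (A : gradedAlg F Gb).
Variables (gen : pred (funT G (gcar A))) (comp : G -> pred (spanT gen)).
Hypothesis genP : forall f, f \in gen <-> exists g v, v \in gcomp A (pi g) /\ f = fdelta g v.
Hypothesis compP : forall g (x : spanT gen),
  x \in comp g <-> (forall k, k != g -> sp_val x k = 0) /\ sp_val x g \in gcomp A (pi g).

Let P_subspace g : subspace (gcomp A (pi g)).
Proof. by split=> [|a x y xA yA]; rewrite ?rpred0 ?rpredD ?rpredZ. Qed.

Let P_mul g h x y : x \in gcomp A (pi g) -> y \in gcomp A (pi h) ->
  gmul A x y \in gcomp A (pi (g + h)).
Proof. by rewrite raddfD; apply: gmul_gcomp. Qed.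

Lemma funalg_graded_galg : is_galg (funalg (gmul A) comp).
Proof. exact: (funalg_galg (m := gmul A) P_subspace P_mul genP compP). Qed.

Definition delta_map g (x : gcar A) : gcar (funalg (gmul A) comp) :=
  fun_delta (gmul A) comp g (gproj A (pi g) x).

Lemma delta_map_linear g : linear (delta_map g).
Proof.
move=> a x y; rewrite /delta_map linearP.
by apply: (fun_delta_comb (gmul A) comp P_subspace genP); apply: gproj_in.
Qed.
HB.instance Definition _ g := GRing.isLinear.Build F (gcar A)
  (gcar (funalg (gmul A) comp)) *:%R (delta_map g) (delta_map_linear g).

Lemma delta_map_chart (funalgP : is_galg (funalg (gmul A) comp)) :
  tloop_chart pi (fun _ _ => 1) A (GradedAlg funalgP) delta_map.
Proof.
split=> [g x xg|g x xg|g y yg|g h x y xg yh] /=.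
- by rewrite /delta_map gproj_id //; apply: (fun_delta_gcomp (gmul A) genP compP).
- rewrite /delta_map gproj_id // => x0; have := fun_at_delta (gmul A) comp genP xg.
  by move=> /(congr1 (fun f => f g)); rewrite x0 fdelta_id.
- have yA := fun_at_in P_subspace genP y g; exists (fun_at y g) => //.
  by rewrite /delta_map gproj_id // -(fun_gcompE genP compP yg).
- rewrite scale1r /delta_map !gproj_id ?P_mul //.
  exact: (fun_delta_mul comp P_subspace P_mul genP xg yh).
Qed.
End FunctionAlgebraChart.

Section LoopAlgebra.
Variables (F : fieldType) (G Gb : zmodType).

Lemma loop_genP (pi : G -> Gb) (A : galg F Gb) f :
  f \in loop_gen pi A <-> exists g v, v \in gcomp A (pi g) /\ f = fdelta g v.
Proof. by split=> [/asboolP|/asboolP]. Qed.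

Lemma loop_compP (pi : G -> Gb) (A : galg F Gb) g (x : loop_car pi A) : x \in loop_comp pi A g <->
  (forall k, k != g -> sp_val x k = 0) /\ sp_val x g \in gcomp A (pi g).
Proof. by split=> [/asboolP|/asboolP]. Qed.

Variables (pi : {additive G -> Gb}) (A : gradedAlg F Gb).

Lemma loop_galg : is_galg (loop pi A).
Proof. exact: (funalg_graded_galg (@loop_genP pi A) (@loop_compP pi A)). Qed.

Canonical loop_gradedAlg := GradedAlg loop_galg.

Lemma loop_chart : exists phi, tloop_chart pi (fun _ _ => 1) A loop_gradedAlg phi.
Proof.
by eexists; exact: (delta_map_chart (@loop_genP pi A) (@loop_compP pi A) loop_galg).
Qed.

Lemma tloop_has_chart t :
  exists phi, tloop_chart pi t A (twist_gradedAlg loop_gradedAlg t) phi.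
Proof.
have [phi chart] := loop_chart; exists phi.
by apply: (chart_eq (chart_twist t chart)) => g h; rewrite mul1r.
Qed.
End LoopAlgebra.

Section ScalarAlgebra.
Variables (F : fieldType) (G : zmodType).

Definition scalar_galg : galg F G :=
  @GAlg F G F^o (fun x y => x * y) (fun g x => (g == 0) || (x == 0)).

Lemma mem_scalar_galg g x : (x \in gcomp scalar_galg g) = (g == 0) || (x == 0).
Proof. by []. Qed.

Lemma scalar_galgP : is_galg scalar_galg.
Proof.
split; [split=> a x y z|split; [|split; [|split]]].
- by rewrite /= mulrDl -scalerAl.
- by rewrite /= mulrDr -scalerAr.
- move=> g; split=> [|a x y]; rewrite !mem_scalar_galg ?eqxx ?orbT //.
  by case: (g == 0) => //= /eqP -> /eqP ->; rewrite scaler0 addr0.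
- move=> x; exists [:: 0], (fun g => if g == 0 then x else 0); rewrite big_seq1 eqxx; split=> // g.
  by rewrite mem_scalar_galg; case: ifP => //= _; rewrite eqxx.
- move=> s f us fA s0 g gs; case: (eqVneq g 0) (fA g) => [g0 _|g0]; last first.
    by rewrite mem_scalar_galg (negbTE g0) => /eqP.
  rewrite -[RHS]s0 (bigD1_seq g) //= big1 ?addr0 // => h; rewrite g0 => h0.
  by have := fA h; rewrite mem_scalar_galg (negbTE h0) => /eqP.
- move=> g h x y; rewrite !mem_scalar_galg.
  case/orP=> [/eqP ->|/eqP ->]; last by rewrite /= mul0r eqxx orbT.
  by rewrite add0r; case/orP=> [->|/eqP ->]; rewrite //= mulr0 eqxx orbT.
Qed.
Canonical scalar_gradedAlg := GradedAlg scalar_galgP.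
End ScalarAlgebra.

Section GroupAlgebra.
Variables (F : fieldType) (G : zmodType) (H : subgrp G).
Local Notation A := (scalar_gradedAlg F (quot H)).

Lemma grp_genP (f : funT G (gcar A)) :
  f \in grp_gen H <-> exists g v, v \in gcomp A (qproj H g) /\ f = fdelta g v.
Proof.
split=> [/asboolP [g [a [gH ->]]]|[g [a [aA ->]]]].
  by exists g, a; rewrite mem_scalar_galg qproj_eq0 gH.
move: aA; rewrite mem_scalar_galg qproj_eq0.
move=> /orP [gH|/eqP ->]; apply/asboolP; first by exists g, a.
by exists 0, 0; split; [apply: sg0|apply/funext => h; rewrite /fdelta !if_same].
Qed.

Lemma grp_compP g (x : grp_car H) : x \in grp_comp H g <->
  (forall k, k != g -> sp_val x k = 0) /\ sp_val x g \in gcomp A (qproj H g).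
Proof.
rewrite mem_scalar_galg qproj_eq0; split=> [/asboolP [x0 xg]|[x0 xg]]; last apply/asboolP.
  by split=> //; case: xg => [->|->]; rewrite ?eqxx ?orbT.
by split=> //; case/orP: xg => [|/eqP]; [left|right].
Qed.

Lemma grpalg_galg : is_galg (grpalg (F := F) H).
Proof. exact: (funalg_graded_galg grp_genP grp_compP). Qed.

Canonical grpalg_gradedAlg := GradedAlg grpalg_galg.

Lemma tgrpalg_has_chart (t : G -> G -> F) :
  exists phi, tloop_chart (qproj H) t A (twist_gradedAlg grpalg_gradedAlg t) phi.
Proof.
have chart := delta_map_chart grp_genP grp_compP grpalg_galg.
by eexists; apply: (chart_eq (chart_twist t chart)) => g h; rewrite mul1r.
Qed.
End GroupAlgebra.

Section ScaleMap.
Variables (F : fieldType) (V : lmodType F) (v : V).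

Definition scale_map (a : F^o) : V := a *: v.

Lemma scale_map_linear : linear scale_map.
Proof. by move=> a b c; rewrite /scale_map scalerDl scalerA. Qed.
HB.instance Definition _ := GRing.isLinear.Build F F^o V *:%R scale_map scale_map_linear.
End ScaleMap.

Section CentroidChart.
Variables (F : fieldType) (G Gb : zmodType) (pi : {additive G -> Gb}) (s t : G -> G -> F).
Variables (A : gradedAlg F Gb) (B : gradedAlg F G) (phi : G -> {linear gcar A -> gcar B}).
Hypothesis pi_surj : forall a, exists g, pi g = a.
Hypothesis tC : sym2cocycle t.
Hypothesis chart : tloop_chart pi t A B phi.
Hypotheses (gsA : graded_simple A) (cA : central A).
Hypothesis st : forall k l, pi k = 0 -> pi l = 0 -> s k l = t k l.

Lemma cval_chart_ext z w :
  (forall g x, x \in gcomp A (pi g) -> cval z (phi g x) = cval w (phi g x)) -> z = w.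
Proof.
move=> zw; apply: cval_ext; apply: linear_homog_ext => g _ /(chart_surj chart) [x xg <-].
exact: zw.
Qed.

Lemma centroid_shifts : exists S : G -> gcar (centroid_alg B), forall k, pi k = 0 ->
  S k \in gcomp (centroid_alg B) k /\
  forall g x, x \in gcomp A (pi g) -> cval (S k) (phi g x) = t k g *: phi (k + g) x.
Proof.
have /choice [S SP] : forall k, exists z, pi k = 0 -> z \in gcomp (centroid_alg B) k /\
    forall g x, x \in gcomp A (pi g) -> cval z (phi g x) = t k g *: phi (k + g) x.
  move=> k; have [k0|k_neq0] := pselect (pi k = 0); last by exists 0.
  have [d [dC dk] dE] := shift_homog_centroid tC chart k0; exists (centroid_elt d) => _.
  rewrite centroid_eltE //; split=> //; apply/asboolP; rewrite -/(cval _).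
  by rewrite centroid_eltE.
by exists S.
Qed.

Lemma centroid_has_chart (centroidP : is_galg (centroid_alg B)) :
  exists psi, tloop_chart pi s (scalar_gradedAlg F Gb) (GradedAlg centroidP) psi.
Proof.
have t_neq0 g h : t g h != 0 := cocycle_neq0 tC g h; have [S SP] := centroid_shifts.
have Csub k : subspace (gcomp (centroid_alg B) k) by case: centroidP => _ [].
exists (fun k => scale_map (S k)).
split=> [k a|k a|k z /centroid_gcompP zk|k l a b]; rewrite ?mem_scalar_galg.
- change ((pi k == 0) || (a == 0) -> a *: S k \in gcomp (centroid_alg B) k).
  have [k0 _|_ /eqP ->] := eqVneq (pi k) 0; last by rewrite scale0r; case: (Csub k).
  by rewrite -[a *: S k]addr0; apply: (Csub k).2; [case: (SP k k0)|case: (Csub k)].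
- change ((pi k == 0) || (a == 0) -> a *: S k = 0 -> a = 0).
  have [k0 _ aS0|_ /eqP //] := eqVneq (pi k) 0.
  have [g [x [xg x0]]] := homog_neq0_over pi_surj gsA.1.
  have := cval_scale (a : F) (S k) (phi g x); rewrite aS0 (SP k k0).2 // scalerA => /esym/eqP.
  rewrite scaler_eq0 mulf_eq0 (negbTE (t_neq0 _ _)) orbF => /orP [/eqP //|].
  by rewrite (negbTE (chart_neq0 chart _ x0)) // raddfD /= k0 add0r.
- have [k0|k0] := eqVneq (pi k) 0; last first.
    exists 0; first by rewrite mem_scalar_galg eqxx orbT.
    rewrite linear0; apply: cval_ext => x.
    by rewrite (homog_centroid_off_kernel pi_surj tC chart gsA cA zk k0).
  have [a aE] := homog_centroid_is_shift pi_surj tC chart gsA cA zk.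
  exists a; first by rewrite mem_scalar_galg k0 eqxx.
  by apply: cval_chart_ext => g x xg; rewrite cval_scale (SP k k0).2 // aE // scalerA.
change ((pi k == 0) || (a == 0) -> (pi l == 0) || (b == 0) ->
  gmul (centroid_alg B) (a *: S k) (b *: S l) = s k l *: ((a * b) *: S (k + l))).
have [k0 _|_ /eqP -> _] := eqVneq (pi k) 0; last first.
  by rewrite mul0r !scale0r scaler0; apply: cval_ext => x; rewrite cval_mul.
have [l0 _|_ /eqP ->] := eqVneq (pi l) 0; last first.
  rewrite mulr0 !scale0r scaler0; apply: cval_ext => x.
  by rewrite cval_mul -[cval 0 x]/0 linear0.
have kl0 : pi (k + l) = 0 by rewrite raddfD k0 l0 addr0.
apply: cval_chart_ext => g x xg; have xlg : x \in gcomp A (pi (l + g)) by rewrite raddfD l0 add0r.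
rewrite cval_mul !cval_scale (SP l l0).2 // !linearZ /= (SP k k0).2 // (SP _ kl0).2 //.
rewrite !scalerA addrA.
rewrite st //; congr (_ *: _); transitivity (a * b * (t k (l + g) * t l g)); first by ring.
by rewrite -(cocycleA tC); ring.
Qed.
End CentroidChart.

(** * Descent and extension of symmetric cocycles *)

Section CocycleDescent.
Variables (F : fieldType) (G : zmodType) (H : subgrp G).
Local Notation pi := (qproj H).
Local Notation s := (coset_rep H).

Lemma cocycle_deflation (t : G -> G -> F) : sym2cocycle t ->
  (forall h a b, h \in sg_pred H -> t (h + a) b = t a b) ->
  exists2 mu, sym2cocycle mu & forall a b, t a b = mu (pi a) (pi b).
Proof.
move=> tC tH; have t_pi a a' b b' : pi a = pi a' -> pi b = pi b' -> t a b = t a' b'.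
  have tl c d e : pi c = pi d -> t c e = t d e.
    by move=> /eqP; rewrite qproj_eqP => cd; rewrite -(tH _ d e cd) subrK.
  by move=> /tl aa' /tl bb'; rewrite aa' (cocycleC tC) bb' (cocycleC tC).
have q_valD (a b : quot H) : pi (q_val (a + b)) = pi (q_val a + q_val b).
  by rewrite qproj_val raddfD /= !qproj_val.
exists (fun a b => t (q_val a) (q_val b)) => [|a b]; last by apply: t_pi; rewrite qproj_val.
split=> [a b|]; first exact: (cocycle_neq0 tC).
split=> [a b c|a b]; last exact: (cocycleC tC).
rewrite (t_pi (q_val (a + b)) (q_val a + q_val b) (q_val c) (q_val c)) // ?q_valD //.
rewrite (t_pi (q_val a) (q_val a) (q_val (b + c)) (q_val b + q_val c)) // ?q_valD //.
exact: (cocycleA tC).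
Qed.

Lemma trivial_cocycle_descent (t : G -> G -> F) : sym2cocycle t ->
  (forall h k, h \in sg_pred H -> k \in sg_pred H -> t h k = 1) ->
  exists (gam : G -> F) (mu : quot H -> quot H -> F), [/\ forall g, gam g != 0, sym2cocycle mu,
    forall a b, t a b = mu (pi a) (pi b) * coboundary gam a b &
    forall h g, h \in sg_pred H -> t h g * gam (h + g) = gam g].
Proof.
move=> tC t1; have t0 := cocycle_neq0 tC; pose gam g := (t (g - s g) (s g))^-1.
have gam0 g : gam g != 0 by rewrite invr_eq0.
have gamH h : h \in sg_pred H -> gam h = 1.
  by move=> hH; rewrite /gam t1 ?invr1 ?sub_coset_rep // -[s h](subKr h) rpredB ?sub_coset_rep.
have gam_shift h g : h \in sg_pred H -> t h g * gam (h + g) = gam g.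
  move=> hH; have -> : gam (h + g) = (t (h + (g - s g)) (s g))^-1.
    rewrite /gam; suff -> : s (h + g) = s g by rewrite addrA.
    by congr q_val; apply/eqP; rewrite qproj_eqP addrK.
  have := cocycleA tC h (g - s g) (s g); rewrite t1 ?sub_coset_rep // mul1r subrK => ->.
  by rewrite invfM mulrA divff // mul1r.
pose u a b := t a b * (coboundary gam a b)^-1.
have uC : sym2cocycle u by apply/sym2cocycleM/sym2cocycleV/sym2cocycle_coboundary.
have uH h a : h \in sg_pred H -> u h a = 1.
  by move=> hH; rewrite /u /coboundary gamH // mul1r invfM invrK mulrCA gam_shift // mulVf.
have [h a b hH|mu muC uE] := cocycle_deflation uC.
  by have := cocycleA uC h a b; rewrite !(uH h) // !mul1r.
exists gam, mu; split=> // a b; rewrite -uE /u -mulrA mulVf ?mulr1 //.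
exact: cocycle_neq0 (sym2cocycle_coboundary gam0) _ _.
Qed.

Lemma cocycle_descent (t : G -> G -> F) (lam : G -> F) : sym2cocycle t ->
  (forall h, h \in sg_pred H -> lam h != 0) ->
  (forall h k, h \in sg_pred H -> k \in sg_pred H -> t h k * lam (h + k) = lam h * lam k) ->
  exists (gam : G -> F) (mu : quot H -> quot H -> F), [/\ forall g, gam g != 0, sym2cocycle mu,
    forall a b, t a b = mu (pi a) (pi b) * coboundary gam a b &
    forall h g, h \in sg_pred H -> t h g * gam (h + g) = lam h * gam g].
Proof.
move=> tC lam0 lamM; pose ext g := if g \in sg_pred H then lam g else 1.
have ext0 g : ext g != 0 by rewrite /ext; case: ifP => [/lam0 //|_]; apply: oner_neq0.
have extE h : h \in sg_pred H -> ext h = lam h by rewrite /ext => ->.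
pose u a b := t a b * (coboundary ext a b)^-1.
have tE a b : t a b = u a b * coboundary ext a b.
  by rewrite /u -mulrA mulVf ?mulr1 //; apply: cocycle_neq0 (sym2cocycle_coboundary ext0) _ _.
have [|h k hH kH|gam [mu [gam0 muC uE uH]]] := @trivial_cocycle_descent u.
- by apply/sym2cocycleM/sym2cocycleV/sym2cocycle_coboundary.
- rewrite /u /coboundary !extE ?rpredD // invfM invrK mulrCA mulrA -mulrA lamM // mulrC divff //.
  by rewrite mulf_neq0 ?lam0.
exists (fun g => ext g * gam g), mu; split=> // [g|a b|h g hH]; first by rewrite mulf_neq0.
  by rewrite tE uE /coboundary; field; rewrite ext0 gam0.
by rewrite -(uH h g hH) tE /coboundary (extE h) //; field.
Qed.
End CocycleDescent.

(* A partial cocycle vanishes outside [K * K], so that it determines its domain and extension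
   is a relation between plain functions. *)
Section PartialCocycles.
Variables (F : fieldType) (G : zmodType).
Implicit Types (K : subgrp G) (t u c d : G -> G -> F).

Definition pcocycle K t := [/\
  forall a b, (t a b != 0) = (a \in sg_pred K) && (b \in sg_pred K),
  forall a b e, a \in sg_pred K -> b \in sg_pred K -> e \in sg_pred K ->
    t a b * t (a + b) e = t a (b + e) * t b e &
  forall a b, a \in sg_pred K -> b \in sg_pred K -> t a b = t b a].

Lemma pcocycle_dom K t a : pcocycle K t -> (t a a != 0) = (a \in sg_pred K).
Proof. by case=> -> _ _; rewrite andbb. Qed.

Definition extends t u := forall a b, t a b != 0 -> u a b = t a b.

Lemma extends_neq0 t u a b : extends t u -> t a b != 0 -> u a b != 0.
Proof. by move=> tu ab; rewrite tu. Qed.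

Lemma extends_trans t u c : extends t u -> extends u c -> extends t c.
Proof. by move=> tu uc a b ab; rewrite uc ?tu. Qed.

Section ChainUnion.
Variable C : set (G -> G -> F).
Hypothesis C_pcocycle : forall c, C c -> exists K, pcocycle K c.
Hypothesis C_total : forall c d, C c -> C d -> extends c d \/ extends d c.
Variables (c0 : G -> G -> F) (Cc0 : C c0).

Lemma chain_union : exists2 u, forall c, C c -> extends c u &
  forall a b, u a b != 0 -> exists2 c, C c & c a b != 0.
Proof.
have /choice [u uP] : forall ab : G * G, exists v : F,
    (forall c, C c -> c ab.1 ab.2 != 0 -> v = c ab.1 ab.2) /\
    (v != 0 -> exists2 c, C c & c ab.1 ab.2 != 0).
  move=> [a b] /=; have [[c Cc cab]|none] := pselect (exists2 c, C c & c a b != 0); last first.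
    by exists 0; split=> [c Cc cab|]; [case: none; exists c|rewrite eqxx].
  exists (c a b); split=> [d Cd dab|_]; last by exists c.
  by have [->|->] := C_total Cc Cd.
by exists (fun a b => u (a, b)) => [c Cc a b|a b]; [apply: (uP (a, b)).1|apply: (uP (a, b)).2].
Qed.

Section Union.
Variable u : G -> G -> F.
Hypothesis u_extends : forall c, C c -> extends c u.
Hypothesis u_support : forall a b, u a b != 0 -> exists2 c, C c & c a b != 0.

Lemma chain_common_dom (s : seq G) : (forall x, x \in s -> u x x != 0) ->
  exists c K, [/\ C c, pcocycle K c & forall x, x \in s -> x \in sg_pred K].
Proof.
move=> sU; suff [c Cc sc] : exists2 c, C c & forall x, x \in s -> c x x != 0.
  by have [K cK] := C_pcocycle Cc; exists c, K; split=> // x /sc; rewrite (pcocycle_dom x cK).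
elim: s sU => [|x s IH] sU; first by exists c0.
have [|c Cc sc] := IH; first by move=> y ys; apply: sU; rewrite inE ys orbT.
have [d Cd xd] := u_support (sU x (mem_head x s)).
have [cd|dc] := C_total Cc Cd.
  by exists d => // y; rewrite inE => /orP [/eqP -> //|/sc]; apply: extends_neq0.
by exists c => // y; rewrite inE => /orP [/eqP ->|/sc //]; apply: extends_neq0 xd.
Qed.

Lemma chain_union_pcocycle : exists K, pcocycle K u.
Proof.
pose U : pred G := fun x => u x x != 0.
have common x y z : x \in U -> y \in U -> z \in U -> exists c K, [/\ C c, pcocycle K c,
    x \in sg_pred K, y \in sg_pred K & z \in sg_pred K].
  move=> xU yU zU; have [|c [K [Cc cK xyzK]]] := @chain_common_dom [:: x; y; z].
    by move=> w; rewrite !inE => /or3P [] /eqP ->.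
  by exists c, K; split=> //; apply: xyzK; rewrite !inE eqxx ?orbT.
have uE c K a b : C c -> pcocycle K c -> a \in sg_pred K -> b \in sg_pred K -> u a b = c a b.
  by move=> Cc [cn _ _] aK bK; apply: (u_extends Cc); rewrite cn aK.
have domU c K x : C c -> pcocycle K c -> x \in sg_pred K -> x \in U.
  by move=> Cc cK xK; rewrite unfold_in (uE c K) // (pcocycle_dom x cK).
have U0 : 0 \in U by have [K cK] := C_pcocycle Cc0; apply: (domU c0 K); rewrite ?rpred0.
have UB x y : x \in U -> y \in U -> x - y \in U.
  move=> xU yU; have [c [K [Cc cK xK yK _]]] := common x y y xU yU yU.
  by apply: (domU c K); rewrite ?rpredB.
exists (SubGrp U0 UB); split=> /= [a b|a b e aU bU eU|a b aU bU].
- apply/idP/andP => [/u_support [c Cc cab]|[aU bU]].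
    have [K cK] := C_pcocycle Cc; have [cn _ _] := cK.
    by move: cab; rewrite cn => /andP [aK bK]; split; apply: (domU c K).
  have [c [K [Cc cK aK bK _]]] := common a b b aU bU bU; have [cn _ _] := cK.
  by rewrite (uE c K) // cn aK.
- have [c [K [Cc cK aK bK eK]]] := common a b e aU bU eU; have [_ cA _] := cK.
  by rewrite !(uE c K) ?rpredD ?cA.
- have [c [K [Cc cK aK bK _]]] := common a b b aU bU bU; have [_ _ cC] := cK.
  by rewrite (uE c K a b) // (uE c K b a) // cC.
Qed.
End Union.
End ChainUnion.

Lemma maximal_pcocycle K t : pcocycle K t -> exists L u, [/\ pcocycle L u, extends t u &
  forall M v, pcocycle M v -> extends u v -> {subset sg_pred M <= sg_pred L}].
Proof.
move=> tK; pose T := {u | extends t u /\ exists L, pcocycle L u}.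
have tT : extends t t /\ exists L, pcocycle L t by split; last exists K.
pose R (u v : T) := asbool (extends (sval u) (sval v)).
have RP (u v : T) : reflect (extends (sval u) (sval v)) (R u v) by apply: asboolP.
have [u|u v w /RP uv /RP vw|C C_total|[u [tu [L uL]]] umax] := @ZL_preorder T (exist _ t tT) R.
- exact/RP.
- exact/RP/(extends_trans uv vw).
- have [[p Cp]|none] := pselect (exists p, C p); last first.
    by exists (exist _ t tT) => p Cp; case: none; exists p.
  pose C' v := exists2 p, C p & sval p = v.
  have C'_pcocycle v : C' v -> exists M, pcocycle M v by case=> [[w [tw wM]] _ <-].
  have C'_total v w : C' v -> C' w -> extends v w \/ extends w v.
    by move=> [q Cq <-] [r Cr <-]; have [/RP|/RP] := C_total q r Cq Cr; [left|right].
  have C'p : C' (sval p) by exists p.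
  have [v v_extends v_support] := chain_union C'_total.
  have vT : extends t v /\ exists M, pcocycle M v.
    split; first exact: extends_trans (proj2_sig p).1 (v_extends _ C'p).
    exact: (chain_union_pcocycle (C := C') C'_pcocycle C'_total C'p v_extends v_support).
  by exists (exist _ v vT) => q Cq; apply/RP/v_extends; exists q.
exists L, u; split=> // M v vM uv x; rewrite -(pcocycle_dom x vM) -(pcocycle_dom x uL).
have vT : extends t v /\ exists M, pcocycle M v by split; [apply: extends_trans uv|exists M].
have /RP vu := umax (exist _ v vT) (introT (asboolP _) uv).
exact: (extends_neq0 vu).
Qed.
End PartialCocycles.

Section SectionCocycle.
Variables (F : fieldType) (G : zmodType) (K : subgrp G) (T : Type).
Variables (op : T -> T -> T) (scale : F -> T -> T) (sect : G -> T).
Hypothesis opA : associative op.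
Hypothesis opC : forall x y, x \in sg_pred K -> y \in sg_pred K ->
  op (sect x) (sect y) = op (sect y) (sect x).
Hypothesis scaleA : forall a b v, a != 0 -> b != 0 -> scale a (scale b v) = scale (a * b) v.
Hypothesis scale_opl : forall a v w, op (scale a v) w = scale a (op v w).
Hypothesis scale_opr : forall a x w, x \in sg_pred K ->
  op (sect x) (scale a w) = scale a (op (sect x) w).
Hypothesis scale_free : forall x a b, x \in sg_pred K -> a != 0 -> b != 0 ->
  scale a (sect x) = scale b (sect x) -> a = b.
Hypothesis sect_op : forall x y, x \in sg_pred K -> y \in sg_pred K ->
  exists2 a, a != 0 & op (sect x) (sect y) = scale a (sect (x + y)).

Lemma section_cocycle : exists2 t, pcocycle K t & forall x y, x \in sg_pred K -> y \in sg_pred K ->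
  op (sect x) (sect y) = scale (t x y) (sect (x + y)).
Proof.
have /choice [t tP] : forall xy : G * G, exists a : F,
    (a != 0) = (xy.1 \in sg_pred K) && (xy.2 \in sg_pred K) /\
    (a != 0 -> op (sect xy.1) (sect xy.2) = scale a (sect (xy.1 + xy.2))).
  move=> [x y] /=; case: andP => [[xK yK]|_]; last by exists 0; rewrite eqxx.
  by have [a a0 aE] := sect_op xK yK; exists a; rewrite a0.
have t_neq0 x y : x \in sg_pred K -> y \in sg_pred K -> t (x, y) != 0.
  by move=> xK yK; rewrite (tP (x, y)).1 xK.
have tE x y : x \in sg_pred K -> y \in sg_pred K ->
    op (sect x) (sect y) = scale (t (x, y)) (sect (x + y)).
  by move=> xK yK; apply: (tP (x, y)).2; apply: t_neq0.
exists (fun x y => t (x, y)) => //; split=> [x y|x y z xK yK zK|x y xK yK] /=.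
- exact: (tP (x, y)).1.
- have [xyK yzK] := (rpredD xK yK, rpredD yK zK).
  apply: (scale_free (rpredD xyK zK)); rewrite ?mulf_neq0 ?t_neq0 //.
  rewrite -scaleA ?t_neq0 // -tE // -scale_opl -tE // -opA tE // scale_opr // tE //.
  by rewrite scaleA ?t_neq0 // addrA mulrC.
- apply: (scale_free (rpredD xK yK)); rewrite ?t_neq0 //.
  by rewrite -tE // opC // tE // addrC.
Qed.
End SectionCocycle.

Section ExtensionGroup.
Variables (F : fieldType) (G : zmodType) (K : subgrp G) (t : G -> G -> F).

(* The abelian extension of [K] by the multiplicative group of [F] with cocycle [t]. *)
Definition cocycle_ext of pcocycle K t := {p : G * F | (p.1 \in sg_pred K) && (p.2 != 0)}.

Variable tK : pcocycle K t.
Local Notation E := (cocycle_ext tK).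
HB.instance Definition _ := Choice.copy E {p : G * F | (p.1 \in sg_pred K) && (p.2 != 0)}.

Lemma pcocycle_neq0 a b : a \in sg_pred K -> b \in sg_pred K -> t a b != 0.
Proof. by case: tK => -> _ _ -> ->. Qed.

Lemma pcocycleA a b c : a \in sg_pred K -> b \in sg_pred K -> c \in sg_pred K ->
  t a b * t (a + b) c = t a (b + c) * t b c.
Proof. by case: tK => _ tA _; apply: tA. Qed.

Lemma pcocycleC a b : a \in sg_pred K -> b \in sg_pred K -> t a b = t b a.
Proof. by case: tK => _ _ tC; apply: tC. Qed.

Lemma pcocycle0l a : a \in sg_pred K -> t 0 a = t 0 0.
Proof.
move=> aK; have := pcocycleA (sg0 K) (sg0 K) aK; rewrite !add0r.
by move=> /(mulIf (pcocycle_neq0 (sg0 K) aK)).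
Qed.

Lemma ext_elt_subproof (x : G) (a : F) : x \in sg_pred K -> a != 0 ->
  ((x, a).1 \in sg_pred K) && ((x, a).2 != 0).
Proof. by move=> /= -> ->. Qed.

Definition ext_elt (x : G) (a : F) (xK : x \in sg_pred K) (a0 : a != 0) : E :=
  exist _ (x, a) (ext_elt_subproof xK a0).

Definition ext_base (p : E) : G := (sval p).1.
Definition ext_coef (p : E) : F := (sval p).2.

Lemma ext_base_in p : ext_base p \in sg_pred K.
Proof. by have /andP [] := proj2_sig p. Qed.

Lemma ext_coef_neq0 p : ext_coef p != 0.
Proof. by have /andP [] := proj2_sig p. Qed.

Lemma ext_ext p q : ext_base p = ext_base q -> ext_coef p = ext_coef q -> p = q.
Proof. by case: p q => -[x a] ? [[y b] ?] /= xy ab; apply: val_inj; congr (_, _). Qed.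

Definition ext_add (p q : E) : E := ext_elt (sgD (ext_base_in p) (ext_base_in q))
  (mulf_neq0 (mulf_neq0 (ext_coef_neq0 p) (ext_coef_neq0 q))
    (pcocycle_neq0 (ext_base_in p) (ext_base_in q))).

Definition ext_zero : E := ext_elt (sg0 K) (invr_neq0 (pcocycle_neq0 (sg0 K) (sg0 K))).

Definition ext_opp (p : E) : E := ext_elt (sgN (ext_base_in p))
  (invr_neq0 (mulf_neq0 (mulf_neq0 (ext_coef_neq0 p)
    (pcocycle_neq0 (sgN (ext_base_in p)) (ext_base_in p))) (pcocycle_neq0 (sg0 K) (sg0 K)))).

Lemma ext_base_add p q : ext_base (ext_add p q) = ext_base p + ext_base q. Proof. by []. Qed.

Lemma ext_coef_add p q :
  ext_coef (ext_add p q) = ext_coef p * ext_coef q * t (ext_base p) (ext_base q).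
Proof. by []. Qed.

Lemma ext_addA : associative ext_add.
Proof.
move=> p q r; apply: ext_ext; first exact: addrA.
rewrite !ext_coef_add !ext_base_add.
have [pK qK rK] := And3 (ext_base_in p) (ext_base_in q) (ext_base_in r).
transitivity (ext_coef p * ext_coef q * ext_coef r *
  (t (ext_base p) (ext_base q + ext_base r) * t (ext_base q) (ext_base r))); first by ring.
by rewrite -pcocycleA //; ring.
Qed.

Lemma ext_addC : commutative ext_add.
Proof.
move=> p q; apply: ext_ext; first exact: addrC.
by rewrite !ext_coef_add [ext_coef p * _]mulrC pcocycleC ?ext_base_in.
Qed.

Lemma ext_add0 : left_id ext_zero ext_add.
Proof.
move=> p; apply: ext_ext; first exact: add0r.
rewrite ext_coef_add -[ext_base ext_zero]/(0 : G) (pcocycle0l (ext_base_in p)).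
by rewrite mulrAC [ext_coef ext_zero * _]mulVf ?mul1r // (pcocycle_neq0 (sg0 K) (sg0 K)).
Qed.

Lemma ext_addN : left_inverse ext_zero ext_opp ext_add.
Proof.
move=> p; apply: ext_ext; first exact: addNr.
rewrite ext_coef_add -[ext_base (ext_opp p)]/(- ext_base p) -[ext_coef ext_zero]/((t 0 0)^-1).
rewrite -[ext_coef (ext_opp p)]/((ext_coef p * t (- ext_base p) (ext_base p) * t 0 0)^-1); field.
by rewrite ext_coef_neq0 !pcocycle_neq0 ?sg0 ?sgN ?ext_base_in.
Qed.
HB.instance Definition _ := GRing.isZmodule.Build E ext_addA ext_addC ext_add0 ext_addN.

Lemma ext_base_is_zmod_morphism : zmod_morphism (ext_base : E -> G).
Proof. by []. Qed.
HB.instance Definition _ := GRing.isZmodMorphism.Build E G ext_base ext_base_is_zmod_morphism.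

Lemma ext_coefD p q : ext_coef (p + q) = ext_coef p * ext_coef q * t (ext_base p) (ext_base q).
Proof. exact: ext_coef_add. Qed.

Definition ext_lift (x : G) (a : F) : E := insubd (0 : E) (x, a).

Lemma ext_liftE x a : x \in sg_pred K -> a != 0 ->
  ext_base (ext_lift x a) = x /\ ext_coef (ext_lift x a) = a.
Proof. by move=> xK a0; rewrite /ext_base /ext_coef insubdK // unfold_in /= xK. Qed.

Lemma ext_liftD x y a b : x \in sg_pred K -> y \in sg_pred K -> a != 0 -> b != 0 ->
  ext_lift x a + ext_lift y b = ext_lift (x + y) (a * b * t x y).
Proof.
move=> xK yK a0 b0; have [[xE aE] [yE bE]] := (ext_liftE xK a0, ext_liftE yK b0).
have [|xyE abE] := ext_liftE (sgD xK yK) (a := a * b * t x y).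
  by rewrite !mulf_neq0 ?pcocycle_neq0.
by apply: ext_ext; rewrite ?ext_coefD ?raddfD /= xE yE ?aE ?bE ?xyE ?abE.
Qed.

(* The zero of [E] is [(0, (t 0 0)^-1)], hence the normalization by [t 0 0]. *)
Definition ext_scalar (a : F) : E := ext_lift 0 (a / t 0 0).

Let t00_neq0 : t 0 0 != 0.
Proof. exact: pcocycle_neq0 (sg0 K) (sg0 K). Qed.

Lemma ext_scalarM a b : a != 0 -> b != 0 -> ext_scalar (a * b) = ext_scalar a + ext_scalar b.
Proof.
move=> a0 b0; rewrite /ext_scalar ext_liftD ?sg0 ?mulf_neq0 ?invr_eq0 ?t00_neq0 // addr0.
by congr ext_lift; field; exact: t00_neq0.
Qed.

Lemma ext_scalar_inj a b : a != 0 -> b != 0 -> ext_scalar a = ext_scalar b -> a = b.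
Proof.
move=> a0 b0 /(congr1 ext_coef); rewrite !(ext_liftE (sg0 K) _).2 ?mulf_neq0 ?invr_eq0 //.
by apply: mulIf; rewrite invr_eq0.
Qed.

Lemma ext_kernel p : ext_base p = 0 -> exists2 a, a != 0 & p = ext_scalar a.
Proof.
move=> p0; exists (ext_coef p * t 0 0); first by rewrite mulf_neq0 ?ext_coef_neq0.
have [pE aE] := ext_liftE (sg0 K) (ext_coef_neq0 p).
by apply: ext_ext; rewrite /ext_scalar mulfK ?pE ?aE.
Qed.
End ExtensionGroup.

Lemma subgrp_int_principal (S : subgrp int) :
  exists N : nat, forall m, (m \in sg_pred S) = (N %| m)%Z.
Proof.
have absS m : m \in sg_pred S -> `|m|%N%:Z \in sg_pred S.
  by case: m => n // nS; rewrite NegzE rpredN in nS.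
have [ex|none] := pselect (exists n : nat, (0 < n)%N && (n%:Z \in sg_pred S)); last first.
  exists 0%N => m; rewrite dvd0z; apply/idP/eqP => [mS|->]; last exact: rpred0.
  apply: contrapT => /eqP m0; case: none; exists `|m|%N.
  by rewrite absz_gt0 m0 absS.
have [N /andP [N0 NS] N_min] := ex_minnP ex; exists N => m.
have multS (q : int) : q * N%:Z \in sg_pred S by rewrite mulrC -mulrzz rpredMz.
apply/idP/idP => [mS|/dvdzP [q ->] //]; apply/dvdz_mod0P.
have N_gt0 : (0 < N%:Z)%R by rewrite ltz_nat.
have rS : (m %% N)%Z \in sg_pred S by rewrite /modz rpredB.
have := modz_ge0 m (Num.Theory.lt0r_neq0 N_gt0); have := ltz_pmod m N_gt0.
case: (m %% N)%Z rS => // r rS r_lt _; have [-> //|r0] := posnP r.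
by have := N_min r; rewrite r0 rS leqNgt -ltz_nat r_lt => /(_ isT).
Qed.

Lemma order_modulo (G : zmodType) (K : subgrp G) (g : G) :
  exists N : nat, forall m : int, (g *~ m \in sg_pred K) = (N %| m)%Z.
Proof.
pose S : pred int := fun m => g *~ m \in sg_pred K.
have S0 : 0 \in S by rewrite -topredE /S /= rpred0.
have SB m n : m \in S -> n \in S -> m - n \in S.
  by rewrite -!topredE /S /= mulrzBr; apply: rpredB.
exact: subgrp_int_principal (SubGrp S0 SB).
Qed.

Lemma pair_mulrz (U V : zmodType) (u : U) (v : V) (n : int) : (u, v) *~ n = (u *~ n, v *~ n).
Proof.
have [] := (raddfMz (@fst U V) n (u, v), raddfMz (@snd U V) n (u, v)).
by case: (_ *~ n) => x y /= -> ->.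
Qed.

(* With [E] the extension of [K] given by [t] and [N] the order of [g] modulo [K], the quotient
   of [E * Z] by [(e, - N)], where [e] lies above [N g], extends the group generated by [K], [g]. *)
Section AdjoinElement.
Variables (F : fieldType) (G : zmodType) (K : subgrp G) (t : G -> G -> F).
Hypothesis tK : pcocycle K t.
Variables (g : G) (N : nat).
Hypothesis gN : forall m, (g *~ m \in sg_pred K) = (N %| m)%Z.
Variable e : cocycle_ext tK.
Hypothesis eE : ext_base e = g *+ N.
Hypothesis e0 : N = 0%N -> e = 0.

Local Notation M := (cocycle_ext tK * int)%type.

Definition adjoin_base (m : M) : G := ext_base m.1 + g *~ m.2.

Lemma adjoin_base_is_zmod_morphism : zmod_morphism adjoin_base.
Proof. by move=> [p m] [q n]; rewrite /adjoin_base raddfB mulrzBr opprD addrACA. Qed.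
HB.instance Definition _ := GRing.isZmodMorphism.Build M G adjoin_base adjoin_base_is_zmod_morphism.

Definition in_adjoin_relations : pred M := fun m => asbool (exists q : int, m = (e, - N%:Z) *~ q).

Lemma in_adjoin_relations0 : 0 \in in_adjoin_relations.
Proof. by apply/asboolP; exists 0. Qed.

Lemma in_adjoin_relationsB m n :
  m \in in_adjoin_relations -> n \in in_adjoin_relations -> m - n \in in_adjoin_relations.
Proof.
by move=> /asboolP [p ->] /asboolP [q ->]; apply/asboolP; exists (p - q); rewrite mulrzBr.
Qed.

Definition adjoin_relations : subgrp M := SubGrp in_adjoin_relations0 in_adjoin_relationsB.

Definition adjoin_scalar a : quot adjoin_relations := qproj adjoin_relations (ext_scalar tK a, 0).

Lemma adjoin_scalarM a b : a != 0 -> b != 0 ->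
  adjoin_scalar (a * b) = adjoin_scalar a + adjoin_scalar b.
Proof. by move=> a0 b0; rewrite /adjoin_scalar -raddfD ext_scalarM. Qed.

Lemma adjoin_scalar_inj a b : a != 0 -> b != 0 -> adjoin_scalar a = adjoin_scalar b -> a = b.
Proof.
move=> a0 b0 /eqP; rewrite qproj_eqP => /asboolP [q]; rewrite pair_mulrz => -[abE].
move=> /esym/eqP; rewrite mulrzz mulf_eq0 oppr_eq0 => N_or_q.
apply: (@ext_scalar_inj _ _ _ _ tK) => //; apply/eqP; rewrite -subr_eq0 abE.
by case/orP: N_or_q => [/eqP [/e0 ->]|/eqP ->]; rewrite ?mul0rz ?mulr0z.
Qed.

Lemma adjoin_kernel m : adjoin_base m = 0 ->
  exists2 a, a != 0 & qproj adjoin_relations m = adjoin_scalar a.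
Proof.
case: m => p m; rewrite /adjoin_base /= => pm0.
have : g *~ m \in sg_pred K by rewrite -[g *~ m](addKr (ext_base p)) pm0 addr0 rpredN ext_base_in.
rewrite gN => /dvdzP [q mE]; have [|a a0 aE] := @ext_kernel _ _ _ _ _ (p + e *~ q).
  by rewrite raddfD raddfMz /= eE -pm0 mE [q * _]mulrC mulrzA -pmulrn.
exists a => //; apply/eqP; rewrite qproj_eqP; apply/asboolP; exists (- q).
rewrite pair_mulrz mE -aE; congr (_, _); first by rewrite /= mulrNz opprD addrA subrr add0r.
by rewrite /= subr0 mulrzz mulrNN mulrC.
Qed.

Definition in_adjoin_grp : pred G := fun x => asbool (exists m, adjoin_base m = x).

Lemma in_adjoin_grp0 : 0 \in in_adjoin_grp.
Proof. by apply/asboolP; exists 0; rewrite raddf0. Qed.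

Lemma in_adjoin_grpB x y : x \in in_adjoin_grp -> y \in in_adjoin_grp -> x - y \in in_adjoin_grp.
Proof.
by move=> /asboolP [m <-] /asboolP [n <-]; apply/asboolP; exists (m - n); rewrite raddfB.
Qed.

Definition adjoin_grp : subgrp G := SubGrp in_adjoin_grp0 in_adjoin_grpB.

Lemma mem_adjoin_gen : g \in in_adjoin_grp.
Proof. by apply/asboolP; exists (0, 1); rewrite /adjoin_base raddf0 add0r mulr1z. Qed.

Definition adjoin_lift (x : G) : M := (ext_lift tK x 1, 0).

Lemma adjoin_liftK x : x \in sg_pred K -> adjoin_base (adjoin_lift x) = x.
Proof. by move=> xK; rewrite /adjoin_base mulr0z addr0; case: (ext_liftE tK xK (oner_neq0 F)). Qed.

Lemma mem_adjoin_sub x : x \in sg_pred K -> x \in in_adjoin_grp.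
Proof. by move=> xK; apply/asboolP; exists (adjoin_lift x); apply: adjoin_liftK. Qed.

Lemma adjoin_liftD x y : x \in sg_pred K -> y \in sg_pred K ->
  adjoin_lift x + adjoin_lift y = (ext_scalar tK (t x y), 0) + adjoin_lift (x + y).
Proof.
move=> xK yK; have [x1 t0] := (oner_neq0 F, pcocycle_neq0 tK).
rewrite /adjoin_lift -[LHS]/(ext_lift tK x 1 + ext_lift tK y 1, 0).
rewrite -[RHS]/(ext_scalar tK (t x y) + ext_lift tK (x + y) 1, 0); congr (_, _).
rewrite /ext_scalar !ext_liftD ?rpredD ?mulf_neq0 ?invr_neq0 ?t0 ?rpred0 // add0r.
by rewrite (pcocycle0l tK) ?rpredD // !mul1r mulr1 mulfVK ?t0 ?rpred0.
Qed.

Lemma adjoin_section : exists s : G -> M,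
  (forall x, x \in in_adjoin_grp -> adjoin_base (s x) = x) /\
  (forall x, x \in sg_pred K -> s x = adjoin_lift x).
Proof.
suff /choice [s sP] : forall x, exists m : M,
    (x \in in_adjoin_grp -> adjoin_base m = x) /\ (x \in sg_pred K -> m = adjoin_lift x).
  by exists s; split=> x; [apply: (sP x).1|apply: (sP x).2].
move=> x; have [xK|xK] := boolP (x \in sg_pred K).
  by exists (adjoin_lift x); split=> // _; apply: adjoin_liftK.
by have [/asboolP [m mE]|_] := boolP (x \in in_adjoin_grp); [exists m|exists 0].
Qed.

Lemma pcocycle_adjoin_grp : exists2 u, pcocycle adjoin_grp u & extends t u.
Proof.
have [s [sK s_lift]] := adjoin_section.
pose sect x := qproj adjoin_relations (s x).
have [|||||||u uL uE] :=
  @section_cocycle F G adjoin_grp _ +%R (fun a v => adjoin_scalar a + v) sect.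
- exact: addrA.
- by move=> *; apply: addrC.
- by move=> a b v a0 b0; rewrite adjoin_scalarM // addrA.
- by move=> a v w; rewrite addrA.
- by move=> a x w _; rewrite addrCA.
- by move=> x a b _ a0 b0 ab; apply: (adjoin_scalar_inj a0 b0); apply: (addIr (sect x)) ab.
- move=> x y xL yL; have [|a a0 aE] := @adjoin_kernel (s x + s y - s (x + y)).
    by rewrite raddfB raddfD /= !sK ?subrr //; apply: (rpredD xL yL).
  by exists a => //; rewrite -aE -!raddfD subrK.
exists u => // a b; have [t_dom _ _] := tK; have [u_dom _ _] := uL.
move=> tab; have := tab; rewrite t_dom => /andP [aK bK].
apply: adjoin_scalar_inj => //; first by rewrite u_dom !mem_adjoin_sub.
apply: (addIr (sect (a + b))); rewrite -uE ?mem_adjoin_sub // -!raddfD.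
by rewrite !s_lift ?rpredD // adjoin_liftD.
Qed.
End AdjoinElement.

Lemma pcocycle_adjoin (F : fieldType) (G : zmodType) (K : subgrp G) (t : G -> G -> F) (g : G) :
  pcocycle K t -> exists L u, [/\ pcocycle L u, extends t u & g \in sg_pred L].
Proof.
move=> tK; have [N gN] := order_modulo K g.
have gNK : g *+ N \in sg_pred K by rewrite pmulrn gN dvdzz.
have [e eE e0] : exists2 e : cocycle_ext tK, ext_base e = g *+ N & N = 0%N -> e = 0.
  have [->|N0] := eqVneq N 0%N; first by exists 0; rewrite ?raddf0.
  exists (ext_lift tK (g *+ N) 1); last by move=> N0'; rewrite N0' in N0.
  by case: (ext_liftE tK gNK (oner_neq0 F)).
have [u uL tu] := pcocycle_adjoin_grp gN eE e0.
by exists (adjoin_grp tK g), u; split=> //; apply: mem_adjoin_gen.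
Qed.

Lemma cocycle_extension (F : fieldType) (G : zmodType) (K : subgrp G) (t : G -> G -> F) :
  pcocycle K t -> exists2 u, sym2cocycle u & extends t u.
Proof.
move=> /maximal_pcocycle [L [u [uL tu L_max]]]; exists u => //.
have LT g : g \in sg_pred L.
  by have [M [v [vM uv]]] := pcocycle_adjoin g uL; apply: (L_max M v).
have [u_dom uA uC] := uL.
by split=> [a b|]; [rewrite u_dom !LT|split=> [a b e|a b]; [apply: uA|apply: uC]].
Qed.

(** * Graded-central-simple algebras as loop algebras *)

Lemma centroid_cocycle (F : fieldType) (G : zmodType) (A : gradedAlg F G)
    (gcsA : graded_central_simple A) : let H := centroid_subgrp gcsA in
  exists (u : G -> gcar (centroid_alg A)) (t : G -> G -> F), [/\ pcocycle H t,
    forall h, h \in sg_pred H -> homog_centroid h (cval (u h)) /\ injective (cval (u h)) &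
    forall h k, h \in sg_pred H -> k \in sg_pred H ->
      gmul (centroid_alg A) (u h) (u k) = t h k *: u (h + k)].
Proof.
move=> H; have [gsA _] := gcsA; have [_ [sqA _]] := gsA.
have /choice [u uP] : forall h, exists z : gcar (centroid_alg A),
    h \in sg_pred H -> homog_centroid h (cval z) /\ exists x, cval z x != 0.
  move=> h; have [/asboolP [c [x [cH cx]]]|_] := boolP (h \in sg_pred H); last by exists 0.
  exists (centroid_elt c) => _; have cE := centroid_eltE cH.1.
  by rewrite /homog_centroid /= cE; split=> //; exists x.
have uI h : h \in sg_pred H -> injective (cval (u h)).
  by move=> /uP [uh [x ux]]; apply: homog_centroid_inj uh ux.
have [|||||||t tH tE] :=
  @section_cocycle F G H _ (gmul (centroid_alg A)) (fun a z => a *: z) u; last first.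
- by exists u, t; split=> // h hH; split; [case: (uP h hH)|apply: uI].
- move=> h k hH kH; have [[uh _] [uk [x ukx]]] := (uP h hH, uP k kH).
  have [|uhk [y uhky]] := uP (h + k); first exact: rpredD.
  have [a aE] := homog_centroid_line gcsA uhk uhky (homog_centroid_comp uh uk).
  exists a; last by apply: cval_ext => z; rewrite cval_mul cval_scale; apply: aE.
  by apply: contraNneq ukx => a0; apply/eqP/(uI h hH); rewrite linear0 [LHS]aE /= a0 scale0r.
- move=> h a b /uP [_ [x ux]] _ _ /(congr1 (fun z => cval z x)); rewrite !cval_scale.
  by move/eqP; rewrite -subr_eq0 -scalerBl scaler_eq0 (negbTE ux) orbF subr_eq0 => /eqP.
- by move=> a h z _; apply: cval_ext => x; rewrite cval_mul !cval_scale cval_mul linearZ.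
- by move=> a z w; apply: cval_ext => x; rewrite cval_mul !cval_scale cval_mul.
- by move=> a b z _ _; rewrite scalerA.
- move=> h k _ _; apply: cval_ext => x; rewrite !cval_mul.
  exact: centroid_commute sqA (cval_centroid _) (cval_centroid _) x.
- by move=> z w v; apply: cval_ext => x; rewrite !cval_mul.
Qed.

Section Fold.
Variables (F : fieldType) (G : zmodType) (H : subgrp G) (B : gradedAlg F G).
Variable u : G -> {linear gcar B -> gcar B}.
Hypothesis u_homog : forall h, h \in sg_pred H -> homog_centroid h (u h).
Hypothesis u0 : u 0 =1 id.
Hypothesis uD : forall h k x, h \in sg_pred H -> k \in sg_pred H -> u h (u k x) = u (h + k) x.
Local Notation pi := (qproj H).

Lemma action_gcomp h g x : h \in sg_pred H -> x \in gcomp B g -> u h x \in gcomp B (h + g).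
Proof. by move=> /u_homog [_ uh]; apply: uh. Qed.

Lemma actionK h : h \in sg_pred H -> cancel (u h) (u (- h)).
Proof. by move=> hH x; rewrite uD ?rpredN // addNr u0. Qed.

Lemma action_mul h k x y : h \in sg_pred H -> k \in sg_pred H ->
  gmul B (u h x) (u k y) = u (h + k) (gmul B x y).
Proof.
move=> hH kH; have [[[_ uhM] _] [[_ ukM] _]] := (u_homog hH, u_homog kH).
by rewrite -(uhM x _).1 -(ukM x y).2 uD.
Qed.

(* [fold] moves a homogeneous element within its [H]-orbit to the degree of the coset
   representative, so that the components of these degrees make up the algebra of orbits. *)
Definition fold : {linear gcar B -> gcar B} := glue (fun g => u (coset_rep H g - g)).

Lemma fold_homog g x : x \in gcomp B g -> fold x = u (coset_rep H g - g) x.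
Proof. exact: glue_homog. Qed.

Lemma fold_gcomp g x : x \in gcomp B g -> fold x \in gcomp B (coset_rep H g).
Proof.
by move=> xg; rewrite (fold_homog xg) -{2}(subrK g (coset_rep H g)) action_gcomp ?coset_rep_sub.
Qed.

Definition fold_mul (x y : gcar B) : gcar B := fold (gmul B x y).

Lemma fold_mul_bilinear : bilinear_for *:%R *:%R fold_mul.
Proof. by split=> z a x y; rewrite /fold_mul ?linearPl ?linearPr linearP. Qed.
HB.instance Definition _ := bilinear_isBilinear.Build F (gcar B) (gcar B) (gcar B) *:%R *:%R
  fold_mul fold_mul_bilinear.

Definition fold_galg : galg F G := GAlg fold_mul (gcomp B).

Definition folded : galg F (quot H) := loop (fun a : quot H => q_val a) fold_galg.

Let comp_subspace (a : quot H) : subspace (gcomp B (q_val a)).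
Proof. by split=> [|c x y xB yB]; rewrite ?rpred0 ?rpredD ?rpredZ. Qed.

Let comp_mul (a b : quot H) x y : x \in gcomp B (q_val a) -> y \in gcomp B (q_val b) ->
  fold_mul x y \in gcomp B (q_val (a + b)).
Proof.
move=> xa yb; have -> : q_val (a + b) = coset_rep H (q_val a + q_val b).
  by rewrite /coset_rep qprojD !qproj_val.
exact/fold_gcomp/gmul_gcomp.
Qed.

Let genP := @loop_genP F (quot H) G (@q_val G H) fold_galg.
Let compP := @loop_compP F (quot H) G (@q_val G H) fold_galg.

Lemma folded_galg : is_galg folded.
Proof. exact: (funalg_galg (m := fold_mul) comp_subspace comp_mul genP compP). Qed.

Canonical folded_gradedAlg := GradedAlg folded_galg.

Definition unfold (g : G) (x : gcar folded) : gcar B := u (g - coset_rep H g) (fun_at x (pi g)).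

Lemma unfold_linear g : linear (unfold g).
Proof. by move=> a x y; rewrite /unfold fun_at_linear linearP. Qed.
HB.instance Definition _ g :=
  GRing.isLinear.Build F (gcar folded) (gcar B) *:%R (unfold g) (unfold_linear g).

Let delta (a : quot H) (x : gcar B) : gcar folded :=
  fun_delta fold_mul (loop_comp (@q_val G H) fold_galg) a x.

Let unfold_delta g x : x \in gcomp B (coset_rep H g) ->
  unfold g (delta (pi g) x) = u (g - coset_rep H g) x.
Proof. by move=> xB; rewrite /unfold (fun_at_delta _ _ genP xB) fdelta_id. Qed.

Let deltaP g y : y \in gcomp folded (pi g) ->
  exists2 x, x \in gcomp B (coset_rep H g) & y = delta (pi g) x.
Proof.
move=> yg; exists (fun_at y (pi g)); last exact: (fun_gcompE genP compP yg).
exact: (fun_at_in (P := fun a => gcomp B (q_val a)) comp_subspace genP).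
Qed.

Let delta_mul g h x y : x \in gcomp B (coset_rep H g) -> y \in gcomp B (coset_rep H h) ->
  gmul folded (delta (pi g) x) (delta (pi h) y) = delta (pi (g + h)) (fold_mul x y).
Proof.
by move=> xg yh; rewrite qprojD; apply: (fun_delta_mul _ comp_subspace comp_mul genP xg yh).
Qed.

Lemma unfold_chart : tloop_chart pi (fun _ _ => 1) folded_gradedAlg B unfold.
Proof.
split=> [g y /deltaP [x xg ->]|g y /deltaP [x xg ->]|g y yg
  |g h y z /deltaP [x xg ->] /deltaP [w wh ->]].
- rewrite /= unfold_delta // -[in gcomp B g](subrK (coset_rep H g) g).
  by rewrite action_gcomp ?sub_coset_rep.
- rewrite /= unfold_delta // => ux0; suff -> : x = 0 by apply: (fun_delta0 _ _ comp_subspace genP).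
  by apply: (can_inj (actionK (sub_coset_rep H g))); rewrite ux0 linear0.
- exists (delta (pi g) (fold y)); first exact: (fun_delta_gcomp _ genP compP (fold_gcomp yg)).
  rewrite /= unfold_delta ?fold_gcomp // (fold_homog yg) uD ?sub_coset_rep ?coset_rep_sub //.
  by rewrite addrA subrK subrr u0.
have xwB := gmul_gcomp xg wh.
have xw_rep : coset_rep H (coset_rep H g + coset_rep H h) = coset_rep H (g + h).
  by rewrite /coset_rep qprojD !qproj_val -qprojD.
rewrite scale1r (delta_mul xg wh) /= !unfold_delta -?xw_rep ?fold_gcomp // xw_rep.
rewrite action_mul ?sub_coset_rep //.
rewrite /fold_mul (fold_homog xwB) xw_rep.
rewrite uD ?sub_coset_rep // -?xw_rep ?coset_rep_sub //.
by congr (u _ _); rewrite [RHS]addrA subrK opprD addrACA.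
Qed.
End Fold.

Lemma untwist_action (F : fieldType) (G : zmodType) (K : subgrp G) (B : gradedAlg F G)
    (t : G -> G -> F) (u : G -> {linear gcar B -> gcar B}) : sym2cocycle t ->
  (forall h, h \in sg_pred K -> homog_centroid h (u h) /\ injective (u h)) ->
  (forall h k x, h \in sg_pred K -> k \in sg_pred K -> u h (u k x) = t h k *: u (h + k) x) ->
  let C := twist_gradedAlg B (fun g h => (t g h)^-1) in
  exists v : G -> {linear gcar C -> gcar C}, [/\
    forall h, h \in sg_pred K -> homog_centroid h (v h),
    v 0 =1 id &
    forall h k x, h \in sg_pred K -> k \in sg_pred K -> v h (v k x) = v (h + k) x].
Proof.
move=> tC uH uM C; have t0 := cocycle_neq0 tC; have tVC := sym2cocycleV tC.
have /choice [v vP] : forall h, exists d : {linear gcar C -> gcar C}, h \in sg_pred K ->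
    homog_centroid h d /\ forall g x, x \in gcomp B g -> d x = (t h g)^-1 *: u h x.
  move=> h; have [hK|_] := boolP (h \in sg_pred K); last by exists idfun.
  have [d dH dE] := homog_centroid_lift (pi := idfun) tVC (twist_chart B _) (uH h hK).1.
  by exists d.
exists v; split=> [h hK||h k x hK kK]; first by case: (vP h hK).
  have [_ vE] := vP 0 (rpred0 _); have u0 x : u 0 x = t 0 0 *: x.
    by apply: (uH 0 (rpred0 _)).2; rewrite uM ?rpred0 // addr0 linearZ.
  apply: (linear_homog_ext (f' := idfun)) => g x xg.
  by rewrite /= (vE g) // u0 (cocycle0l tC) scalerA mulVf ?scale1r.
have [[_ vhE] [_ vkE]] := (vP h hK, vP k kK); have [_ vhkE] := vP (h + k) (rpredD hK kK).
apply: (linear_homog_ext (f := v h \o v k) (f' := v (h + k))) => g {}x xg /=.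
have ukx : u k x \in gcomp B (k + g) by apply: (uH k kK).1.2.
rewrite (vkE g) // linearZ /= (vhE (k + g)) // uM // (vhkE g) // !scalerA; congr (_ *: _).
by rewrite -[t h k](mulfK (t0 (h + k) g)) (cocycleA tC); field; rewrite !t0.
Qed.

Lemma loop_decomposition (F : fieldType) (G : zmodType) (B : gradedAlg F G) :
  graded_central_simple B -> exists (H : subgrp G) (A : gradedAlg F (quot H)) (t : G -> G -> F),
    [/\ central_simple A, sym2cocycle t & giso B (tloop (qproj H) A t)].
Proof.
move=> gcsB; have [gsB cB] := gcsB; pose H := centroid_subgrp gcsB.
have [u [t0 [t0H uH uM]]] := centroid_cocycle gcsB; have [t tC t0t] := cocycle_extension t0H.
have t_neq0 g h := cocycle_neq0 tC g h.
have [|v [vH v0 vM]] := untwist_action (u := fun h => cval (u h)) tC uH.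
  move=> h k x hH kH; rewrite /= -cval_mul uM // cval_scale t0t //.
  by have [-> _ _] := t0H; rewrite hH.
have chart := chart_comp (unfold_chart vH v0 vM) (untwist_chart B t_neq0).
set A := folded_gradedAlg vH in chart.
have {}chart : tloop_chart (qproj H) t A B _ := chart_eq chart (fun g h => mulr1 _).
have gsA : graded_simple A := base_graded_simple (@qproj_surj G H) chart gsB.
have suppA a : centroid_support A a -> a = 0.
  rewrite -[a]qproj_val => /(base_centroid_support (@qproj_surj G H) tC chart) aH.
  by apply/eqP; rewrite qproj_eq0; apply/asboolP.
have gcA : graded_central A := base_graded_central (@qproj_surj G H) tC chart cB.
exists H, A, t; split=> //.
  by split; [apply: graded_simple_simple|apply: graded_central_central].
have [phi loop_chart] := tloop_has_chart (qproj H) A t.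
exact: chart_unique chart loop_chart.
Qed.

(** * Loop algebras of central simple algebras *)

Lemma tloop_graded_central_simple (F : fieldType) (G Gb : zmodType) (pi : {additive G -> Gb})
    (t : G -> G -> F) (A : gradedAlg F Gb) : (forall a, exists g, pi g = a) ->
  central_simple A -> sym2cocycle t -> graded_central_simple (tloop pi A t).
Proof.
move=> pi_surj [/simple_graded_simple gsA cA] tC; have [phi chart] := tloop_has_chart pi A t.
by split; [apply: chart_graded_simple chart gsA|apply: chart_graded_central chart gsA cA].
Qed.

Lemma centroid_tloop_giso (F : fieldType) (G : zmodType) (H : subgrp G) (A : gradedAlg F (quot H))
    (t : G -> G -> F) : central_simple A -> sym2cocycle t ->
  giso (centroid_alg (tloop (qproj H) A t)) (tgrpalg H (restr H t)).
Proof.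
move=> csA tC; have [/simple_graded_simple gsA cA] := csA; have surj := @qproj_surj G H.
have [gsL _] := tloop_graded_central_simple surj csA tC.
have [phi chart] := tloop_has_chart (qproj H) A t.
have st k l : qproj H k = 0 -> qproj H l = 0 -> restr H t k l = t k l.
  by move=> /eqP; rewrite qproj_eq0 => kH /eqP; rewrite qproj_eq0 => lH; rewrite /restr kH lH.
have [psi C_chart] := centroid_has_chart surj tC chart gsA cA st (centroid_galg gsL).
have [psi' FH_chart] := tgrpalg_has_chart H (restr H t).
exact: chart_unique C_chart FH_chart.
Qed.

Lemma giso_tloop_chart (F : fieldType) (G Gb : zmodType) (pi : {additive G -> Gb}) (t : G -> G -> F)
    (A : gradedAlg F Gb) (B : gradedAlg F G) : giso (tloop pi A t) B ->
  exists phi, tloop_chart pi t A B phi.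
Proof.
move=> /(giso_chart (A := twist_gradedAlg (loop_gradedAlg pi A) t)) [f f_chart].
have [phi chart] := tloop_has_chart pi A t; eexists.
by apply: chart_eq (chart_comp (rho := idfun) chart f_chart) _ => g h; rewrite mul1r.
Qed.

Lemma tloop_giso_kernel (F : fieldType) (G Gb Gc : zmodType)
    (pi : {additive G -> Gb}) (rho : {additive G -> Gc}) (s t : G -> G -> F)
    (A : gradedAlg F Gb) (C : gradedAlg F Gc) :
  (forall a, exists g, pi g = a) -> (forall a, exists g, rho g = a) ->
  central_simple A -> central_simple C -> sym2cocycle s -> sym2cocycle t ->
  giso (tloop pi A s) (tloop rho C t) -> forall k, pi k = 0 <-> rho k = 0.
Proof.
move=> pi_surj rho_surj [/simple_graded_simple gsA cA] [/simple_graded_simple gsC cC] sC tC AC k.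
have [phi chartA] := giso_tloop_chart (B := twist_gradedAlg (loop_gradedAlg rho C) t) AC.
have [psi chartC] := tloop_has_chart rho C t.
rewrite -(chart_centroid_support pi_surj sC chartA k gsA cA).
exact: chart_centroid_support rho_surj tC chartC k gsC cC.
Qed.

Lemma tloop_giso_of_twist (F : fieldType) (G Gb : zmodType) (pi : {additive G -> Gb})
    (s t : G -> G -> F) (mu : Gb -> Gb -> F) (A C : gradedAlg F Gb) :
  cohomologous s (fun g h => mu (pi g) (pi h) * t g h) -> giso (twist A mu) C ->
  giso (tloop pi A s) (tloop pi C t).
Proof.
move=> [gam [gam0 sE]] /(giso_chart (A := twist_gradedAlg A mu)) [f f_chart].
have [phi chartA] := tloop_has_chart pi A s; have [psi chartC] := tloop_has_chart pi C t.
have chartAC := chart_comp (rho := idfun) (twist_chart A mu) f_chart.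
have {}chartC := chart_cochain gam0 (chart_comp chartAC chartC).
apply: (chart_unique chartA); apply: (chart_eq chartC) => g h.
by rewrite sE mul1r [t g h * _]mulrC.
Qed.

Section Transition.
Variables (F : fieldType) (G Gb : zmodType) (pi : {additive G -> Gb}) (s t : G -> G -> F).
Variables (A C : gradedAlg F Gb) (B : gradedAlg F G).
Variables (phi : G -> {linear gcar A -> gcar B}) (psi : G -> {linear gcar C -> gcar B}).
Variable psi' : G -> {linear gcar B -> gcar C}.
Hypothesis pi_surj : forall a, exists g, pi g = a.
Hypotheses (sC : sym2cocycle s) (tC : sym2cocycle t).
Hypothesis chartA : tloop_chart pi s A B phi.
Hypothesis chartC : tloop_chart pi t C B psi.
Hypothesis psi'_gcomp : forall g y, psi' g y \in gcomp C (pi g).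
Hypothesis psi'K : forall g y, y \in gcomp B g -> psi g (psi' g y) = y.
Hypotheses (gsA : graded_simple A) (gsC : graded_simple C) (cC : central C).

Let r g h := s g h / t g h.
Let t0 := cocycle_neq0 tC.
Let rC : sym2cocycle r := sym2cocycleM sC (sym2cocycleV tC).

Definition transition g : {linear gcar A -> gcar C} := psi' g \o phi g.

Lemma transition_gcomp g x : transition g x \in gcomp C (pi g).
Proof. exact: psi'_gcomp. Qed.

Lemma psi_transition g x : x \in gcomp A (pi g) -> psi g (transition g x) = phi g x.
Proof. by move=> xg; rewrite /= psi'K ?(chart_gcomp chartA). Qed.

Lemma transition_eq0 g x : x \in gcomp A (pi g) -> transition g x = 0 -> x = 0.
Proof.
by move=> xg x0; apply: (chart_eq0 chartA xg); rewrite -psi_transition // x0 linear0.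
Qed.

Lemma transition_surj g z : z \in gcomp C (pi g) ->
  exists2 x, x \in gcomp A (pi g) & transition g x = z.
Proof.
move=> zg; have [x xg xE] := chart_surj chartA (chart_gcomp chartC zg); exists x => //.
by apply: (chart_inj chartC (transition_gcomp g x) zg); rewrite psi_transition.
Qed.

Lemma transition_mul g h x y : x \in gcomp A (pi g) -> y \in gcomp A (pi h) ->
  gmul C (transition g x) (transition h y) = r g h *: transition (g + h) (gmul A x y).
Proof.
move=> xg yh; have xyA : gmul A x y \in gcomp A (pi (g + h)) by rewrite raddfD gmul_gcomp.
have xyC : gmul C (transition g x) (transition h y) \in gcomp C (pi (g + h)).
  by rewrite raddfD gmul_gcomp ?transition_gcomp.
apply: (chart_inj chartC xyC); first by rewrite rpredZ ?transition_gcomp.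
have := chart_mul chartC (transition_gcomp g x) (transition_gcomp h y).
rewrite !psi_transition // (chart_mul chartA) // => E; apply: (scalerI (t0 g h)); rewrite -E.
by rewrite linearZ /= psi'K ?(chart_gcomp chartA) // scalerA [t g h * _]mulrC mulfVK.
Qed.

Definition shift_factor h (c : F) := forall g x, x \in gcomp A (pi g) ->
  r h g *: transition (h + g) x = c *: transition g x.

(* An element of degree [h] of the centroid of [B] acts as the shift by [h] along [phi], hence, as
   [C] is central, as a multiple of it along [psi]. *)
Lemma shift_factor_exists h : pi h = 0 -> exists2 c, c != 0 & shift_factor h c.
Proof.
move=> h0.
have shift_in (D : gradedAlg F Gb) g x : x \in gcomp D (pi g) -> x \in gcomp D (pi (h + g)).
  by rewrite raddfD h0 add0r.
have [d dH dE] := shift_homog_centroid sC chartA h0.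
have [c cE] := homog_centroid_is_shift pi_surj tC chartC gsC cC dH.
have shift : shift_factor h c.
  move=> g x xg; have Egx := transition_gcomp g x.
  apply: (chart_inj chartC (g := h + g)); rewrite ?rpredZ ?transition_gcomp ?shift_in //.
  apply: (scalerI (t0 h g)); rewrite !linearZ /= psi'K ?(chart_gcomp chartA) ?shift_in //.
  by rewrite !scalerA mulfVK // -dE // -[in LHS](psi_transition xg) cE.
exists c => //; have [g [x [xg x0]]] := homog_neq0_over pi_surj gsA.1; apply: contraNneq x0 => c0.
apply/eqP/(transition_eq0 (shift_in _ g x xg)); have := shift g x xg; rewrite c0 scale0r => /eqP.
by rewrite scaler_eq0 (negbTE (cocycle_neq0 rC _ _)) => /eqP.
Qed.

Lemma shift_factorM h k a b c : pi h = 0 -> pi k = 0 ->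
  shift_factor h a -> shift_factor k b -> shift_factor (h + k) c -> r h k * c = a * b.
Proof.
move=> h0 k0 ha kb hkc; have [g [x [xg x0]]] := homog_neq0_over pi_surj gsA.1.
have xkg : x \in gcomp A (pi (k + g)) by rewrite raddfD k0 add0r.
have : (r h k * c) *: transition g x = (a * b) *: transition g x.
  transitivity ((r h k * r (h + k) g) *: transition (h + k + g) x).
    by rewrite -[LHS]scalerA -[RHS]scalerA hkc.
  rewrite (cocycleA rC) [r h _ * _]mulrC -[LHS]scalerA -addrA ha //.
  by rewrite [LHS]scalerA [r k g * a]mulrC -[LHS]scalerA kb // scalerA.
move/eqP; rewrite -subr_eq0 -scalerBl scaler_eq0 subr_eq0 => /orP [/eqP //|/eqP].
by move=> /(transition_eq0 xg)/eqP; rewrite (negbTE x0).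
Qed.
End Transition.

Section BaseIsomorphism.
Variables (F : fieldType) (G : zmodType) (H : subgrp G) (A C : gradedAlg F (quot H)).
Local Notation pi := (qproj H).

Lemma invariant_transition_chart (t : G -> G -> F) (mu : quot H -> quot H -> F) (gam : G -> F)
    (E : G -> {linear gcar A -> gcar C}) :
  (forall g x, E g x \in gcomp C (pi g)) ->
  (forall g x, x \in gcomp A (pi g) -> E g x = 0 -> x = 0) ->
  (forall g z, z \in gcomp C (pi g) -> exists2 x, x \in gcomp A (pi g) & E g x = z) ->
  (forall g h x y, x \in gcomp A (pi g) -> y \in gcomp A (pi h) ->
     gmul C (E g x) (E h y) = t g h *: E (g + h) (gmul A x y)) ->
  (forall g, gam g != 0) ->
  (forall g h, t g h = mu (pi g) (pi h) * coboundary gam g h) ->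
  (forall h g x, h \in sg_pred H -> x \in gcomp A (pi g) ->
     (gam (h + g))^-1 *: E (h + g) x = (gam g)^-1 *: E g x) ->
  tloop_chart idfun mu A C (fun a => (gam (q_val a))^-1 \*: E (q_val a)).
Proof.
move=> E_gcomp E_eq0 E_surj E_mul gam0 tE E_inv.
have E_rep a g x : pi g = a -> x \in gcomp A a ->
    (gam (q_val a))^-1 *: E (q_val a) x = (gam g)^-1 *: E g x.
  move=> <- xg; rewrite -[q_val (pi g)](subrK g); apply: E_inv => //.
  by rewrite -qproj_eqP qproj_val.
split=> [a x xa|a x xa /= /eqP|a z za|a b x y xa yb] /=.
- by rewrite rpredZ // -{2}[a]qproj_val.
- rewrite scaler_eq0 invr_eq0 (negbTE (gam0 _)) => /eqP; apply: E_eq0.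
  by rewrite qproj_val.
- have [|x xa xE] := E_surj (q_val a) (gam (q_val a) *: z); first by rewrite rpredZ // qproj_val.
  by exists x; rewrite ?[pi _]qproj_val in xa * => //; rewrite /= xE scalerA mulVf ?scale1r.
rewrite linearZr_LR linearZl_LR /= E_mul ?qproj_val //.
rewrite (E_rep (a + b) (q_val a + q_val b)) ?gmul_gcomp //.
rewrite !scalerA tE !qproj_val /coboundary; congr (_ *: _); field.
by rewrite !gam0.
Qed.

Lemma chart_base_giso (s t : G -> G -> F) (B : gradedAlg F G) phi psi :
  graded_simple A -> graded_simple C -> central C -> sym2cocycle s -> sym2cocycle t ->
  tloop_chart pi s A B phi -> tloop_chart pi t C B psi ->
  exists mu, [/\ sym2cocycle mu, cohomologous s (fun g h => mu (pi g) (pi h) * t g h) &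
    giso (twist A mu) C].
Proof.
move=> gsA gsC cC sC tC chartA chartC; have surj := @qproj_surj G H.
have [psi' [psi'_gcomp psi'K _]] := chart_inverse chartC.
pose E := transition phi psi'; pose r g h := s g h / t g h.
have pi0 h : h \in sg_pred H -> pi h = 0 by rewrite -qproj_eq0 => /eqP.
have /choice [lam lamP] : forall h, exists c, h \in sg_pred H ->
    c != 0 /\ shift_factor pi s t phi psi' h c.
  move=> h; have [/pi0 h0|_] := boolP (h \in sg_pred H); last by exists 0.
  have [c c0 cP] := shift_factor_exists surj sC tC chartA chartC psi'_gcomp psi'K gsA gsC cC h0.
  by exists c.
have rC : sym2cocycle r := sym2cocycleM sC (sym2cocycleV tC).
have [||gam [mu [gam0 muC rE gamP]]] := @cocycle_descent _ _ H r lam rC.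
- by move=> h /lamP [].
- move=> h k hH kH; have [[_ hP] [_ kP]] := (lamP h hH, lamP k kH).
  have [_ hkP] := lamP _ (rpredD hH kH).
  exact: (shift_factorM surj sC tC chartA psi'K gsA (pi0 h hH) (pi0 k kH) hP kP hkP).
exists mu; split=> //.
  exists gam; split=> // g h; rewrite mulrAC -/(coboundary gam g h) -rE.
  by rewrite /r mulfVK // cocycle_neq0.
apply: (chart_unique (rho := idfun) (twist_chart A mu)).
apply: (invariant_transition_chart (E := E) _ _ _ _ gam0 rE) => [g x|g x|g z|g h x y|h g x hH xg].
- exact: transition_gcomp.
- exact: (transition_eq0 chartA psi'K).
- exact: (transition_surj chartA chartC psi'_gcomp psi'K).
- exact: (transition_mul tC chartA chartC psi'_gcomp psi'K).
have [lam0 lamE] := lamP h hH; apply: (scalerI (mulf_neq0 lam0 (gam0 g))).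
by rewrite -{1}gamP // !scalerA !mulfK // -lamE.
Qed.

Lemma twist_giso_of_tloop (s t : G -> G -> F) : central_simple A -> central_simple C ->
  sym2cocycle s -> sym2cocycle t -> giso (tloop pi A s) (tloop pi C t) ->
  exists mu, [/\ sym2cocycle mu, cohomologous s (fun g h => mu (pi g) (pi h) * t g h) &
    giso (twist A mu) C].
Proof.
move=> [/simple_graded_simple gsA _] [/simple_graded_simple gsC cC] sC tC AC.
have [phi chartA] := giso_tloop_chart (B := twist_gradedAlg (loop_gradedAlg pi C) t) AC.
have [psi chartC] := tloop_has_chart pi C t.
exact: chart_base_giso gsA gsC cC sC tC chartA chartC.
Qed.
End BaseIsomorphism.

Theorem theorem5p2 (F : fieldType) (G : zmodType) :
  (* (1) *)
  (forall B : galg F G, is_galg B -> graded_central_simple B ->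
     exists (H : subgrp G) (A : galg F (quot H)) (t : G -> G -> F),
       is_galg A /\ central_simple A /\ sym2cocycle t /\
       giso B (tloop (qproj H) A t))
  /\
  (* (2) *)
  (forall (H : subgrp G) (A : galg F (quot H)) (t : G -> G -> F),
     is_galg A -> central_simple A -> sym2cocycle t ->
     graded_central_simple (tloop (qproj H) A t) /\
     giso (centroid_alg (tloop (qproj H) A t)) (tgrpalg H (restr H t)))
  /\
  (* (3), "only if" part concerning the subgroups: H1 = H2 *)
  (forall (H1 H2 : subgrp G) (A1 : galg F (quot H1)) (A2 : galg F (quot H2))
          (t1 t2 : G -> G -> F),
     is_galg A1 -> central_simple A1 -> is_galg A2 -> central_simple A2 ->
     sym2cocycle t1 -> sym2cocycle t2 ->
     giso (tloop (qproj H1) A1 t1) (tloop (qproj H2) A2 t2) ->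
     sg_pred H1 =i sg_pred H2)
  /\
  (* (3), for H1 = H2 = H *)
  (forall (H : subgrp G) (A1 A2 : galg F (quot H)) (t1 t2 : G -> G -> F),
     is_galg A1 -> central_simple A1 -> is_galg A2 -> central_simple A2 ->
     sym2cocycle t1 -> sym2cocycle t2 ->
     (giso (tloop (qproj H) A1 t1) (tloop (qproj H) A2 t2) <->
      exists mu : quot H -> quot H -> F,
        sym2cocycle mu /\
        cohomologous t1 (fun a b => mu (qproj H a) (qproj H b) * t2 a b) /\
        giso (twist A1 mu) A2)).
Proof.
split; [|split; [|split]].
- move=> B gB gcsB; have [H [A [t [csA tC BA]]]] := @loop_decomposition F G (GradedAlg gB) gcsB.
  by exists H, A, t; split; first exact: gradedAlgP.
- move=> H A t gA csA tC; split; last exact: (@centroid_tloop_giso F G H (GradedAlg gA)).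
  exact: (@tloop_graded_central_simple F G _ _ t (GradedAlg gA) (@qproj_surj G H)).
- move=> H1 H2 A1 A2 t1 t2 gA1 csA1 gA2 csA2 t1C t2C L12 k.
  have := tloop_giso_kernel (A := GradedAlg gA1) (C := GradedAlg gA2)
    (@qproj_surj G H1) (@qproj_surj G H2) csA1 csA2 t1C t2C L12 k.
  by rewrite -!qproj_eq0 => -[k12 k21]; apply/eqP/eqP.
move=> H A1 A2 t1 t2 gA1 csA1 gA2 csA2 t1C t2C; split.
  move=> L12; have [mu [muC t12 A12]] :=
    twist_giso_of_tloop (A := GradedAlg gA1) (C := GradedAlg gA2) csA1 csA2 t1C t2C L12.
  by exists mu.
move=> [mu [muC [t12 A12]]].
exact: (@tloop_giso_of_twist F G _ _ t1 t2 mu (GradedAlg gA1) (GradedAlg gA2)).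
Qed.
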